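(* Let $\Sigma\subset G(r,r+2)$ be a congruence and let $\pi\subset\mathbb{P}^{r+2}$ be an $r$-dimensional projective subspace such that $\Sigma\subset\Omega_\pi$. Then $\Sigma$ has order $1$ if and only if $\phi^{-1}(\pi^*\times\{H\})\cap\Sigma$ is a line (possibly with the point $[\pi]$ removed) for all $H\in H_\pi$. Thus, in this case, the map $$\alpha:\Sigma\setminus\{[\pi]\}\to H_\pi\cong\mathbb{P}^1,\qquad \alpha(\sigma)=\mathbb{P}^r(\sigma)+\pi,$$ defines $\Sigma$ as a rational ruled surface.
   Context: Everything is over $\mathbb{C}$, $r\ge1$. $G(r,r+2)$ is the Grassmannian of $r$-dimensional linear subspaces of $\mathbb{P}^{r+2}$, in its Plücker embedding (lines are understood in this embedding); $\mathbb{P}^r(\sigma)$ is the subspace corresponding to $\sigma$. A congruence is a $2$-dimensional reduced irreducible closed subvariety $\Sigma\subset G(r,r+2)$; its order is the number of $\sigma\in\Sigma$ with $\mathbb{P}^r(\sigma)$ through a general point of $\mathbb{P}^{r+2}$. For an $r$-dimensional subspace $\pi$: $\Omega_\pi=\{\sigma\in G(r,r+2) : \dim(\mathbb{P}^r(\sigma)\cap\pi)\ge r-1\}$; $\pi^*$ is the dual space parametrizing hyperplanes of $\pi$; $H_\pi\cong\mathbb{P}^1$ is the pencil of hyperplanes of $\mathbb{P}^{r+2}$ containing $\pi$; $[\pi]$ is the point of $G(r,r+2)$ corresponding to $\pi$; and $\phi:\Omega_\pi\setminus\{[\pi]\}\to\pi^*\times H_\pi$ is the map $\phi(\sigma)=(\mathbb{P}^r(\sigma)\cap\pi,\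 \mathbb{P}^r(\sigma)+\pi)$, where $+$ denotes linear span. *)

(* Defs.v *)
From HB Require Import structures.
From mathcomp Require Import all_boot all_order all_algebra.
From mathcomp Require Import classical_sets cardinality reals complex.
From mathcomp Require Import mpoly.
Set Implicit Arguments.
Unset Strict Implicit.
Unset Printing Implicit Defensive.
Import GRing.Theory.
Local Open Scope classical_set_scope.
Local Open Scope ring_scope.

(* Linear subspaces of P^(m-1) are represented by vector subspaces of F^m, so
   dimensions are one more than the projective ones: [grass F k m] is the
   Grassmannian of (k-1)-dimensional linear subspaces of P^(m-1), and in
   particular [grass F 1 m] is P^(m-1) itself. *)
Definition grass (F : fieldType) (k m : nat) : set {vspace 'rV[F]_m} :=
  [set S | \dim S = k].

Definition pidx (k m : nat) : finType :=
  {t : k.-tuple 'I_m | sorted ltn [seq val i | i <- t]}.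

(* Vector of maximal minors of a basis of S, meant for \dim S = k; for k = 1
   these are the usual homogeneous coordinates of a point of P^(m-1). *)
Definition plucker_coord (F : fieldType) (k m : nat) (S : {vspace 'rV[F]_m}) :
    'rV[F]_#|pidx k m| :=
  \row_j \det (\matrix_(i < k, l < k)
    ((vbasis S)`_i : 'rV[F]_m) 0 (tnth (val (enum_val j)) l)).

Definition plucker (F : fieldType) (k m : nat) (S : {vspace 'rV[F]_m}) :
    {vspace 'rV[F]_#|pidx k m|} :=
  <[plucker_coord k S]>%VS.

Arguments plucker {F} k {m} S.

(* The Zariski topology of [grass F k m], induced by the Plücker embedding. *)
Definition zclosed (F : fieldType) (k m : nat) (Z : set {vspace 'rV[F]_m}) :=
  exists I : set {mpoly F[#|pidx k m|]},
    (forall p, I p -> exists d, p \is d.-homog) /\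
    Z = [set S | grass k S /\
           forall p, I p -> forall v, v \in plucker k S -> p.@[v 0] = 0].

Definition zirreducible (F : fieldType) (k m : nat)
    (X : set {vspace 'rV[F]_m}) :=
  X !=set0 /\
  forall A B, zclosed k A -> zclosed k B -> X `<=` A `|` B ->
    X `<=` A \/ X `<=` B.

Definition zchain (F : fieldType) (k m : nat) (X : set {vspace 'rV[F]_m})
    (d : nat) :=
  exists Z : nat -> set {vspace 'rV[F]_m},
    (forall i, (i <= d)%N ->
       [/\ zclosed k (Z i), zirreducible k (Z i) & Z i `<=` X]) /\
    (forall i, (i < d)%N -> Z i `<` Z i.+1).

Definition zdim (F : fieldType) (k m : nat) (X : set {vspace 'rV[F]_m})
    (d : nat) :=
  zchain k X d /\ ~ zchain k X d.+1.

(* A property of the general point of P^(m-1) holds off a proper closed set. *)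
Definition general_point (F : fieldType) (m : nat)
    (P : {vspace 'rV[F]_m} -> Prop) :=
  exists Z, [/\ zclosed 1 Z, Z `<` @grass F 1 m &
    forall x, (@grass F 1 m `\` Z) x -> P x].

(* Points of the projective space P(W). *)
Definition points (F : fieldType) (m : nat) (W : {vspace 'rV[F]_m}) :
    set {vspace 'rV[F]_m} :=
  [set x | grass 1 x /\ (x <= W)%VS].

(* Lines of the Plücker space that are contained in [grass F k m]. *)
Definition is_line (F : fieldType) (k m : nat) (L : set {vspace 'rV[F]_m}) :=
  L `<=` @grass F k m /\
  exists2 W, grass 2 W & plucker k @` L = points W.

Definition polymap (F : fieldType) (a b : nat) (q : 'I_b -> {mpoly F[a]})
    (v : 'rV[F]_a) : 'rV[F]_b :=
  \row_j (q j).@[v 0].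

(* Morphisms from A (a subset of [grass F k m]) to B (a subset of
   [grass F k' m']): in Plücker coordinates, f is given around each point by
   forms of equal degree without common zero at that point. *)
Definition morphism (F : fieldType) (k m k' m' : nat)
    (A : set {vspace 'rV[F]_m}) (B : set {vspace 'rV[F]_m'})
    (f : {vspace 'rV[F]_m} -> {vspace 'rV[F]_m'}) :=
  (forall x, A x -> B (f x)) /\
  forall x, A x ->
    exists d (q : 'I_#|pidx k' m'| -> {mpoly F[#|pidx k m|]}),
      [/\ forall j, q j \is d.-homog,
          exists2 v, v \in plucker k x & polymap q v != 0 &
          forall y v, A y -> v \in plucker k y -> polymap q v != 0 ->
            plucker k' (f y) = <[polymap q v]>%VS].

Definition isomorphic (F : fieldType) (k m k' m' : nat)
    (A : set {vspace 'rV[F]_m}) (B : set {vspace 'rV[F]_m'}) :=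
  exists f g,
    [/\ morphism k k' A B f, morphism k' k B A g,
        forall x, A x -> g (f x) = x & forall y, B y -> f (g y) = y].

(* alpha, defined on X minus the point o, makes X a rational ruled surface with
   base B: B is a rational curve, and the fibres of alpha are, up to the point
   o, the lines of a family that is algebraic, i.e. given by a morphism from B
   to the Grassmannian of lines of the Plücker space, and that sweeps out X. *)
Definition rational_ruling (F : fieldType) (k m k' m' : nat)
    (X : set {vspace 'rV[F]_m}) (o : {vspace 'rV[F]_m})
    (B : set {vspace 'rV[F]_m'})
    (alpha : {vspace 'rV[F]_m} -> {vspace 'rV[F]_m'}) :=
  [/\ isomorphic k' 1 B (@grass F 1 2),
      morphism k k' (X `\ o) B alpha,
      alpha @` (X `\ o) = B &
      exists lam : {vspace 'rV[F]_m'} -> {vspace 'rV[F]_#|pidx k m|},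
        [/\ morphism k' 2 B (@grass F 2 _) lam,
            plucker k @` X = \bigcup_(H in B) points (lam H) &
            forall H, B H ->
              plucker k @` ((X `\ o) `&` alpha @^-1` [set H]) =
              points (lam H) `\ plucker k o]].

Definition congruence (F : fieldType) (r : nat)
    (Sigma : set {vspace 'rV[F]_r.+3}) :=
  [/\ zclosed r.+1 Sigma, zirreducible r.+1 Sigma & zdim r.+1 Sigma 2].

Definition has_order (F : fieldType) (r : nat)
    (Sigma : set {vspace 'rV[F]_r.+3}) (n : nat) :=
  general_point (fun x => ([set s | Sigma s /\ (x <= s)%VS] #= `I_n)%card).

Definition Omega (F : fieldType) (r : nat) (pi : {vspace 'rV[F]_r.+3}) :
    set {vspace 'rV[F]_r.+3} :=
  [set s | grass r.+1 s /\ (r <= \dim (s :&: pi))%N].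

Definition hyperplanes_of (F : fieldType) (r : nat)
    (pi : {vspace 'rV[F]_r.+3}) : set {vspace 'rV[F]_r.+3} :=
  [set K | grass r K /\ (K <= pi)%VS].

Definition pencil (F : fieldType) (r : nat) (pi : {vspace 'rV[F]_r.+3}) :
    set {vspace 'rV[F]_r.+3} :=
  [set H | grass r.+2 H /\ (pi <= H)%VS].

Definition phi (F : fieldType) (r : nat) (pi s : {vspace 'rV[F]_r.+3}) :
    {vspace 'rV[F]_r.+3} * {vspace 'rV[F]_r.+3} :=
  ((s :&: pi)%VS, (s + pi)%VS).

Definition phi_fibre (F : fieldType) (r : nat) (pi H : {vspace 'rV[F]_r.+3}) :
    set {vspace 'rV[F]_r.+3} :=
  (Omega pi `\ pi) `&` phi pi @^-1` (hyperplanes_of pi `*` [set H]).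

Definition alpha (F : fieldType) (r : nat) (pi s : {vspace 'rV[F]_r.+3}) :
    {vspace 'rV[F]_r.+3} :=
  (s + pi)%VS.

(* Main.v *)
(* Write a hyperplane of the pencil as H_t = pi + <t0 u0 + t1 u1>.  A member of
   Omega_pi inside H_t is the kernel of a functional (c, y) on H_t, and its
   Plücker coordinates are linear in (c, t0 y, t1 y).  In these terms the fibre
   of Sigma over H_t is a closed cone of functionals, and order 1 says that a
   general hyperplane meets a general fibre in exactly one point.  By quantifier
   elimination that point depends rationally on the hyperplane; a curve in
   which the hyperplanes of a general pencil cut one point each is a line, so a
   general fibre contains the line through two sections that are rational in t.
   Saturating the K[t]-module spanned by two such sections gives a line over
   every t, contained in Sigma by density.  Since Sigma is irreducible, these
   lines sweep out Sigma outside [pi], and, by a determinant trick replacing the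
   completeness of the family, also [pi] if it lies on Sigma.
   Conversely, the set of points lying on exactly one member is constructible,
   hence it or its complement contains a nonempty open set; if all fibres are
   lines the complement meets H_t in the base locus of a pencil of hyperplanes,
   so it is the former. *)
Require Import Defs.
From mathcomp Require Import all_boot all_order all_algebra fingroup perm.
From mathcomp Require Import boolp classical_sets cardinality reals complex.
From mathcomp Require Import mpoly closed_field zify ring.
Set Implicit Arguments.
Unset Strict Implicit.
Unset Printing Implicit Defensive.
Import Order.TTheory GRing.Theory Num.Theory.
Local Open Scope classical_set_scope.
Local Open Scope ring_scope.

(** [Omega] is the cone with vertex [pi] over the Segre image of the product of the pencil and the
    dual space of pi: t and y enter through their tensor, and the vertex is y = 0. The vertex lies
    over every t, so it escapes all arguments made fibre by fibre; hence the recurring condition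
    [yof w != 0] and the separate question whether the family of lines reaches [pi]. A point
    [vec t0 t1 + p *m E] off pi is the hyperplane c + p.y = 0 in the space of functionals, which
    never contains the vertex (1, 0); this is how the order becomes a statement on hyperplane
    sections. Replacing t by a t multiplies c by a and fixes y, so degrees in t carry a weight.
    Genericity rests on three devices: a constructible predicate holds or fails generically,
    polynomial identities spread by density, and irreducibility is applied to two explicit closed
    sets covering Sigma. The equations of these sets must be forms in the Plücker vector alone; t is
    recovered there, up to the factor y_i, from the entries t0 y_i and t1 y_i. *)

Lemma rV_neq0_ex (F : fieldType) n (y : 'rV[F]_n) : y != 0 -> exists i, y 0 i != 0.
Proof.
move=> y0; apply: contrapT => h; move/eqP: y0; apply; apply/rowP => i; rewrite [RHS]mxE.
by apply: contrapT => /eqP yi; apply: h; exists i.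
Qed.

(** * Polynomial functions and constructible predicates *)

Section FunctionRings.
Variable F : comNzRingType.

(** One set of closure lemmas then serves polynomial functions in one or several variables,
    evaluations of first-order terms and polynomials in y over K[t]. Functions rather than
    polynomials are used so that determinants and matrix products can be treated through their
    values. *)
Definition funring (X : Type) (S : (X -> F) -> Prop) :=
  [/\ forall c, S (fun=> c),
      forall f g, S f -> S g -> S (fun x => f x + g x),
      forall f g, S f -> S g -> S (fun x => f x * g x) &
      forall f g, S f -> f =1 g -> S g].

Variables (X : Type) (S : (X -> F) -> Prop).
Hypothesis SP : funring S.

Lemma fr_cst c : S (fun=> c). Proof. by case: SP. Qed.
Lemma fr_ext f g : S f -> f =1 g -> S g.
Proof. by case: SP => _ _ _ h Sf /(h f g Sf). Qed.
Lemma fr_add f g : S f -> S g -> S (fun x => f x + g x).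
Proof. by case: SP => _ h _ _; apply: h. Qed.
Lemma fr_mul f g : S f -> S g -> S (fun x => f x * g x).
Proof. by case: SP => _ _ h _; apply: h. Qed.

Lemma fr_opp f : S f -> S (fun x => - f x).
Proof.
move=> Sf; apply: (fr_ext (fr_mul (fr_cst (-1)) Sf)) => x.
by rewrite mulN1r.
Qed.

Lemma fr_sub f g : S f -> S g -> S (fun x => f x - g x).
Proof. by move=> Sf Sg; apply: fr_add => //; apply: fr_opp. Qed.

Lemma fr_sum I (s : seq I) (P : pred I) (f : I -> X -> F) :
  (forall i, P i -> S (f i)) -> S (fun x => \sum_(i <- s | P i) f i x).
Proof.
move=> Sf; elim: s => [|i s IH].
  by apply: (fr_ext (fr_cst 0)) => x; rewrite big_nil.
case Pi: (P i); last by apply: (fr_ext IH) => x; rewrite big_cons Pi.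
by apply: (fr_ext (fr_add (Sf i Pi) IH)) => x; rewrite big_cons Pi.
Qed.

Lemma fr_prod I (s : seq I) (P : pred I) (f : I -> X -> F) :
  (forall i, P i -> S (f i)) -> S (fun x => \prod_(i <- s | P i) f i x).
Proof.
move=> Sf; elim: s => [|i s IH].
  by apply: (fr_ext (fr_cst 1)) => x; rewrite big_nil.
case Pi: (P i); last by apply: (fr_ext IH) => x; rewrite big_cons Pi.
by apply: (fr_ext (fr_mul (Sf i Pi) IH)) => x; rewrite big_cons Pi.
Qed.

Lemma fr_exp f n : S f -> S (fun x => f x ^+ n).
Proof.
move=> Sf; apply: (fr_ext (@fr_prod 'I_n (index_enum _) xpredT (fun=> f) _)) => // x.
by rewrite prodr_const card_ord.
Qed.

Lemma fr_det n (M : X -> 'M[F]_n) :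
  (forall i j, S (fun x => M x i j)) -> S (fun x => \det (M x)).
Proof.
move=> SM; apply: fr_sum => s _; apply: fr_mul; first exact: fr_cst.
by apply: fr_prod => i _; apply: SM.
Qed.

Lemma fr_mpoly n (p : {mpoly F[n]}) (v : X -> 'I_n -> F) :
  (forall i, S (fun x => v x i)) -> S (fun x => p.@[v x]).
Proof.
move=> Sv; apply: (@fr_ext (fun x => \sum_(m <- msupp p) p@_m * \prod_i v x i ^+ m i)).
  apply: fr_sum => m _; apply: fr_mul; first exact: fr_cst.
  by apply: fr_prod => i _; apply: fr_exp.
by move=> x; rewrite mevalE.
Qed.

Lemma fr_mulmx a b c (A : X -> 'M[F]_(a, b)) (B : X -> 'M[F]_(b, c)) i j :
  (forall i j, S (fun x => A x i j)) -> (forall i j, S (fun x => B x i j)) ->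
  S (fun x => (A x *m B x) i j).
Proof.
move=> SA SB.
apply: (@fr_ext (fun x => \sum_l A x i l * B x l j)).
  by apply: fr_sum => l _; apply: fr_mul.
by move=> x; rewrite mxE.
Qed.

Lemma fr_poly (p : {poly F}) f : S f -> S (fun x => p.[f x]).
Proof.
move=> Sf; apply: (@fr_ext (fun x => \sum_(i < size p) p`_i * f x ^+ i)).
  by apply: fr_sum => i _; apply: fr_mul; [apply: fr_cst|apply: fr_exp].
by move=> x; rewrite horner_coef.
Qed.

End FunctionRings.

Section Polynomial.
Variable F : comNzRingType.

Definition pfun n (f : 'rV[F]_n -> F) :=
  exists p : {mpoly F[n]}, forall v, f v = p.@[v 0].

Definition polyf (f : F -> F) := exists p : {poly F}, forall x, f x = p.[x].

Lemma pfunP n : funring (@pfun n).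
Proof.
split.
- by move=> c; exists c%:MP => v; rewrite mevalC.
- by move=> f g [p fp] [q gq]; exists (p + q) => v; rewrite mevalD fp gq.
- by move=> f g [p fp] [q gq]; exists (p * q) => v; rewrite mevalM fp gq.
- by move=> f g [p fp] fg; exists p => v; rewrite -fg.
Qed.

Lemma pfun_coord n j : pfun (fun v : 'rV[F]_n => v 0 j).
Proof. by exists 'X_j => v; rewrite mevalXU. Qed.

Lemma polyfP : funring polyf.
Proof.
split.
- by move=> c; exists c%:P => v; rewrite hornerC.
- by move=> f g [p fp] [q gq]; exists (p + q) => v; rewrite hornerD fp gq.
- by move=> f g [p fp] [q gq]; exists (p * q) => v; rewrite hornerM fp gq.
- by move=> f g [p fp] fg; exists p => v; rewrite -fg.
Qed.

Lemma polyf_id : polyf id. Proof. by exists 'X => x; rewrite hornerX. Qed.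

Lemma fr_pfun X (S : (X -> F) -> Prop) n f (v : X -> 'rV[F]_n) :
  funring S -> pfun f -> (forall j, S (fun x => v x 0 j)) -> S (fun x => f (v x)).
Proof.
move=> SP [p fp] Sv; apply: (fr_ext SP (fr_mpoly SP p Sv)) => x.
by rewrite fp.
Qed.

End Polynomial.

(** * Cofinite, generic and constructible predicates over an algebraically closed field *)

Section Infinite.
Variable K : closedFieldType.

Lemma poly_nonroot (p : {poly K}) : p != 0 -> exists x, p.[x] != 0.
Proof. by move=> /closed_nonrootP. Qed.

Definition cofin (P : K -> Prop) :=
  exists2 p : {poly K}, p != 0 & forall x, p.[x] != 0 -> P x.

Lemma cofinI P Q : cofin P -> cofin Q -> cofin (fun x => P x /\ Q x).
Proof.
move=> [p p0 hp] [q q0 hq]; exists (p * q); first by rewrite mulf_neq0.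
by move=> x; rewrite hornerM mulf_eq0 negb_or => /andP[/hp ? /hq].
Qed.

Lemma cofinW (P Q : K -> Prop) : (forall x, P x -> Q x) -> cofin P -> cofin Q.
Proof. by move=> PQ [p p0 hp]; exists p => // x /hp /PQ. Qed.

Lemma cofinT (P : K -> Prop) : (forall x, P x) -> cofin P.
Proof. by move=> h; exists 1 => //; rewrite oner_neq0. Qed.

Lemma cofin_ex P : cofin P -> exists x, P x.
Proof. by move=> [p /poly_nonroot[x px] /(_ x px)]; exists x. Qed.

Lemma cofin_ne0 (p : {poly K}) : p != 0 -> cofin (fun x => p.[x] != 0).
Proof. by exists p. Qed.

Lemma cofin_polyf f x : polyf f -> f x != 0 -> cofin (fun x => f x != 0).
Proof.
move=> [p fp] fx; exists p; last by move=> y; rewrite fp.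
by apply: contraNneq fx => p0; rewrite fp p0 horner0.
Qed.

Lemma cofin_neq a : cofin (fun x => x != a).
Proof.
exists ('X - a%:P); first by rewrite polyXsubC_eq0.
by move=> x; rewrite hornerXsubC subr_eq0.
Qed.

Lemma cofin_all (I : finType) (P : I -> K -> Prop) :
  (forall i, cofin (P i)) -> cofin (fun x => forall i, P i x).
Proof.
move=> /(_ _)/cid2 h; exists (\prod_i (sval (h i))).
  by apply/prodf_neq0 => i _; case: (h i).
move=> x; rewrite horner_prod => /prodf_neq0 hx i.
by case: (h i) (hx i isT) => p /= _ hp /hp.
Qed.

Lemma polyf_cofin0 f : polyf f -> cofin (fun x => f x = 0) -> forall x, f x = 0.
Proof.
move=> pf h x; apply: contrapT => /eqP fx.
by have [y [/eqP]] := cofin_ex (cofinI (cofin_polyf pf fx) h).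
Qed.

Lemma poly_cofin0 (p : {poly K}) : cofin (fun x => p.[x] = 0) -> p = 0.
Proof.
move=> h; apply: contrapT => /eqP p0.
by have [y [/eqP]] := cofin_ex (cofinI (cofin_ne0 p0) h).
Qed.

Definition generic n (P : 'rV[K]_n -> Prop) :=
  exists f, [/\ pfun f, exists v, f v != 0 & forall v, f v != 0 -> P v].

Lemma polyf_line n (f : 'rV[K]_n -> K) (a b : 'rV[K]_n) : pfun f ->
  polyf (fun s => f (a + s *: b)).
Proof.
move=> pf; apply: (fr_pfun (@polyfP K) pf) => j.
apply: (@fr_ext _ _ _ (@polyfP K) (fun s => a 0 j + s * b 0 j)).
  apply: (fr_add (@polyfP K)); first exact: (fr_cst (@polyfP K)).
  by apply: (fr_mul (@polyfP K)); [exact: polyf_id|exact: (fr_cst (@polyfP K))].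
by move=> x; rewrite !mxE.
Qed.

(** On the line from v to [v1] the function g is not identically zero, so f vanishes at almost all
    points of that line and hence at v. *)
Lemma pfun_dense n (f g : 'rV[K]_n -> K) v1 : pfun f -> pfun g -> g v1 != 0 ->
  (forall v, g v != 0 -> f v = 0) -> forall v, f v = 0.
Proof.
move=> pf pg gv1 fg v.
have h : cofin (fun s => f (v + s *: (v1 - v)) = 0).
  apply: (cofinW (fun s => fg _)).
  apply: (@cofin_polyf _ 1); first exact: polyf_line.
  by rewrite scale1r addrC subrK.
have := polyf_cofin0 (polyf_line v (v1 - v) pf) h 0.
by rewrite scale0r addr0.
Qed.

Lemma pfunM_neq0 n (f g : 'rV[K]_n -> K) v1 v2 : pfun f -> pfun g ->
  f v1 != 0 -> g v2 != 0 -> exists v, f v * g v != 0.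
Proof.
move=> pf pg fv gv; apply: contrapT => h.
suff f0 : f v1 = 0 by move: fv; rewrite f0 eqxx.
apply: (pfun_dense pf pg gv) => v gv0; apply/eqP; apply: contraPT gv0 => fv0 gv0.
by apply: h; exists v; rewrite mulf_neq0.
Qed.

Lemma genericI n (P Q : 'rV[K]_n -> Prop) :
  generic P -> generic Q -> generic (fun v => P v /\ Q v).
Proof.
move=> [f [pf [v1 fv] hf]] [g [pg [v2 gv] hg]]; exists (fun v => f v * g v).
split; first exact: (fr_mul (pfunP K n)).
  exact: pfunM_neq0 pf pg fv gv.
by move=> v; rewrite mulf_eq0 negb_or => /andP[/hf ? /hg].
Qed.

(** Boolean combinations of zero sets, kept as predicates rather than formulas: substitution of
    polynomial maps is then immediate, and formulas appear only where a quantifier is eliminated. *)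
Inductive constr n : ('rV[K]_n -> Prop) -> Prop :=
| Constr0 f : pfun f -> constr (fun v => f v = 0)
| ConstrN P : constr P -> constr (fun v => ~ P v)
| ConstrI P Q : constr P -> constr Q -> constr (fun v => P v /\ Q v).

Lemma constr_ext n (P Q : 'rV[K]_n -> Prop) :
  constr P -> (forall v, P v <-> Q v) -> constr Q.
Proof.
by move=> cP PQ; have <- : P = Q by apply/funext => v; apply/propext/PQ.
Qed.

Lemma constr_pre n m (P : 'rV[K]_n -> Prop) (phi : 'rV[K]_m -> 'rV[K]_n) :
  constr P -> (forall j, pfun (fun v => phi v 0 j)) ->
  constr (fun v => P (phi v)).
Proof.
move=> cP pphi; elim: cP => [f pf|Q _ IH|Q1 Q2 _ IH1 _ IH2].
- by apply: Constr0; apply: (fr_pfun (pfunP K m) pf).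
- exact: ConstrN.
- exact: ConstrI.
Qed.

(** Irreducibility of affine space: an equation holds identically or fails on a nonempty open set,
    two such sets meet, and the alternative passes through negation and conjunction. *)
Lemma constr_generic n (P : 'rV[K]_n -> Prop) :
  constr P -> generic P \/ generic (fun v => ~ P v).
Proof.
elim=> [f pf|Q _ []gQ|Q1 Q2 _ []g1 _ []g2].
- have [h|h] := pselect (exists v, f v != 0).
    by right; exists f; split => // v /eqP.
  left; exists (fun=> 1); split; first exact: (fr_cst (pfunP K n)).
    by exists 0; rewrite oner_neq0.
  by move=> v _; apply: contrapT => /eqP fv; apply: h; exists v.
- right; case: gQ => f [pf ef hf]; exists f; split => // v /hf Qv; exact.
- by left.
- by left; apply: genericI.
- by right; case: g2 => f [pf ef hf]; exists f; split => // v /hf Qv [].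
- by right; case: g1 => f [pf ef hf]; exists f; split => // v /hf Qv [].
- by right; case: g1 => f [pf ef hf]; exists f; split => // v /hf Qv [].
Qed.

Lemma constr_cofin n (P : 'rV[K]_n -> Prop) (gam : K -> 'rV[K]_n) :
  constr P -> (forall j, polyf (fun x => gam x 0 j)) ->
  cofin (fun x => P (gam x)) \/ cofin (fun x => ~ P (gam x)).
Proof.
move=> cP pg; elim: cP => [f pf|Q _ []gQ|Q1 Q2 _ []g1 _ []g2].
- have pfg := fr_pfun (polyfP K) pf pg.
  have [[x h]|h] := pselect (exists x, f (gam x) != 0).
    by right; apply: (cofinW _ (cofin_polyf pfg h)) => y /eqP.
  left; apply: cofinT => x; apply: contrapT => /eqP fv; apply: h; by exists x.
- by right; apply: cofinW gQ => v Qv; apply.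
- by left.
- by left; apply: cofinI.
- by right; apply: cofinW g2 => v Qv [].
- by right; apply: cofinW g1 => v Qv [].
- by right; apply: cofinW g1 => v Qv [].
Qed.

Lemma constrU n (P Q : 'rV[K]_n -> Prop) :
  constr P -> constr Q -> constr (fun v => P v \/ Q v).
Proof.
move=> cP cQ; apply: (constr_ext (ConstrN (ConstrI (ConstrN cP) (ConstrN cQ)))).
move=> v; split=> [h|[h|h] []//]; apply: contrapT => /not_orP[h1 pencil_minors]; exact: h.
Qed.

Lemma constrT n : @constr n (fun=> True).
Proof.
apply: (constr_ext (Constr0 (fr_cst (pfunP K n) 0))); by split.
Qed.

Lemma constr_all n (I : finType) (P : I -> 'rV[K]_n -> Prop) :
  (forall i, constr (P i)) -> constr (fun v => forall i, P i v).
Proof.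
move=> cP; have h (s : seq I) : constr (fun v => forall i, i \in s -> P i v).
  elim: s => [|i s IH]; first by apply: (constr_ext (constrT n)).
  apply: (constr_ext (ConstrI (cP i) IH)) => v; split.
    by move=> [Pi Ps] j; rewrite inE => /orP[/eqP->//|/Ps].
  by move=> Ps; split=> [|j js]; apply: Ps; rewrite inE ?eqxx ?js ?orbT.
apply: (constr_ext (h (index_enum I))) => v; split=> hv i; last by move=> _.
by apply: hv; rewrite mem_index_enum.
Qed.

Lemma constr_ne0 n m (phi : 'rV[K]_n -> 'rV[K]_m) :
  (forall j, pfun (fun v => phi v 0 j)) -> constr (fun v => phi v != 0).
Proof.
move=> pphi; apply: (constr_ext (ConstrN (constr_all (fun j => Constr0 (pphi j))))).
move=> v; split; first by move=> h; apply/eqP => e; apply: h => j; rewrite e mxE.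
by move=> /eqP h pencil_minors; apply: h; apply/rowP => j; rewrite pencil_minors mxE.
Qed.

(** * Projections of constructible sets by quantifier elimination *)

Section QE.

Let wf_proj := @ClosedFieldQE.wf_ex_elim K.
Let ok_proj := ClosedFieldQE.holds_ex_elim (@solve_monicpoly K).

Let env n (v : 'rV[K]_n) : seq K := [seq v 0 i | i <- enum 'I_n].

Let nth_env n (v : 'rV[K]_n) (i : 'I_n) : (env v)`_i = v 0 i.
Proof. by rewrite (nth_map i) ?size_enum_ord // nth_ord_enum. Qed.

Lemma term_of_pfun n f : pfun f -> exists2 t : GRing.term K,
  GRing.rterm t & forall v : 'rV[K]_n, GRing.eval (env v) t = f v.
Proof.
pose S (g : 'rV[K]_n -> K) := exists2 t : GRing.term K,
  GRing.rterm t & forall v : 'rV[K]_n, GRing.eval (env v) t = g v.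
have SP : funring S.
  split.
  - by move=> c; exists (GRing.Const c).
  - move=> g h [t rt tg] [u ru uh]; exists (GRing.Add t u); first by rewrite /= rt.
    by move=> v; rewrite /= tg uh.
  - move=> g h [t rt tg] [u ru uh]; exists (GRing.Mul t u); first by rewrite /= rt.
    by move=> v; rewrite /= tg uh.
  - by move=> g h [t rt tg] gh; exists t => // v; rewrite tg gh.
move=> [p fp]; apply: (@fr_ext _ _ _ SP (fun v => p.@[v 0])); last by move=> v.
apply: (fr_mpoly SP) => i; exists (GRing.Var _ i) => // v.
by rewrite /= nth_env.
Qed.

Lemma pfun_of_term n (t : GRing.term K) : GRing.rterm t ->
  pfun (fun v : 'rV[K]_n => GRing.eval (env v) t).
Proof.
have P := pfunP K n.
elim: t => //=.
- move=> i _; have [lin|lni] := ltnP i n; last first.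
    apply: (fr_ext P (fr_cst P 0)) => v.
    by rewrite nth_default // size_map size_enum_ord.
  apply: (fr_ext P (pfun_coord K (Ordinal lin))) => v.
  by rewrite -nth_env.
- by move=> c _; apply: (fr_cst P).
- by move=> c _; apply: (fr_cst P).
- by move=> t IHt u IHu /andP[/IHt ? /IHu ?]; apply: (fr_add P).
- by move=> t IHt /IHt ?; apply: (fr_opp P).
- move=> t IHt c /IHt h; apply: (fr_ext P (fr_mul P h (fr_cst P c%:R))) => v.
  by rewrite mulr_natr.
- by move=> t IHt u IHu /andP[/IHt ? /IHu ?]; apply: (fr_mul P).
- by move=> t IHt c /IHt h; apply: (fr_exp P).
Qed.

Lemma formula_of_constr n P : constr P -> exists2 f : GRing.formula K,
  GRing.rformula f & forall v : 'rV[K]_n, GRing.holds (env v) f <-> P v.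
Proof.
elim=> [f /term_of_pfun[t rt tf]|Q _ [f rf fQ]|Q1 Q2 _ [f rf fQ] _ [g rg gQ]].
- exists (GRing.Equal t (GRing.Const 0)); first by rewrite /= rt.
  by move=> v /=; rewrite tf.
- by exists (GRing.Not f) => // v /=; rewrite fQ.
- by exists (GRing.And f g) => [|v /=]; [rewrite /= rf|rewrite fQ gQ].
Qed.

Lemma constr_of_qf n (f : GRing.formula K) :
  GRing.qf_form f -> GRing.rformula f ->
  constr (fun v : 'rV[K]_n => GRing.qf_eval (env v) f).
Proof.
elim: f => //=.
- move=> [] _ _; first by apply: (constr_ext (constrT n)).
  by apply: (constr_ext (ConstrN (constrT n))) => v; split.
- move=> t u _ /andP[rt ru].
  apply: (constr_ext (Constr0 (fr_sub (pfunP K n) (pfun_of_term n rt)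
    (pfun_of_term n ru)))) => v.
  by split=> [/eqP|]; rewrite ?subr_eq0 // => /eqP->; rewrite subrr.
- move=> f IHf g IHg /andP[qf qg] /andP[rf rg].
  by apply: (constr_ext (ConstrI (IHf qf rf) (IHg qg rg))) => v; split=> /andP.
- move=> f IHf g IHg /andP[qf qg] /andP[rf rg].
  by apply: (constr_ext (constrU (IHf qf rf) (IHg qg rg))) => v; split=> /orP.
- move=> f IHf g IHg /andP[qf qg] /andP[rf rg].
  apply: (constr_ext (constrU (ConstrN (IHf qf rf)) (IHg qg rg))) => v.
  by split=> [[/negP/negPf->//|->]|/implyP h]; rewrite ?implybT //;
    case: (GRing.qf_eval _ f) h => h; [right; apply: h|left].
- move=> f IHf qf rf; apply: (constr_ext (ConstrN (IHf qf rf))) => v.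
  by split=> /negP.
Qed.

Lemma constr_ex1 n (P : 'rV[K]_(n + 1) -> Prop) : constr P ->
  constr (fun v : 'rV[K]_n => exists x, P (row_mx v x%:M)).
Proof.
move=> /formula_of_constr[f rf fP].
have rE : GRing.rformula (GRing.Exists n f) by [].
have /andP[qq rq] := GRing.quantifier_elim_wf wf_proj rE.
apply: (constr_ext (constr_of_qf n qq rq)) => v.
(* The eliminated variable has index n, just past the environment of v, so that [set_nth] appends
   its value. *)
have e x : GRing.holds (set_nth 0 (env v) n x) f <-> P (row_mx v x%:M).
  rewrite -fP; suff -> : set_nth 0 (env v) n x = env (row_mx v x%:M) by [].
  have sv : size (env v) = n by rewrite size_map size_enum_ord.
  apply: (@eq_from_nth _ 0).
    by rewrite size_set_nth sv /env size_map size_enum_ord addn1; apply/maxn_idPl.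
  move=> i; rewrite size_set_nth sv (maxn_idPl _) // => ltin.
  have ltin' : (i < n + 1)%N by rewrite addn1.
  rewrite nth_set_nth /= (nth_env (row_mx v x%:M) (Ordinal ltin')) mxE.
  case: splitP => j /= ->.
    by rewrite ltn_eqF // nth_env.
  by rewrite (ord1 j) addn0 eqxx mxE eqxx mulr1n.
split=> [/(GRing.quantifier_elim_rformP wf_proj ok_proj _ rE)[x /e]|[x /e ex]].
  by exists x.
by apply/(GRing.quantifier_elim_rformP wf_proj ok_proj _ rE); exists x.
Qed.

End QE.

Lemma constr_ex n m (P : 'rV[K]_(n + m) -> Prop) : constr P ->
  constr (fun v : 'rV[K]_n => exists w : 'rV[K]_m, P (row_mx v w)).
Proof.
elim: m n P => [|m IH] n P cP.
  have ca : constr (fun v : 'rV[K]_n => P (row_mx v 0)).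
    apply: (constr_pre cP) => j; case: (split_ordP j) => i ->.
      by apply: (fr_ext (pfunP K n) (pfun_coord K i)) => v; rewrite row_mxEl.
    by apply: (fr_ext (pfunP K n) (fr_cst (pfunP K n) 0)) => v; rewrite row_mxEr mxE.
  apply: (constr_ext ca) => v; split=> [|[w]]; first by exists 0.
  by rewrite (thinmx0 w).
pose Q (v : 'rV[K]_((n + 1) + m)) :=
  P (row_mx (lsubmx (lsubmx v)) (row_mx (rsubmx (lsubmx v)) (rsubmx v) : 'rV_(1 + m))).
have cQ : constr Q.
  apply: (constr_pre cP) => j; have PP := pfunP K (n + 1 + m).
  case: (split_ordP j) => i ->.
    apply: (fr_ext PP (pfun_coord K (lshift m (lshift 1 i)))) => v.
    by rewrite row_mxEl !mxE.
  case: (@split_ordP 1 m i) => l ->.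
    apply: (fr_ext PP (pfun_coord K (lshift m (rshift n l)))) => v.
    by rewrite row_mxEr (@row_mxEl _ 1 1 m) !mxE.
  apply: (fr_ext PP (pfun_coord K (rshift (n + 1) l))) => v.
  by rewrite row_mxEr (@row_mxEr _ 1 1 m) !mxE.
apply: (constr_ext (constr_ex1 (IH _ _ cQ))) => v; split.
  by move=> [x [w]]; rewrite /Q !(row_mxKl, row_mxKr) => ?; eexists; eassumption.
move=> [w Pw]; exists ((lsubmx (w : 'rV_(1 + m))) 0 0), (rsubmx (w : 'rV_(1 + m))).
by rewrite /Q !(row_mxKl, row_mxKr) -mx11_scalar hsubmxK.
Qed.

End Infinite.

(** * Finiteness of systems of equations *)

Section Noetherian.

Definition ideal_pred (A : comNzRingType) (J : A -> Prop) :=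
  [/\ J 0, forall x y, J x -> J y -> J (x + y) & forall c x, J x -> J (c * x)].

(* That s generates J is stated as: every ideal containing s contains J. *)
Definition noetherian (A : comNzRingType) :=
  forall J : A -> Prop, ideal_pred J -> exists2 s : seq A,
    forall x, x \in s -> J x &
    forall J', ideal_pred J' -> (forall x, x \in s -> J' x) ->
      forall x, J x -> J' x.

Lemma noetherian_field (F : fieldType) : noetherian F.
Proof.
move=> J [J0 JD JM]; have [[a Ja a0]|h] := pselect (exists2 a, J a & a != 0).
  exists [:: a]; first by move=> x; rewrite inE => /eqP->.
  move=> J' [_ _ J'M] /(_ a); rewrite inE eqxx => /(_ isT) J'a x _.
  by rewrite -(divfK a0 x); apply: J'M.
exists [::] => // J' [J'0 _ _] _ x Jx; suff -> : x = 0 by [].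
by apply: contrapT => /eqP x0; apply: h; exists x.
Qed.

Lemma noetherian_surj (A B : comNzRingType) (f : {rmorphism A -> B}) :
  (forall y, exists x, f x = y) -> noetherian A -> noetherian B.
Proof.
move=> fs nA J [J0 JD JM].
have idf J' : ideal_pred J' -> ideal_pred (fun x => J' (f x)).
  move=> [J'0 J'D J'M]; split; first by rewrite rmorph0.
    by move=> x y ? ?; rewrite rmorphD; apply: J'D.
  by move=> c x ?; rewrite rmorphM; apply: J'M.
have [s sJ sJ'] := nA _ (idf J (And3 J0 JD JM)).
exists (map f s); first by move=> _ /mapP[x /sJ Jfx ->].
move=> J' idJ' sub y Jy; have [x fx] := fs y; rewrite -fx.
apply: (sJ' _ (idf _ idJ')); last by rewrite fx.
by move=> z zs; apply: sub; apply: map_f.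
Qed.

Lemma noetherian_poly (A : comNzRingType) : noetherian A -> noetherian {poly A}.
Proof.
move=> nA J [J0 JD JM].
(* The coefficients of degree d of elements of degree at most d. Membership in J is kept beside that
   in J', so that subtracting such an element from a member of J stays in J. *)
pose L (J' : {poly A} -> Prop) d a :=
  exists p, [/\ J p, J' p, (size p <= d.+1)%N & p`_d = a].
have idL J' d : ideal_pred J' -> ideal_pred (L J' d).
  move=> [J'0 J'D J'M]; split.
  - by exists 0; split; rewrite ?size_poly0 ?coef0.
  - move=> x y [p [Jp J'p sp <-]] [q [Jq J'q sq <-]]; exists (p + q).
    split; [exact: JD|exact: J'D| |by rewrite coefD].
    by rewrite (leq_trans (size_polyD _ _)) // geq_max sp.
  - move=> c x [p [Jp J'p sp <-]]; exists (c%:P * p).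
    split; [exact: JM|exact: J'M| |by rewrite coefCM].
    by rewrite mul_polyC (leq_trans (size_scale_leq _ _)).
have JJ : ideal_pred J by split.
have Lmono J' d e a : ideal_pred J' -> (d <= e)%N -> L J' d a -> L J' e a.
  move=> [J'0 J'D J'M] de [p [Jp J'p sp pa]]; exists ('X^(e - d) * p).
  split; [exact: JM|exact: J'M| |].
    rewrite mulrC; have [->|p0] := eqVneq p 0; first by rewrite mul0r size_poly0.
    by rewrite size_mulXn // -{2}(subnK de) -addnS leq_add2l.
  by rewrite mulrC coefMXn ltnNge leq_subr /= subKn.
have lift d (s : seq A) : (forall a, a \in s -> L J d a) -> exists2 S : seq {poly A},
    forall p, p \in S -> J p & forall J', ideal_pred J' ->
      (forall p, p \in S -> J' p) -> forall a, a \in s -> L J' d a.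
  elim: s => [|a s IH] sL; first by exists [::].
  have [p [Jp _ sp pa]] := sL a (mem_head _ _).
  have [|S SJ SJ'] := IH; first by move=> b bs; apply: sL; rewrite inE bs orbT.
  exists (p :: S); first by move=> q; rewrite inE => /orP[/eqP->|/SJ].
  move=> J' idJ' SJ'' b; rewrite inE => /orP[/eqP->|bs].
    by exists p; split=> //; apply: SJ''; rewrite mem_head.
  by apply: SJ' => // q qS; apply: SJ''; rewrite inE qS orbT.
(* Hilbert's argument: the ideal of all leading coefficients has generators that occur in some
   degree D; these serve all degrees from D on, and each of the finitely many lower degrees gets its
   own generators. *)
have [s sL sgen] : exists2 s : seq A, forall x, x \in s -> exists d, L J d x &
    forall J', ideal_pred J' -> (forall x, x \in s -> J' x) ->
      forall x, (exists d, L J d x) -> J' x.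
  apply: nA; split; first by exists 0%N; case: (idL J 0%N JJ).
    move=> x y [d Lx] [e Ly]; exists (maxn d e).
    case: (idL J (maxn d e) JJ) => _ h _; apply: h.
      exact: Lmono (leq_maxl _ _) Lx.
    exact: Lmono (leq_maxr _ _) Ly.
  by move=> c x [d Lx]; exists d; case: (idL J d JJ) => _ _; apply.
have [D sD] : exists D, forall x, x \in s -> L J D x.
  elim: s sL {sgen} => [|a s IH] sL; first by exists 0%N.
  have [d da] := sL a (mem_head _ _).
  have [|e es] := IH; first by move=> x xs; apply: sL; rewrite inE xs orbT.
  exists (maxn d e) => x; rewrite inE => /orP[/eqP->|/es].
    exact: Lmono (leq_maxl _ _) da.
  exact: Lmono (leq_maxr _ _).
have [S SJ Sgen] := lift D s sD.
have low e : exists2 T : seq {poly A}, forall p, p \in T -> J p &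
    forall J', ideal_pred J' -> (forall p, p \in T -> J' p) ->
      forall d a, (d < e)%N -> L J d a -> L J' d a.
  elim: e => [|e [T TJ Tgen]]; first by exists [::].
  have [s' s'L s'gen] := nA _ (idL J e JJ).
  have [T' T'J T'gen] := lift e s' s'L.
  exists (T ++ T'); first by move=> p; rewrite mem_cat => /orP[/TJ|/T'J].
  move=> J' idJ' TT d a; rewrite ltnS leq_eqVlt => /orP[/eqP->|de] La.
    apply: s'gen La; first exact: idL.
    by apply: T'gen => // p pT; apply: TT; rewrite mem_cat pT orbT.
  by apply: Tgen => // p pT; apply: TT; rewrite mem_cat pT.
have [T TJ Tgen] := low D.
exists (S ++ T); first by move=> p; rewrite mem_cat => /orP[/SJ|/TJ].
move=> J' idJ' ST p; have [n] := ubnP (size p); elim: n p => // n IH p sp Jp.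
have [->|p0] := eqVneq p 0; first by case: idJ'.
have Lp : L J (size p).-1 (p`_(size p).-1).
  by exists p; split=> //; rewrite prednK // size_poly_gt0.
have [q [Jq J'q sq qp]] : L J' (size p).-1 (p`_(size p).-1).
  have [pD|Dp] := ltnP (size p).-1 D.
    by apply: Tgen => // q qT; apply: ST; rewrite mem_cat qT orbT.
  apply: Lmono Dp _ => //; apply: (sgen _ (idL J' D idJ')); last by eexists; exact: Lp.
  by apply: Sgen => // q qS; apply: ST; rewrite mem_cat qS.
case: (idJ') => J'0 J'D J'M; rewrite -(subrK q p); apply: (J'D _ _ _ J'q); apply: IH; last first.
  by apply: JD => //; rewrite -mulN1r; apply: JM.
rewrite -ltnS; apply: leq_trans sp; rewrite ltnS.
have sp0 : (0 < size p)%N by rewrite size_poly_gt0.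
rewrite -(prednK sp0) ltnS; apply/leq_sizeP => j; rewrite coefB leq_eqVlt => /orP[/eqP<-|ltj].
  by rewrite qp subrr.
rewrite !nth_default ?subrr //; first exact: leq_trans ltj.
by move: ltj; rewrite prednK.
Qed.

(** The property passes to quotients, so a surjection from the univariate polynomials over [{mpoly
    F[n]}] is enough; surjectivity is checked on constants and variables. *)
Lemma noetherian_mpoly (F : fieldType) n : noetherian {mpoly F[n]}.
Proof.
elim: n => [|n IH].
  apply: (@noetherian_surj F _ (@mpolyC 0 F)) (@noetherian_field F) => p.
  exists p@_0%MM; apply/mpolyP => m; rewrite mcoeffC.
  by have -> : m = 0%MM by [apply/mnmP; case]; rewrite eqxx mulr1.
pose f (p : {poly {mpoly F[n]}}) : {mpoly F[n.+1]} :=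
  horner_eval 'X_ord_max (map_poly (@mwiden n F) p).
apply: (@noetherian_surj _ _ (@horner_eval _ ('X_ord_max : {mpoly F[n.+1]}) \o map_poly (@mwiden n F))); last exact: noetherian_poly IH.
move=> p; pose S (q : {mpoly F[n.+1]}) := exists x, f x = q.
have SD x y : S x -> S y -> S (x + y).
  by move=> [u <-] [v <-]; exists (u + v); rewrite /f !raddfD.
have SM x y : S x -> S y -> S (x * y).
  by move=> [u <-] [v <-]; exists (u * v); rewrite /f !rmorphM.
have SC c : S c%:MP.
  by exists c%:MP%:P; rewrite /f map_polyC /= /horner_eval hornerC mwidenC.
have SX i : S 'X_i.
  case: (unliftP ord_max i) => [j ->|->].
    exists ('X_j)%:P; rewrite /f map_polyC /= /horner_eval hornerC mwidenX mnmwiden1.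
    by congr 'X_[U_(_)]; apply/val_inj; rewrite /= /bump leqNgt ltn_ord.
  by exists 'X; rewrite /f map_polyX /horner_eval hornerX.
rewrite (mpolyE p); apply: (big_ind S) => [||m _].
- by rewrite -mpolyC0.
- exact: SD.
rewrite -mul_mpolyC; apply: (SM) => //; rewrite mpolyXE_id.
apply: (big_ind S) => [||i _]; [by rewrite -mpolyC1|exact: (SM)|].
elim: (m i) => [|k IHk]; first by rewrite expr0 -mpolyC1.
by rewrite exprS; apply: SM.
Qed.

(** A closed set is given by arbitrarily many equations, while constructible predicates admit finite
    conjunctions only. *)
Lemma finite_equations (F : fieldType) n (I : set {mpoly F[n]}) :
  exists2 s : seq {mpoly F[n]}, forall p, p \in s -> I p &
    forall v, (forall p, p \in s -> p.@[v] = 0) -> forall p, I p -> p.@[v] = 0.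
Proof.
pose J p := forall J', ideal_pred J' -> (forall q, I q -> J' q) -> J' p.
have idJ : ideal_pred J.
  split; first by move=> J' [].
    by move=> x y Jx Jy J' idJ' sub; case: (idJ') => _ h _; apply: h; [apply: Jx|apply: Jy].
  by move=> c x Jx J' idJ' sub; case: (idJ') => _ _ h; apply: h; apply: Jx.
have [s sJ sgen] := noetherian_mpoly idJ.
(* The polynomials vanishing wherever some finite part of I vanishes form an ideal containing I. *)
pose fin p := exists2 s : seq {mpoly F[n]}, forall p, p \in s -> I p &
    forall v, (forall p, p \in s -> p.@[v] = 0) -> p.@[v] = 0.
have fJ p : J p -> fin p.
  apply; last by move=> q Iq; exists [:: q] => [x|v]; [rewrite inE => /eqP->|apply; rewrite mem_head].
  split.
  - by exists [::] => // v _; rewrite meval0.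
  - move=> x y [sx sxI hx] [sy syI hy]; exists (sx ++ sy).
      by move=> q; rewrite mem_cat => /orP[/sxI|/syI].
    move=> v hv; rewrite mevalD hx ?hy ?addr0 // => q qs; apply: hv;
      by rewrite mem_cat qs ?orbT.
  - by move=> c x [sx sxI hx]; exists sx => // v /hx; rewrite mevalM => ->; rewrite mulr0.
have [S SI hS] : exists2 S : seq {mpoly F[n]}, forall p, p \in S -> I p &
    forall v, (forall p, p \in S -> p.@[v] = 0) -> forall p, p \in s -> p.@[v] = 0.
  have : forall p, p \in s -> fin p by move=> p /sJ/fJ.
  elim: (s) => [|p s' IH] h; first by exists [::].
  have [S SI hS] := IH (fun q qs => h q (mem_behead (s := p :: s') qs)).
  have [T TI hT] := h p (mem_head _ _).
  exists (T ++ S); first by move=> q; rewrite mem_cat => /orP[/TI|/SI].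
  move=> v hv q; rewrite inE => /orP[/eqP->|qs].
    by apply: hT => t tT; apply: hv; rewrite mem_cat tT.
  by apply: hS => // t tS; apply: hv; rewrite mem_cat tS orbT.
exists S => // v /hS hv p Ip.
apply: (sgen (fun p => p.@[v] = 0)) => //; last by move=> J' _; apply.
split; first by rewrite meval0.
  by move=> x y xv yv; rewrite mevalD xv yv addr0.
by move=> c x xv; rewrite mevalM xv mulr0.
Qed.

End Noetherian.

(** * Rational dependence on a parameter *)

Section Rationality.
Variable K : numClosedFieldType.

(** The outer variable is y, the inner one is t. *)
Definition ev2 (q : {poly {poly K}}) (t y : K) := q.[y%:P].[t].

Lemma ev2D p q t y : ev2 (p + q) t y = ev2 p t y + ev2 q t y.
Proof. by rewrite /ev2 !hornerD. Qed.

Lemma ev2M p q t y : ev2 (p * q) t y = ev2 p t y * ev2 q t y.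
Proof. by rewrite /ev2 !hornerM. Qed.

Lemma ev2Z c q t y : ev2 (c *: q) t y = c.[t] * ev2 q t y.
Proof. by rewrite /ev2 hornerZ hornerM. Qed.

Lemma ev2_map q t y : ev2 q t y = (map_poly (horner_eval t) q).[y].
Proof.
rewrite -[in RHS](hornerC y t) -/(horner_eval t y%:P).
by rewrite (horner_map (horner_eval t)).
Qed.

Definition pt2 (t y : K) : 'rV[K]_(1 + 1) := row_mx t%:M y%:M.

Lemma pfun_pt2 f : pfun f -> exists q, forall t y, f (pt2 t y) = ev2 q t y.
Proof.
pose S (g : K * K -> K) := exists q, forall t y, g (t, y) = ev2 q t y.
have SP : funring S.
  split.
  - by move=> c; exists c%:P%:P => t y; rewrite /ev2 !hornerC.
  - by move=> g h [p gp] [q hq]; exists (p + q) => t y; rewrite ev2D gp hq.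
  - by move=> g h [p gp] [q hq]; exists (p * q) => t y; rewrite ev2M gp hq.
  - by move=> g h [p gp] gh; exists p => t y; rewrite -gh.
move=> pf; have [j|q hq] := fr_pfun (v := fun x => pt2 x.1 x.2) SP pf; last first.
  by exists q => t y; rewrite -hq.
case: (split_ordP j) => i -> {j}.
  exists ('X%:P) => t y; rewrite /ev2 hornerC hornerX /pt2 row_mxEl.
  by rewrite (ord1 i) mxE eqxx.
exists 'X => t y; rewrite /ev2 hornerX hornerC /pt2 row_mxEr.
by rewrite (ord1 i) mxE eqxx.
Qed.

(** Off the product of the nonzero polynomials occurring in P, every equation has a truth value
    independent of the point. *)
Lemma constr_pt2_generic P : constr P -> exists2 q, q != 0 &
  forall t y z, ev2 q t y != 0 -> ev2 q t z != 0 -> P (pt2 t y) -> P (pt2 t z).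
Proof.
move=> cP; suff [q q0 h] : exists2 q, q != 0 & forall t y z, ev2 q t y != 0 ->
    ev2 q t z != 0 -> (P (pt2 t y) <-> P (pt2 t z)).
  by exists q => // t y z qy qz; rewrite (h t y z).
elim: cP => [f /pfun_pt2[q fq]|Q _ [q q0 h]|P1 P2 _ [p p0 hp] _ [q q0 hq]].
- have [q0|q0] := eqVneq q 0.
    exists 1; first exact: oner_neq0.
    by move=> t y z _ _; rewrite !fq q0 /ev2 !horner0.
  by exists q => // t y z /eqP qy /eqP qz; rewrite !fq; split.
- by exists q => // t y z qy qz; rewrite (h t y z).
- exists (p * q); first by rewrite mulf_neq0.
  move=> t y z; rewrite !ev2M !mulf_eq0 !negb_or => /andP[py qy] /andP[pz qz].
  by rewrite (hp t y z) // (hq t y z).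
Qed.

Section UniqueSolution.
Variable D : K -> K -> Prop.
Hypothesis cD : constr (fun v : 'rV[K]_(1 + 1) => D (v 0 (lshift 1 0)) (v 0 (rshift 1 0))).
Hypothesis uD : cofin (fun t => exists2 y, D t y & forall z, D t z -> z = y).

Let D_pt2 t y : D ((pt2 t y) 0 (lshift 1 0)) ((pt2 t y) 0 (rshift 1 0)) = D t y.
Proof. by rewrite /pt2 row_mxEl row_mxEr !mxE !eqxx. Qed.

(** If y(t) denotes the unique solution, [van] is the kernel of the evaluation at y(t) for general
    t. It is prime, because by [constr_cofin] a polynomial vanishes along y(t) for almost all t or
    for almost no t. *)
Let van q := cofin (fun t => forall y, D t y -> ev2 q t y = 0).
Let nonvan q := cofin (fun t => forall y, D t y -> ev2 q t y != 0).

Let van_dich q : van q \/ nonvan q.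
Proof.
pose E (v : 'rV[K]_(1 + 1)) :=
  D (v 0 (lshift 1 0)) (v 0 (rshift 1 0)) /\
  ev2 q (v 0 (lshift 1 0)) (v 0 (rshift 1 0)) = 0.
have cE : constr E.
  apply: ConstrI => //; apply: Constr0.
  have P := pfunP K (1 + 1).
  have h : pfun (fun v : 'rV[K]_(1 + 1) => \sum_(i < size q)
      (q`_i).[v 0 (lshift 1 0)] * v 0 (rshift 1 0) ^+ i).
    apply: (fr_sum P) => i _; apply: (fr_mul P).
      by apply: (fr_poly P); apply: pfun_coord.
    by apply: (fr_exp P); apply: pfun_coord.
  apply: (fr_ext P h) => v; rewrite /ev2 (horner_coef q) horner_sum.
  by apply: eq_bigr => i _; rewrite hornerM horner_exp hornerC.
have [j|h|h] := @constr_cofin _ _ _ (fun t => t%:M) (constr_ex1 cE).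
- apply: (fr_ext (polyfP K) (polyf_id K)) => t.
  by rewrite mxE (ord1 j) eqxx.
- left; apply: cofinW (cofinI uD h) => t [[y0 _ uy] [y [Dy qy]]] z /uy->.
  move: Dy qy; rewrite -/(pt2 t y) D_pt2 => /uy ->.
  by rewrite /pt2 row_mxEl row_mxEr !mxE !eqxx.
- right; apply: cofinW h => t h y Dy; apply/eqP => qy; apply: h; exists y.
  by rewrite /E -/(pt2 t y) D_pt2; split => //; rewrite /pt2 row_mxEl row_mxEr !mxE !eqxx.
Qed.

Let van_nonvan q : van q -> nonvan q -> False.
Proof.
move=> vq nq; have [t [[y Dy _] [/(_ _ Dy) h /(_ _ Dy) /eqP]]] := cofin_ex (cofinI uD (cofinI vq nq)).
by [].
Qed.

Let vanM (p q : {poly {poly K}}) : van (p * q) -> van p \/ van q.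
Proof.
move=> vpq; case: (van_dich p) => [|np]; [by left|].
case: (van_dich q) => [|nq]; [by right|case: (van_nonvan vpq)].
apply: cofinW (cofinI np nq) => t [hp hq] y Dy.
by rewrite ev2M mulf_neq0 ?hp ?hq.
Qed.

Let vanZ (c : {poly K}) (q : {poly {poly K}}) : c != 0 -> van (c *: q) -> van q.
Proof.
move=> c0 h; apply: cofinW (cofinI (cofin_ne0 c0) h) => t [ct {}h] y /h.
by rewrite ev2Z => /eqP; rewrite mulf_eq0 (negPf ct) => /eqP.
Qed.

Let van_const (q : {poly {poly K}}) : (size q <= 1)%N -> van q -> q = 0.
Proof.
move=> /size1_polyC-> h; congr polyC.
apply: poly_cofin0; apply: cofinW (cofinI uD h) => t [[y Dy _] /(_ _ Dy)].
by rewrite /ev2 hornerC.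
Qed.

(** Take q off whose zeros membership in D does not depend on y. Were q nonzero at the solution,
    every other z with q(t, z) nonzero would be a solution too, against uniqueness. *)
Let exists_van : exists2 q : {poly {poly K}}, q != 0 & van q.
Proof.
have [q q0 hq] := constr_pt2_generic cD; exists q => //.
case: (van_dich q) => // nq.
have [t [[y Dy uy] /(_ _ Dy) qy]] := cofin_ex (cofinI uD nq).
have qt0 : map_poly (horner_eval t) q != 0.
  by apply: contraNneq qy => e; rewrite ev2_map e horner0.
have q1 : map_poly (horner_eval t) q * ('X - y%:P) != 0.
  by rewrite mulf_neq0 // polyXsubC_eq0.
have [z] := poly_nonroot q1; rewrite hornerM hornerXsubC mulf_eq0 negb_or subr_eq0.
move=> /andP[qz zy]; case/eqP: zy; apply: uy.
by rewrite -D_pt2; apply: hq qy _ _; rewrite ?ev2_map // D_pt2.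
Qed.

(* A polynomial q of least degree in y that vanishes on the solutions divides,
   or is coprime to, every other polynomial; so all its roots are solutions.
   Hence it has a single root, and degree 1 since it is separable. *)
Lemma rational_solution : exists a b : {poly K},
  cofin (fun t => b.[t] != 0 /\ D t (a.[t] / b.[t])).
Proof.
have [n0 hn0] : exists n, `[< exists q, [/\ q != 0, van q & size q = n] >].
  by have [q q0 vq] := exists_van; exists (size q); apply/asboolP; exists q.
have hex : exists n, `[< exists q, [/\ q != 0, van q & size q = n] >] by exists n0.
case: (ex_minnP hex) => n /asboolP[q [q0 vq sq]] nmin.
have qmin p : p != 0 -> van p -> (size q <= size p)%N.
  by move=> p0 vp; rewrite sq; apply: nmin; apply/asboolP; exists p.
have lq0 : lead_coef q != 0 by rewrite lead_coef_eq0.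
have sq1 : (1 < size q)%N.
  by rewrite ltnNge; apply: contra_neqN q0 => /van_const; apply.
(* Pseudo-division over K[t]: the remainder has smaller degree in y and vanishes at the solutions,
   so it is 0 by minimality. *)
have divq p : van p -> exists c h, c != 0 /\ c *: p = h * q.
  move=> vp; exists (lead_coef q ^+ scalp p q), (p %/ q).
  split; first exact: expf_neq0.
  have e := Pdiv.Idomain.divp_eq p q; rewrite e.
  suff -> : p %% q = 0 by rewrite addr0.
  apply: contrapT => /eqP r0; have := ltn_modp p q; rewrite q0 ltnNge.
  rewrite qmin //; apply: cofinW (cofinI vp vq) => t [hp hq] y Dy.
  have /(congr1 (fun p => ev2 p t y)) := e.
  by rewrite ev2Z ev2D ev2M hp // hq // !mulr0 add0r.
(* Up to a factor in K[t], q is h g with g the gcd, and one factor vanishes at the solutions. It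
   cannot be g, since p would vanish as well; so h does, and minimality makes g constant in y. A
   Bezout relation leaves only a polynomial in t to avoid. *)
have copq p : nonvan p -> cofin (fun t => forall y, ev2 q t y = 0 -> ev2 p t y != 0).
  move=> np; set g := gcdp p q.
  have g0 : g != 0 by rewrite gcdp_eq0 negb_and q0 orbT.
  have /Pdiv.Idomain.dvdpP[[c h] /= c0 e] : g %| q by apply: dvdp_gcdr.
  have h0 : h != 0.
    apply: contraNneq q0 => h0; move/eqP: e.
    by rewrite h0 mul0r scale_poly_eq0 (negPf c0).
  have vgh : van (h * g).
    rewrite -e; apply: cofinW vq => t hq y Dy; by rewrite ev2Z hq // mulr0.
  have sg : size g = 1%N.
    case: (vanM vgh) => [vh|vg]; last first.
      have /Pdiv.Idomain.dvdpP[[c' h'] /= c'0 e'] : g %| p by apply: dvdp_gcdl.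
      case: (@van_nonvan p) => //; apply: vanZ c'0 _; rewrite e'.
      by apply: cofinW vg => t hg y Dy; rewrite ev2M hg // mulr0.
    have := qmin _ h0 vh; rewrite -(size_scale q c0) e size_mul //.
    have sg0 : (0 < size g)%N by rewrite size_poly_gt0.
    by move: sg0; move: (size h) (size g) => a b; lia.
  have [[u v] /= uv] := Pdiv.Idomain.Bezoutp p q.
  have /Pdiv.Idomain.eqpP[[c1 c2] /= /andP[c10 c20] ec] := uv.
  have /size1_polyC eg : (size g <= 1)%N by rewrite sg.
  have gc0 : c2 * g`_0 != 0.
    by rewrite mulf_neq0 //; apply: contraNneq g0 => e0; rewrite eg e0.
  apply: cofinW (cofin_ne0 gc0) => t ht y qy; apply: contra_neqN ht => /eqP py.
  have /(congr1 (fun p => ev2 p t y)) := ec.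
  rewrite -/g !ev2Z ev2D !ev2M py qy !mulr0 addr0 mulr0 hornerM.
  by move=> ->; congr (_ * _); rewrite [in RHS]eg /ev2 hornerC.
have transfer P : constr P -> cofin (fun t => forall y z, D t z -> ev2 q t y = 0 ->
    (P (pt2 t y) <-> P (pt2 t z))).
  elim=> [f /pfun_pt2[p fp]|Q _ IH|P1 P2 _ IH1 _ IH2].
  - case: (van_dich p) => [vp|np].
      have [c [h [c0 e]]] := divq p vp.
      apply: cofinW (cofinI (cofin_ne0 c0) vp) => t [ct hp] y z Dz qy.
      rewrite !fp (hp z) //; split => // _.
      have /(congr1 (fun p => ev2 p t y)) := e.
      by rewrite ev2Z ev2M qy mulr0 => /eqP; rewrite mulf_eq0 (negPf ct) => /eqP.
    apply: cofinW (cofinI np (copq p np)) => t [h1 pencil_minors] y z Dz qy.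
    by rewrite !fp; split => /eqP; [rewrite (negPf (pencil_minors _ qy))|rewrite (negPf (h1 _ Dz))].
  - by apply: cofinW IH => t h y z Dz qy; rewrite (h y z).
  - by apply: cofinW (cofinI IH1 IH2) => t [h1 pencil_minors] y z Dz qy; rewrite (h1 y z) // (pencil_minors y z).
have rootD : cofin (fun t => forall y z, D t z -> ev2 q t y = 0 -> D t y).
  by apply: cofinW (transfer _ cD) => t h y z Dz /(h y z Dz); rewrite !D_pt2 => ->.
have sizeqt : cofin (fun t => size (map_poly (horner_eval t) q) = size q).
  apply: cofinW (cofin_ne0 lq0) => t qt.
  by rewrite size_map_poly_id0 // /horner_eval.
have sq2 : size q = 2%N.
  apply/eqP; rewrite eqn_leq sq1 andbT leqNgt; apply/negP => sq3.
  (* Characteristic zero enters here. *)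
  have dq0 : q^`() != 0.
    rewrite -size_poly_eq0; apply: contraTneq sq3 => sd.
    have : (q^`())`_(size q).-2 = 0 by rewrite nth_default // sd.
    rewrite coef_deriv prednK; last by case: (size q) sq1 => [|[]].
    rewrite -/(lead_coef q) -mulr_natl => /eqP; rewrite mulf_eq0 (negPf lq0) orbF.
    rewrite -polyC_natr polyC_eq0 pnatr_eq0.
    by case: (size q) sq1 => [|[|k]].
  have nd : nonvan q^`().
    case: (van_dich q^`()) => // vd; have := qmin _ dq0 vd.
    by rewrite leqNgt lt_size_deriv.
  have [t [[y Dy uy] [/(_ _ Dy) ndy [rD [sz /(_ _ Dy) qy]]]]] :=
    cofin_ex (cofinI uD (cofinI nd (cofinI rootD (cofinI sizeqt vq)))).
  have /factor_theorem[r er] : root (map_poly (horner_eval t) q) y.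
    by rewrite /root -ev2_map qy.
  have r0 : r != 0.
    by apply: contraTneq sq1 => r0; rewrite -sz er r0 mul0r size_poly0.
  have sr : size r != 1%N.
    move: sq3; rewrite -sz er size_mul ?polyXsubC_eq0 // size_XsubC addn2 /= ltnS.
    by case: (size r) => [|[]].
  (* A root z of the cofactor is again a solution, hence equal to y; so y is a double root and the
     derivative vanishes there. *)
  have [z rz] := closed_rootP r sr.
  have zy : z = y.
    apply: uy; apply: rD Dy _; rewrite ev2_map er hornerM.
    by move/eqP: rz => ->; rewrite mul0r.
  case/eqP: ndy; rewrite ev2_map -deriv_map er derivM derivXsubC mulr1.
  rewrite hornerD hornerM hornerXsubC subrr mulr0 add0r -zy; exact/eqP.
exists (- q`_0), q`_1; have q10 : q`_1 != 0 by move: lq0; rewrite lead_coefE sq2.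
apply: cofinW (cofinI uD (cofinI rootD (cofin_ne0 q10))) => t [[y Dy _] [h qt]].
split=> //; apply: h Dy _; rewrite ev2_map.
rewrite (@horner_coef_wide _ 2); last first.
  by rewrite -sq2; apply: size_poly.
rewrite big_ord_recl big_ord1 !coef_map /= /horner_eval expr0 mulr1 expr1 hornerN.
by rewrite mulrCA divff // mulr1 subrr.
Qed.

End UniqueSolution.
End Rationality.

(** * Vectors depending polynomially on a parameter *)

Section PolynomialVectors.
Variable K : numClosedFieldType.

Definition evr m n (p : 'M[{poly K}]_(m, n)) (t : K) : 'M[K]_(m, n) :=
  map_mx (horner_eval t) p.

Lemma evrE m n (p : 'M[{poly K}]_(m, n)) t i j : evr p t i j = (p i j).[t].
Proof. by rewrite mxE. Qed.

Lemma polyf_evr m n (p : 'M[{poly K}]_(m, n)) i j : polyf (fun t => evr p t i j).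
Proof. by exists (p i j) => t; rewrite evrE. Qed.

Lemma divide_evr n (p : 'rV[{poly K}]_n) t0 : evr p t0 = 0 ->
  exists r : 'rV_n, p = ('X - t0%:P) *: r.
Proof.
move=> p0; exists (\row_j (p 0 j %/ ('X - t0%:P))).
apply/rowP => j; rewrite !mxE mulrC divpK // dvdp_XsubCl /root.
by have /rowP/(_ j) := p0; rewrite evrE mxE => ->.
Qed.

Lemma evrZ n c (p : 'rV[{poly K}]_n) t : evr (c *: p) t = c.[t] *: evr p t.
Proof. by apply/rowP => j; rewrite !mxE /horner_eval hornerM. Qed.

Lemma evrD n (p q : 'rV[{poly K}]_n) t : evr (p + q) t = evr p t + evr q t.
Proof. by apply/rowP => j; rewrite !mxE /horner_eval hornerD. Qed.

Lemma size_XsubC_scale n (t0 : K) (r : 'rV[{poly K}]_n) j :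
  size ((('X - t0%:P) *: r) 0 j) = (if r 0 j == 0 then 0%N else (size (r 0 j)).+1).
Proof.
rewrite mxE; case: eqP => [->|/eqP r0]; first by rewrite mulr0 size_poly0.
by rewrite size_mul ?polyXsubC_eq0 // size_XsubC.
Qed.

(** A common root of the entries is divided out, which changes the vectors over other parameters by
    a nonzero factor only. The total size of the entries drops since p is not zero. *)
Lemma reduce_evr n (D : K -> 'rV[K]_n -> Prop) (p : 'rV[{poly K}]_n) :
  (forall t w, D t w -> w != 0) ->
  (forall t w c, c != 0 -> D t w -> D t (c *: w)) ->
  cofin (fun t => D t (evr p t)) ->
  exists2 q : 'rV[{poly K}]_n, cofin (fun t => D t (evr q t)) & forall t, evr q t != 0.
Proof.
move=> D0 DZ; have [N] := ubnP (\sum_j size (p 0%R j)); elim: N p => // N IH p pN Dp.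
have [[t0 pt0]|h] := pselect (exists t, evr p t = 0); last first.
  by exists p => // t; apply/eqP => pt; apply: h; exists t.
have [r er] := divide_evr pt0; apply: (IH r); last first.
  apply: cofinW (cofinI Dp (cofin_neq t0)) => t [].
  rewrite er evrZ hornerXsubC => Dt; rewrite -subr_eq0 => tt0.
  rewrite -[evr r t]scale1r -(mulVf tt0) -scalerA; apply: DZ Dt.
  by rewrite invr_eq0.
rewrite -ltnS; apply: leq_trans pN; rewrite ltnS.
have [t /D0 pt] := cofin_ex Dp.
have [j rj] : exists j, r 0 j != 0.
  apply: contrapT => h; move/eqP: pt; apply; rewrite er evrZ.
  suff -> : r = 0 by rewrite /evr map_mx0 scaler0.
  by apply/rowP => j; rewrite mxE; apply: contrapT => /eqP rj; apply: h; exists j.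
rewrite (bigD1 j) //= [X in (_ < X)%N](bigD1 j) //=.
rewrite er size_XsubC_scale (negPf rj) addSn ltnS leq_add2l.
apply: leq_sum => l _; rewrite size_XsubC_scale.
by case: eqP => [->|_]; rewrite ?size_poly0.
Qed.

(** Normalizing one coordinate of the solution to 1 makes the vector unique, so that each other
    coordinate is the unique solution of a constructible relation and hence rational; denominators
    and common roots are then cleared. *)
Lemma rational_line n (D : K -> 'rV[K]_n -> Prop) :
  constr (fun v : 'rV[K]_(1 + n) => D (v 0 (lshift n 0)) (rsubmx v)) ->
  (forall t w, D t w -> w != 0) ->
  (forall t w c, c != 0 -> D t w -> D t (c *: w)) ->
  cofin (fun t => exists2 w, D t w & forall w', D t w' -> exists c, w' = c *: w) ->
  exists2 q : 'rV[{poly K}]_n, cofin (fun t => D t (evr q t)) & forall t, evr q t != 0.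
Proof.
move=> cD D0 DZ uD.
(* If no coordinate were nonzero on the solutions for almost all t, the dichotomy would make all of
   them zero for almost all t. *)
have [i hi] : exists i, cofin (fun t => exists2 w, D t w & w 0 i != 0).
  apply: contrapT => h.
  have h' i : cofin (fun t => ~ exists2 w, D t w & w 0 i != 0).
    have cE : constr (fun v : 'rV[K]_(1 + n) =>
        D (v 0 (lshift n 0)) (rsubmx v) /\ ~ (v 0 (rshift 1 i) = 0)).
      by apply: ConstrI => //; apply: ConstrN; apply: Constr0; apply: pfun_coord.
    have [j|e|e] := @constr_cofin _ _ _ (fun t => t%:M) (constr_ex cE).
    - apply: (fr_ext (polyfP K) (polyf_id K)) => t.
      by rewrite mxE (ord1 j) eqxx.
    - case: h; exists i; apply: cofinW e => t [w []].
      rewrite row_mxEl row_mxEr row_mxKr mxE eqxx mulr1n => Dw /eqP w0.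
      by exists w.
    - apply: cofinW e => t e [w Dw w0]; apply: e; exists w.
      by rewrite row_mxEl row_mxEr row_mxKr mxE eqxx mulr1n; split=> //; apply/eqP.
  have [t [[w Dw _] ht]] := cofin_ex (cofinI uD (cofin_all h')).
  case/eqP: (D0 _ _ Dw); apply/rowP => j; rewrite mxE.
  by apply: contrapT => /eqP wj; apply: (ht j); exists w.
have sol j : exists ab : {poly K} * {poly K}, cofin (fun t => ab.2.[t] != 0 /\
    exists w, [/\ D t w, w 0 i = 1 & w 0 j = ab.1.[t] / ab.2.[t]]).
  suff [a [b h]] : exists a b : {poly K}, cofin (fun t => b.[t] != 0 /\
      exists w, [/\ D t w, w 0 i = 1 & w 0 j = a.[t] / b.[t]]) by exists (a, b).
  apply: (@rational_solution _ (fun t y => exists w, [/\ D t w, w 0 i = 1 & w 0 j = y])).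
    pose Q (v : 'rV[K]_((1 + 1) + n)) := D (v 0 (lshift n (lshift 1 0))) (rsubmx v) /\
      (v 0 (rshift (1 + 1) i) - 1 = 0 /\
       v 0 (rshift (1 + 1) j) - v 0 (lshift n (rshift 1 0)) = 0).
    have cQ : constr Q.
      have P := pfunP K (1 + 1 + n).
      have cc l := pfun_coord K (n := 1 + 1 + n) l.
      apply: ConstrI; last first.
        apply: ConstrI; apply: Constr0; last exact: (fr_sub P).
        by apply: (fr_sub P) => //; apply: (fr_cst P).
      pose phi (v : 'rV[K]_(1 + 1 + n)) : 'rV[K]_(1 + n) :=
        row_mx (v 0 (lshift n (lshift 1 0)))%:M (rsubmx v).
      have := constr_pre (phi := phi) cD; rewrite /phi => h.
      apply: (constr_ext (h _)) => [l|v]; last first.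
        by rewrite row_mxEl row_mxKr mxE eqxx.
      case: (split_ordP l) => u ->.
        by apply: (fr_ext P (cc _)) => v; rewrite row_mxEl (ord1 u) mxE eqxx.
      by apply: (fr_ext P (cc _)) => v; rewrite row_mxEr mxE.
    apply: (constr_ext (constr_ex cQ)) => v; split=> [[w]|[w [Dw wi wj]]].
      rewrite /Q !row_mxEl !row_mxEr row_mxKr => -[Dw [/eqP wi /eqP wj]].
      by exists w; split=> //; apply/eqP; rewrite -subr_eq0.
    exists w; rewrite /Q !row_mxEl !row_mxEr row_mxKr wi wj !subrr; by split.
  apply: cofinW (cofinI uD hi) => t [[w Dw uw] [w1 Dw1 w1i]].
  have [c ec] := uw _ Dw1.
  have wi0 : w 0 i != 0 by apply: contraNneq w1i => e; rewrite ec mxE e mulr0.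
  exists (w 0 j / w 0 i).
    exists ((w 0 i)^-1 *: w); split; first by apply: DZ Dw; rewrite invr_eq0.
      by rewrite mxE mulVf.
    by rewrite mxE mulrC.
  move=> z [w2 [/uw[c2 ->]]]; rewrite !mxE => e <-.
  have -> : c2 = (w 0 i)^-1 by rewrite -[LHS](mulfK wi0) e mul1r.
  by rewrite mulrC.
have [ab hab] := choice sol.
pose p : 'rV[{poly K}]_n := \row_j ((ab j).1 * \prod_(l | l != j) (ab l).2).
apply: (@reduce_evr _ D p) => //.
apply: cofinW (cofinI uD (cofin_all hab)) => t [[w Dw uw] h].
have [_ [w1 [Dw1 w1i _]]] := h i.
have w1E j : w1 0 j = (ab j).1.[t] / (ab j).2.[t].
  have [_ [w2 [/uw[c2 e2] w2i <-]]] := h j; have [c1 e1] := uw _ Dw1.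
  have wi0 : w 0 i != 0.
    by apply/eqP => e; move/eqP: w1i; rewrite e1 mxE e mulr0 eq_sym oner_eq0.
  suff e : c1 = c2 by rewrite e1 e2 e.
  by apply: (mulIf wi0); move: w1i w2i; rewrite e1 e2 !mxE => -> ->.
have -> : evr p t = (\prod_j (ab j).2.[t]) *: w1.
  apply/rowP => j; rewrite evrE !mxE hornerM horner_prod w1E.
  rewrite [in RHS](bigD1 j) //=; have [b0 _] := h j.
  by field.
by apply: DZ => //; apply/prodf_neq0 => j _; have [] := h j.
Qed.

End PolynomialVectors.

(** * Homogenization of polynomials in one variable *)

Section BinaryForms.
Variable K : fieldType.

(** The homogenization of p in degree N - 1, where N bounds [size p]; for N = 0 it is the zero
    form. *)
Definition bform (N : nat) (p : {poly K}) (a b : K) :=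
  \sum_(i < N) p`_i * a ^+ (N - i.+1) * b ^+ i.

Lemma bform1 N (p : {poly K}) b : (size p <= N)%N -> bform N p 1 b = p.[b].
Proof.
move=> sp; rewrite (horner_coef_wide _ sp); apply: eq_bigr => i _.
by rewrite expr1n mulr1.
Qed.

Lemma bform_scale N (p : {poly K}) (c a b : K) : bform N p (c * a) (c * b) = c ^+ N.-1 * bform N p a b.
Proof.
rewrite /bform mulr_sumr; apply: eq_bigr => i _.
have -> : N.-1 = (N - i.+1 + i)%N by have := ltn_ord i; lia.
rewrite !exprMn exprD; ring.
Qed.

Lemma bform_horner N (p : {poly K}) (a b : K) : a != 0 -> (size p <= N)%N ->
  bform N p a b = a ^+ N.-1 * p.[b / a].
Proof.
move=> a0 sp; rewrite -(bform1 _ sp) -bform_scale mulr1.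
by rewrite [a * _]mulrC divfK.
Qed.

Lemma bform01 N (p : {poly K}) : (size p <= N)%N -> bform N p 0 1 = p`_N.-1.
Proof.
case: N => [|N] sp; first by rewrite /bform big_ord0 nth_default.
rewrite /bform big_ord_recr /= subnn expr0 expr1n !mulr1 big1 ?add0r // => i _.
have -> : (N.+1 - i.+1 = (N - i).-1.+1)%N by have := ltn_ord i; lia.
by rewrite expr0n /= mulr0 mul0r.
Qed.

Lemma fr_bform X (S : (X -> K) -> Prop) N (p : {poly K}) f g : funring S -> S f -> S g ->
  S (fun x => bform N p (f x) (g x)).
Proof.
move=> SP Sf Sg; apply: (fr_sum SP) => i _.
apply: (fr_mul SP); last exact: (fr_exp SP).
by apply: (fr_mul SP); [exact: (fr_cst SP)|exact: (fr_exp SP)].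
Qed.

End BinaryForms.

(** * Lines in closed cones *)

Section ClosedCones.
Variable K : numClosedFieldType.

(** Closedness is tested along polynomial curves only; this follows from any system of equations and
    suffices for the limits taken below. *)
Definition closed_cone n (X : 'rV[K]_n -> Prop) :=
  [/\ constr X, forall c w, X w -> X (c *: w) &
      forall gam : K -> 'rV[K]_n, (forall j, polyf (fun s => gam s 0 j)) ->
        cofin (fun s => X (gam s)) -> forall s, X (gam s)].

(** The top coefficient is the point at infinity of the curve: s^d q(1/s) lies in X for nonzero s
    and extends to s = 0. *)
Lemma cone_lead n (X : 'rV[K]_n -> Prop) (q : 'rV[{poly K}]_n) d :
  closed_cone X -> (forall s, X (evr q s)) -> (forall j, (size (q 0%R j) <= d.+1)%N) ->
  X (\row_j (q 0 j)`_d).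
Proof.
move=> [_ XZ Xg] Xq sq.
pose g (s : K) : 'rV[K]_n := \row_j bform d.+1 (q 0 j) s 1.
have -> : \row_j (q 0 j)`_d = g 0.
  by apply/rowP => j; rewrite !mxE bform01.
apply: Xg => [j|].
  apply: (fr_ext (polyfP K) (f := fun s => bform d.+1 (q 0 j) s 1)) => [|s].
    by apply: (fr_bform _ _ (polyfP K)); [exact: polyf_id|exact: (fr_cst (polyfP K))].
  by rewrite mxE.
apply: cofinW (cofin_neq 0) => s s0.
have -> : g s = s ^+ d *: evr q s^-1.
  by apply/rowP => j; rewrite !mxE bform_horner // div1r.
exact: XZ.
Qed.

Lemma closed_polyE (b : {poly K}) : (forall s, b.[s] != 0) -> (size b <= 1)%N.
Proof.
move=> h; rewrite leqNgt; apply/negP => sb.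
have [s /rootP bs] := @closed_rootP _ b (negbT (gtn_eqF sb)).
by have := h s; rewrite bs eqxx.
Qed.

Section Line.
Variables (n : nat) (X : 'rV[K]_n -> Prop) (a0 a1 : 'cV[K]_n).
Hypothesis XP : closed_cone X.

Definition section_pt s w := [/\ X w, w != 0 & w *m (a0 + s *: a1) = 0].

Hypothesis uS : cofin (fun s => exists2 w, section_pt s w &
  forall w', section_pt s w' -> exists c, w' = c *: w).
Variables w0 w1 : 'rV[K]_n.
Hypothesis u0 : forall w, section_pt 0 w -> exists c, w = c *: w0.
Hypothesis u1 : forall w, section_pt 1 w -> exists c, w = c *: w1.
Hypothesis w0a1 : w0 *m a1 != 0.

Lemma constr_section : constr (fun v : 'rV[K]_(1 + n) =>
  section_pt (v 0 (lshift n 0)) (rsubmx v)).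
Proof.
have P := pfunP K (1 + n); case: XP => cX XZ _.
have cr j : pfun (fun v : 'rV[K]_(1 + n) => (rsubmx v) 0 j).
  by apply: (fr_ext P (pfun_coord K (rshift 1 j))) => v; rewrite mxE.
have h : constr (fun v : 'rV[K]_(1 + n) => X (rsubmx v) /\ (rsubmx v != 0 /\
    (rsubmx v *m (a0 + (v 0 (lshift n 0)) *: a1)) 0 0 = 0)).
  apply: ConstrI; first exact: (constr_pre cX).
  apply: ConstrI; first exact: constr_ne0.
  apply: Constr0; apply: (fr_mulmx P) => i j; first by rewrite (ord1 i).
  rewrite (ord1 j).
  apply: (fr_ext P (f := fun v : 'rV[K]_(1 + n) => a0 i 0 + v 0 (lshift n 0) * a1 i 0)).
    apply: (fr_add P); first exact: (fr_cst P).
    by apply: (fr_mul P); [exact: pfun_coord|exact: (fr_cst P)].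
  by move=> v; rewrite !mxE.
apply: (constr_ext h) => v; split.
  move=> [Xv [v0 e]]; split=> //; apply/matrixP => i j.
  by rewrite (ord1 i) (ord1 j) e mxE.
by move=> [Xv v0 ->]; rewrite mxE.
Qed.

(* A polynomial parametrization [q s] of the points of X on the pencil of
   hyperplanes has degree 1, since both a root of [q s *m a1] and a top
   coefficient of degree at least 2 would be a second point of X on [a0]. *)
Lemma cone_contains_line c0 c1 : X (c0 *: w0 + c1 *: w1).
Proof.
case: (XP) => cX XZ Xg.
have SZ s w c : c != 0 -> section_pt s w -> section_pt s (c *: w).
  move=> c0' [Xw w_neq0 e]; split; first exact: XZ.
    by rewrite scaler_eq0 negb_or c0'.
  by rewrite -scalemxAl e scaler0.
have [q Sq q0] := rational_line constr_section (fun t w '(And3 _ h _) => h) SZ uS.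
have Xq s : X (evr q s).
  apply: (Xg (evr q)); first by move=> j; apply: polyf_evr.
  by apply: cofinW Sq => t [].
pose b : {poly K} := (q *m map_mx polyC a1) 0 0.
have bE s : b.[s] = (evr q s *m a1) 0 0.
  rewrite /b !mxE horner_sum; apply: eq_bigr => j _.
  by rewrite !mxE hornerM hornerC.
(* On the hyperplane of parameter s one has q.a0 = - s (q.a1), for almost all s and therefore as
   polynomials. *)
have a0E : (q *m map_mx polyC a0) 0 0 = - ('X * b).
  apply/eqP; rewrite -subr_eq0 opprK; apply/eqP; apply: poly_cofin0.
  apply: cofinW Sq => s [_ _ /matrixP/(_ 0 0)].
  rewrite mulmxDr -scalemxAr [X in _ = X -> _]mxE hornerD hornerM hornerX bE => <-.
  rewrite [in RHS]mxE [X in _ = _ + X]mxE; congr (_ + _).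
  rewrite !mxE horner_sum; apply: eq_bigr => j _.
  by rewrite !mxE hornerM hornerC.
have Sall s : section_pt s (evr q s).
  split=> //; apply/matrixP => i j; rewrite (ord1 i) (ord1 j) mulmxDr -scalemxAr.
  rewrite [LHS]mxE [X in _ + X = _]mxE -bE.
  have -> : (evr q s *m a0) 0 0 = ((q *m map_mx polyC a0) 0 0).[s].
    rewrite !mxE horner_sum; apply: eq_bigr => l _.
    by rewrite !mxE hornerM hornerC.
  by rewrite a0E hornerN hornerM hornerX [RHS]mxE addNr.
(* The points of X on [a0] are multiples of [w0], which is off [a1]; so X meets the base locus of
   the pencil only in 0. *)
have no_second w : X w -> w != 0 -> w *m a0 = 0 -> w *m a1 = 0 -> False.
  move=> Xw w_neq0 wa0 wa1; have [|c ew] := u0 (w := w).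
    by split; rewrite ?scale0r ?addr0.
  move: wa1; rewrite ew -scalemxAl => /eqP; rewrite scaler_eq0 (negPf w0a1) orbF.
  by move=> /eqP c_eq0; rewrite ew c_eq0 scale0r eqxx in w_neq0.
have sb : (size b <= 1)%N.
  apply: closed_polyE => s; apply/eqP => bs; have [_ _] := Sall s.
  have e1 : evr q s *m a1 = 0.
    by apply/matrixP => i j; rewrite (ord1 i) (ord1 j) -bE bs mxE.
  rewrite mulmxDr -scalemxAr e1 scaler0 addr0 => e0.
  exact: (no_second (evr q s)).
have lead_mul (a : 'cV[K]_n) d :
    (\row_j (q 0 j)`_d *m a) = (((q *m map_mx polyC a) 0 0)`_d)%:M.
  apply/matrixP => i j; rewrite (ord1 i) (ord1 j) !mxE eqxx mulr1n coef_sum.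
  by apply: eq_bigr => l _; rewrite !mxE coefMC.
have sq2 j : (size (q 0%R j) <= 2)%N.
  pose d := (\max_j size (q 0%R j))%N; have dj l : (size (q 0%R l) <= d)%N by apply: leq_bigmax.
  apply: leq_trans (dj j) _; rewrite leqNgt; apply/negP => d3.
  have [l ld] : exists l, size (q 0%R l) = d.
    have n0 : (0 < #|'I_n|)%N by rewrite card_ord (leq_ltn_trans _ (ltn_ord j)).
    by rewrite /d; case: (bigop.eq_bigmax (fun l => size (q 0%R l)) n0) => l ->; exists l.
  have dd l' : (size (q 0%R l') <= d.-1.+1)%N by rewrite prednK //; apply: leq_trans d3.
  have := cone_lead XP Xq dd; move=> /no_second; apply.
  - apply/eqP => /rowP/(_ l); rewrite !mxE => /eqP; rewrite -ld -/(lead_coef _) lead_coef_eq0.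
    by apply/negP; rewrite -size_poly_eq0 ld; case: (d) d3.
  - rewrite lead_mul a0E coefN mulrC coefMX; apply/matrixP => i i'.
    rewrite nth_default ?oppr0; last by move: sb d3; case: (d) => [|[|[|k]]] //= h _; exact: leq_trans h _.
    by rewrite if_same oppr0 !mxE mul0rn.
  - rewrite lead_mul nth_default; last by move: sb d3; case: (d) => [|[|[|k]]] //= h _; exact: leq_trans h _.
    by apply/matrixP => i i'; rewrite !mxE mul0rn.
pose qa : 'rV[K]_n := \row_j (q 0 j)`_0; pose qb : 'rV[K]_n := \row_j (q 0 j)`_1.
have qE s : evr q s = qa + s *: qb.
  apply/rowP => j; rewrite evrE (horner_coef_wide _ (sq2 j)) big_ord_recl big_ord1.
  by rewrite !mxE /= expr0 expr1 mulr1 mulrC.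
have [k0 e0] := u0 (Sall 0); have [k1 e1] := u1 (Sall 1).
have k00 : k0 != 0.
  by apply: contraNneq (q0 0) => k00; rewrite e0 k00 scale0r.
have k10 : k1 != 0.
  by apply: contraNneq (q0 1) => k10; rewrite e1 k10 scale0r.
have -> : w0 = k0^-1 *: qa.
  by rewrite -[qa]addr0 -(scale0r qb) -qE e0 scalerA mulVf // scale1r.
have -> : w1 = k1^-1 *: (qa + qb).
  by rewrite -[qb]scale1r -qE e1 scalerA mulVf // scale1r.
rewrite !scalerA; move: (c0 / k0) (c1 / k1) => d0 d1.
have -> : d0 *: qa + d1 *: (qa + qb) = (d0 + d1) *: qa + d1 *: qb.
  by rewrite scalerDr addrA -scalerDl.
(* For d0 + d1 = 0 the point is the one at infinity on the parametrized line, supplied by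
   [cone_lead]. *)
have [->|d0d1] := eqVneq (d0 + d1) 0.
  by rewrite scale0r add0r; apply: XZ; apply: (cone_lead XP).
have -> : (d0 + d1) *: qa + d1 *: qb = (d0 + d1) *: evr q (d1 / (d0 + d1)).
  by rewrite qE scalerDr scalerA [X in _ = _ + X *: _]mulrC divfK.
exact: XZ.
Qed.

End Line.
End ClosedCones.

(** * Planes over the projective line *)

Section Saturation.
Variables (K : numClosedFieldType) (n : nat) (e : 'I_n -> nat).
Hypothesis e1 : forall j, (e j <= 1)%N.

Definition indep2 (u v : 'rV[K]_n) :=
  forall a b, a *: u + b *: v = 0 -> a = 0 /\ b = 0.

Lemma indep2C u v : indep2 u v -> indep2 v u.
Proof. by move=> h a b; rewrite addrC => /h[-> ->]. Qed.

(* The entry of index j is homogenized in degree [a + e j - 1]. *)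
Definition bvec (a : nat) (p : 'rV[{poly K}]_n) (t0 t1 : K) : 'rV[K]_n :=
  \row_j bform (a + e j) (p 0 j) t0 t1.

Variables p0 q0 : 'rV[{poly K}]_n.

(** Sections of degrees a and b over the projective line, twisted by e, which for general t are
    independent and lie in the span of [p0] and [q0]. *)
Definition spanning_pair a b (p q : 'rV[{poly K}]_n) :=
  [/\ forall j, (size (p 0%R j) <= a + e j)%N, forall j, (size (q 0%R j) <= b + e j)%N,
      cofin (fun t => indep2 (evr p t) (evr q t)) &
      cofin (fun t => forall c d, exists c' d',
        c *: evr p t + d *: evr q t = c' *: evr p0 t + d' *: evr q0 t)].

Lemma spanning_pairC a b p q : spanning_pair a b p q -> spanning_pair b a q p.
Proof.
move=> [sp sq ipq span]; split=> //; first by apply: cofinW ipq => t /indep2C.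
by apply: cofinW span => t h c d; rewrite addrC.
Qed.

Lemma spanning_pair_add a b p q (h : {poly K}) : (a <= b)%N -> (size h <= (b - a).+1)%N ->
  spanning_pair a b p q -> spanning_pair a b p (q + h *: p).
Proof.
move=> ab sh [sp sq ipq span]; split=> //.
- move=> j; rewrite !mxE (leq_trans (size_polyD _ _)) // geq_max sq /=.
  have [->|p_neq0] := eqVneq (p 0 j) 0; first by rewrite mulr0 size_poly0.
  have := size_polyMleq h (p 0 j); have := sp j.
  move: sh ab; move: (size h) (size (p 0%R j)) (size (h * p 0%R j)%R) (e j) => x y z u; lia.
- apply: cofinW ipq => t it c d; rewrite evrD evrZ scalerDr scalerA addrCA.
  rewrite -scalerDl addrC => /it[cd d0]; split=> //.
  by move: cd; rewrite d0 mul0r addr0.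
- apply: cofinW span => t it c d.
  have [c' [d' e']] := it (c + d * h.[t]) d; exists c', d'; rewrite -e'.
  by rewrite evrD evrZ scalerDr scalerA addrCA -scalerDl addrC.
Qed.

Lemma spanning_pair_neq0 a b p q : spanning_pair a b p q -> q != 0.
Proof.
move=> [_ _ ipq _]; apply/eqP => q_eq0; have [t it] := cofin_ex ipq.
have [|_ /eqP] := it 0 1; last by rewrite oner_eq0.
by rewrite q_eq0 /evr map_mx0 scale0r scaler0 addr0.
Qed.

Lemma spanning_pair_divide a b p q t0 : evr q t0 = 0 -> spanning_pair a b p q ->
  exists b' r, b = b'.+1 /\ spanning_pair a b' p r.
Proof.
move=> qt0 h; have [r er] := divide_evr qt0; have := h.
move=> [sp sq ipq span].
have sr j : r 0 j != 0 -> (size (r 0%R j) < b + e j)%N.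
  by move=> rj; have := sq j; rewrite er size_XsubC_scale (negPf rj).
(* For b = 0 the bound e j <= 1 makes q constant, and a constant vector vanishing at t0 is zero. *)
have b0 : (0 < b)%N.
  rewrite lt0n; apply/eqP => b0; have /eqP := spanning_pair_neq0 h; apply.
  rewrite er; suff -> : r = 0 by rewrite scaler0.
  apply/rowP => j; rewrite mxE; apply: contrapT => /eqP rj; have := sr j rj.
  rewrite b0 add0n; have := e1 j; have : (0 < size (r 0%R j))%N by rewrite size_poly_gt0.
  by move: (size (r 0%R j)) => x; lia.
exists b.-1, r; split; first by rewrite prednK.
have tt : cofin (fun t => t - t0 != 0).
  by apply: cofinW (cofin_neq t0) => t; rewrite subr_eq0.
split=> //.
- move=> j; have [->|rj] := eqVneq (r 0 j) 0; first by rewrite size_poly0.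
  by have := sr j rj; move: (size (r 0%R j)) => x; lia.
- apply: cofinW (cofinI tt ipq) => t [t_neq it] c d ecd.
  have [|-> /eqP] := it c (d / (t - t0)); last first.
    by rewrite mulf_eq0 invr_eq0 (negPf t_neq) orbF => /eqP.
  by rewrite er evrZ hornerXsubC scalerA divfK.
- apply: cofinW (cofinI tt span) => t [t_neq it] c d.
  have [c' [d' e']] := it c (d / (t - t0)); exists c', d'; rewrite -e'.
  by rewrite er evrZ hornerXsubC scalerA divfK.
Qed.

Lemma spanning_pair_lead a b (p q : 'rV[{poly K}]_n) : (forall j, (q 0 j)`_(b + e j).-1 = 0) ->
  spanning_pair a b p q -> exists b', b = b'.+1 /\ spanning_pair a b' p q.
Proof.
move=> lq h; have [sp sq ipq span] := h.
have sq' j : (size (q 0%R j) <= (b + e j).-1)%N.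
  apply/leq_sizeP => i; rewrite leq_eqVlt => /orP[/eqP<-//|lti].
  by rewrite nth_default // (leq_trans (sq j)) //; lia.
have b0 : (0 < b)%N.
  rewrite lt0n; apply/eqP => b0; have /eqP := spanning_pair_neq0 h; apply.
  apply/rowP => j; rewrite mxE; apply/eqP; rewrite -size_poly_eq0 -leqn0.
  by apply: leq_trans (sq' j) _; rewrite b0; have := e1 j; lia.
exists b.-1; rewrite prednK //; split=> //; split=> // j.
by apply: leq_trans (sq' j) _; lia.
Qed.

(** Induction on a + b. A dependence of p and q at some point, finite or infinite, allows one of
    them to be corrected by a multiple of the one of smaller degree so that it vanishes there;
    dividing lowers a + b. The final pair splits the saturated rank two bundle into two line
    bundles. *)
Lemma saturate : cofin (fun t => indep2 (evr p0 t) (evr q0 t)) ->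
  exists a b p q, spanning_pair a b p q /\
    forall t0 t1, (t0 != 0) || (t1 != 0) -> indep2 (bvec a p t0 t1) (bvec b q t0 t1).
Proof.
move=> ind0; pose D := (\max_j size (p0 0%R j) + \max_j size (q0 0%R j))%N.
have : exists a b p q, spanning_pair a b p q.
  exists D, D, p0, q0; split=> //.
  - move=> j; rewrite -addnA; apply: leq_trans (leq_addr _ _).
    exact: (leq_bigmax (F := fun j => size (p0 0%R j))).
  - move=> j; rewrite /D addnAC; apply: leq_trans (leq_addl _ _).
    exact: (leq_bigmax (F := fun j => size (q0 0%R j))).
  - by apply: cofinT => t c d; exists c, d.
move=> [a [b [p [q]]]]; have [N] := ubnP (a + b); elim: N a b p q => // N IH a b p q.
wlog ab : a b p q / (a <= b)%N.
  move=> h abN sp; have [ab|/ltnW ba] := leqP a b; first exact: (h a b p q).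
  by apply: (h b a q p) => //; [rewrite addnC|exact: spanning_pairC].
rewrite ltnS => abN sp.
have [h|h] := pselect (forall t0 t1, (t0 != 0) || (t1 != 0) ->
    indep2 (bvec a p t0 t1) (bvec b q t0 t1)).
  by exists a, b, p, q.
have hp b' r : (a + b' < a + b)%N -> spanning_pair a b' p r ->
    exists a b p q, spanning_pair a b p q /\
    forall t0 t1, (t0 != 0) || (t1 != 0) -> indep2 (bvec a p t0 t1) (bvec b q t0 t1).
  by move=> lt; apply: IH; apply: leq_trans abN.
have hq a' r : (a' + b < a + b)%N -> spanning_pair b a' q r ->
    exists a b p q, spanning_pair a b p q /\
    forall t0 t1, (t0 != 0) || (t1 != 0) -> indep2 (bvec a p t0 t1) (bvec b q t0 t1).
  by move=> lt sr; apply: (IH b a' q r) => //; rewrite addnC; apply: leq_trans abN.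
case: (sp) => sizep sizeq _ _.
suff [[t dep]|dep] : (exists t, ~ indep2 (evr p t) (evr q t)) \/
    ~ indep2 (\row_j (p 0 j)`_(a + e j).-1) (\row_j (q 0 j)`_(b + e j).-1).
- have [c [d [ecd ncd]]] : exists c d, c *: evr p t + d *: evr q t = 0 /\
      ~ (c = 0 /\ d = 0).
    apply: contrapT => hc; apply: dep => c d ecd; apply: contrapT => ncd.
    by apply: hc; exists c, d.
  have [d0|d0] := eqVneq d 0.
    have c0 : c != 0 by apply/eqP => c0; apply: ncd.
    have pt0 : evr p t = 0.
      by move: ecd; rewrite d0 scale0r addr0 => /eqP; rewrite scaler_eq0 (negPf c0) => /eqP.
    have [a' [r [ea sr]]] := spanning_pair_divide pt0 (spanning_pairC sp).
    by apply: hq sr; rewrite ea.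
  have qt0 : evr (q + (c / d)%:P *: p) t = 0.
    rewrite evrD evrZ hornerC; apply: (scalerI d0).
    by rewrite scaler0 scalerDr scalerA mulrC divfK // addrC.
  have sp' : spanning_pair a b p (q + (c / d)%:P *: p).
    by apply: spanning_pair_add => //; apply: leq_trans (size_polyC_leq1 _) _.
  have [b' [r [eb sr]]] := spanning_pair_divide qt0 sp'.
  by apply: hp sr; rewrite eb addnS.
- have [c [d [ecd ncd]]] : exists c d,
      (forall j, c * (p 0 j)`_(a + e j).-1 + d * (q 0 j)`_(b + e j).-1 = 0) /\
      ~ (c = 0 /\ d = 0).
    apply: contrapT => hc; apply: dep => c d ecd; apply: contrapT => ncd.
    apply: hc; exists c, d; split=> // j.
    by have /rowP/(_ j) := ecd; rewrite !mxE.
  have [d0|d0] := eqVneq d 0.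
    have c0 : c != 0 by apply/eqP => c0; apply: ncd.
    have [|a' [ea sr]] := spanning_pair_lead (p := q) (q := p) _ (spanning_pairC sp).
      move=> j; move: (ecd j); rewrite d0 mul0r addr0 => /eqP.
      by rewrite mulf_eq0 (negPf c0) => /eqP.
    by apply: hq sr; rewrite ea.
  (* At infinity the top coefficients of p and q are compared in degrees b - a apart, hence this
     shift of p. *)
  pose h' := (c / d) *: 'X^(b - a) : {poly K}.
  have sp' : spanning_pair a b p (q + h' *: p).
    apply: spanning_pair_add => //; apply: leq_trans (size_scale_leq _ _) _.
    by rewrite size_polyXn.
  have [|b' [eb sr]] := spanning_pair_lead _ sp'; last by apply: hp sr; rewrite eb addnS.
  move=> j; rewrite !mxE coefD /h' -scalerAl coefZ coefXnM.
  have -> : (if ((b + e j).-1 < b - a)%N then 0 else (p 0 j)`_((b + e j).-1 - (b - a))) =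
      (p 0 j)`_(a + e j).-1.
    have [ae0|ae0] := posnP (a + e j).
      have pj : p 0 j = 0.
        by apply/eqP; rewrite -size_poly_eq0 -leqn0 (leq_trans (sizep j)) // ae0.
      by rewrite pj !coef0 if_same.
    have -> : ((b + e j).-1 < b - a)%N = false by apply/negbTE; lia.
    by congr (_`_ _); lia.
  apply: (mulfI d0); rewrite mulr0 -[RHS](ecd j).
  by field.
apply: contrapT => /not_orP[fin inf]; apply: h => t0 t1 t01 c d ecd.
have {}ecd j : c * bform (a + e j) (p 0 j) t0 t1 + d * bform (b + e j) (q 0 j) t0 t1 = 0.
  by have /rowP/(_ j) := ecd; rewrite !mxE.
have [t00|t00] := eqVneq t0 0.
  have t10 : t1 != 0 by move: t01; rewrite t00 eqxx.
  have E N' (f : {poly K}) : (size f <= N')%N ->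
      bform N' f t0 t1 = t1 ^+ N'.-1 * f`_N'.-1.
    by move=> sf; rewrite -(bform01 sf) -bform_scale mulr0 mulr1 t00.
  have [|ca db] := contrapT inf (c * t1 ^+ a) (d * t1 ^+ b).
    apply/rowP => j; rewrite !mxE; have := ecd j; rewrite !E //.
    (* The extra factor t1 replaces the exponent (N' + e j).-1 by N' + e j, so that t1 ^+ e j splits
       off; the truncation at N' + e j = 0 is harmless because f is then 0. The chart t0 != 0 below
       is treated alike. *)
    move=> /(congr1 (fun x => t1 * x)); rewrite mulr0 mulrDr.
    have L N' (f : {poly K}) : (size f <= N' + e j)%N ->
        t1 * (t1 ^+ (N' + e j).-1 * f`_(N' + e j).-1) =
        t1 ^+ e j * (t1 ^+ N' * f`_(N' + e j).-1).
      move=> sf; have [N0|N0] := posnP (N' + e j).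
        have -> : f = 0 by apply/eqP; rewrite -size_poly_eq0 -leqn0 -N0.
        by rewrite !coef0 !mulr0.
      by rewrite !mulrA -exprS prednK // -exprD addnC.
    rewrite [t1 * (c * _)]mulrCA [t1 * (d * _)]mulrCA !L //.
    rewrite [c * (t1 ^+ e j * _)]mulrCA [d * (t1 ^+ e j * _)]mulrCA -mulrDr => /eqP.
    by rewrite mulf_eq0 expf_eq0 (negPf t10) andbF /= !mulrA => /eqP.
  move/eqP: ca; rewrite mulf_eq0 expf_eq0 (negPf t10) andbF orbF => /eqP->.
  by move/eqP: db; rewrite mulf_eq0 expf_eq0 (negPf t10) andbF orbF => /eqP->.
have it : indep2 (evr p (t1 / t0)) (evr q (t1 / t0)).
  by apply: contrapT => hi; apply: fin; exists (t1 / t0).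
have [|ca db] := it (c * t0 ^+ a) (d * t0 ^+ b).
  apply/rowP => j; rewrite !mxE /horner_eval; have := ecd j; rewrite !bform_horner //.
  move=> /(congr1 (fun x => t0 * x)); rewrite mulr0 mulrDr.
  have L N' (f : {poly K}) x : (size f <= N' + e j)%N ->
      t0 * (t0 ^+ (N' + e j).-1 * f.[x]) = t0 ^+ e j * (t0 ^+ N' * f.[x]).
    move=> sf; have [N0|N0] := posnP (N' + e j).
      have -> : f = 0 by apply/eqP; rewrite -size_poly_eq0 -leqn0 -N0.
      by rewrite !horner0 !mulr0.
    by rewrite !mulrA -exprS prednK // -exprD addnC.
  rewrite [t0 * (c * _)]mulrCA [t0 * (d * _)]mulrCA !L //.
  rewrite [c * (t0 ^+ e j * _)]mulrCA [d * (t0 ^+ e j * _)]mulrCA -mulrDr => /eqP.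
  by rewrite mulf_eq0 expf_eq0 (negPf t00) andbF /= !mulrA => /eqP.
move/eqP: ca; rewrite mulf_eq0 expf_eq0 (negPf t00) andbF orbF => /eqP->.
by move/eqP: db; rewrite mulf_eq0 expf_eq0 (negPf t00) andbF orbF => /eqP->.
Qed.

End Saturation.

(** * Plücker coordinates *)

Section Minors.
Variable F : fieldType.

Definition pcols k m (j : 'I_#|pidx k m|) : 'I_k -> 'I_m := tnth (val (enum_val j)).

Definition minors k m (A : 'M[F]_(k, m)) : 'rV[F]_#|pidx k m| :=
  \row_j \det (colsub (pcols j) A).

Lemma minors_mul k m (g : 'M[F]_k) (A : 'M[F]_(k, m)) :
  minors (g *m A) = \det g *: minors A.
Proof.
apply/rowP => j; rewrite !mxE -det_mulmx; congr (\det _).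
by apply/matrixP => i l; rewrite !mxE; apply: eq_bigr => u _; rewrite mxE.
Qed.

(** A repeated column gives 0, and sorting distinct columns costs a sign. Unsorted selections arise
    when a product of matrices is expanded. *)
Lemma minors_colsub k m (f : 'I_k -> 'I_m) : exists phi : 'cV[F]_#|pidx k m|,
  forall A : 'M[F]_(k, m), (minors A *m phi) 0 0 = \det (colsub f A).
Proof.
have [inj|ninj] := boolP (injectiveb f); last first.
  exists 0 => A; rewrite mulmx0 mxE.
  have [i [j [ij fij]]] : exists i j, i != j /\ f i = f j.
    apply: contrapT => h; case/injectiveP: ninj => i j fij.
    by apply: contrapT => /eqP ij; apply: h; exists i, j.
  rewrite -det_tr; symmetry; apply: (determinant_alternate ij) => l.
  by rewrite !mxE fij.
have s_size : size (sort (fun x y : 'I_m => (x <= y)%N) (codom f)) == k.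
  by rewrite size_sort size_codom card_ord.
pose t : k.-tuple 'I_m := Tuple s_size.
have st : sorted ltn [seq val i | i <- t].
  rewrite ltn_sorted_uniq_leq map_inj_uniq ?sort_uniq; last exact: val_inj.
  rewrite [uniq _]inj /= sorted_map; apply: sort_sorted => x y.
  exact: leq_total.
pose j0 : 'I_#|pidx k m| := enum_rank (exist _ t st).
have : perm_eq [tuple f i | i < k] t.
  rewrite perm_sym /= perm_sort codomE /=.
  by rewrite perm_refl.
move=> /tuple_permP[p ep].
have fp i : f i = tnth t (p i).
  have -> : f i = tnth [tuple f i | i < k] i by rewrite tnth_mktuple.
  rewrite (tnth_nth (f i)) ep -tnth_nth tnth_mktuple //.
exists ((-1) ^+ p *: delta_mx j0 0) => A.
have -> : colsub f A = col_perm p (colsub (pcols j0) A).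
  by apply/matrixP => i j; rewrite !mxE /pcols enum_rankK fp.
rewrite col_permE det_mulmx det_perm -scalemxAr mxE mulrC -odd_permV; congr (_ * _).
rewrite mxE (bigD1 j0) //= !mxE !eqxx mulr1 big1 ?addr0 // => j jj0.
by rewrite !mxE (negPf jj0) mulr0.
Qed.

(** Only linearity in the Plücker vector is recorded: a projection g onto F^k thereby reads a
    coordinate off the vector. *)
Lemma Cauchy_Binet k m (g : 'M[F]_(m, k)) : exists phi : 'cV[F]_#|pidx k m|,
  forall A : 'M[F]_(k, m), (minors A *m phi) 0 0 = \det (A *m g).
Proof.
have [phi hphi] := choice (fun f : {ffun 'I_k -> 'I_m} => minors_colsub f).
exists (\sum_(f : {ffun 'I_k -> 'I_m}) (\prod_i g (f i) i) *: phi f) => A.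
rewrite mulmx_sumr summxE -det_tr /determinant.
transitivity (\sum_(f : {ffun 'I_k -> 'I_m}) (\prod_i g (f i) i) * \det (colsub f A)^T).
  by apply: eq_bigr => f _; rewrite -scalemxAr mxE hphi det_tr.
rewrite /determinant.
under eq_bigr => f _ do rewrite mulr_sumr.
rewrite exchange_big /=; apply: eq_bigr => s _.
under [in RHS]eq_bigr => i _ do rewrite mxE mxE.
rewrite bigA_distr_bigA /= mulr_sumr; apply: eq_bigr => f _.
rewrite mulrCA -big_split /=; congr (_ * _); apply: eq_bigr => i _.
by rewrite !mxE mulrC.
Qed.

Lemma minors_neq0 k m (A : 'M[F]_(k, m)) : row_free A -> minors A != 0.
Proof.
move=> /row_freeP[g Ag]; have [phi hphi] := Cauchy_Binet g.
apply: contraTneq isT => A0; have /eqP := hphi A.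
by rewrite A0 mul0mx Ag det1 mxE eq_sym oner_eq0.
Qed.

Lemma det_col_mx_linear k (a b : F) (x y : 'rV[F]_(1 + k)) (M : 'M[F]_(k, 1 + k)) :
  \det (col_mx (a *: x + b *: y) M) = a * \det (col_mx x M) + b * \det (col_mx y M).
Proof.
apply: (@determinant_multilinear _ _ _ _ _ (lshift k 0)).
- by rewrite !rowKu; apply/rowP => j; rewrite !mxE.
- by apply/matrixP => i j; rewrite !mxE; case: splitP => // l; rewrite (ord1 l).
- by apply/matrixP => i j; rewrite !mxE; case: splitP => // l; rewrite (ord1 l).
Qed.

Lemma det_row_mx_linear k (a b : F) (x y : 'cV[F]_(1 + k)) (M : 'M[F]_(1 + k, k)) :
  \det (row_mx (a *: x + b *: y) M) = a * \det (row_mx x M) + b * \det (row_mx y M).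
Proof.
rewrite -det_tr tr_row_mx linearP /= linearZ /= det_col_mx_linear.
by rewrite -2!tr_row_mx !det_tr.
Qed.

Lemma det_row_mx_expand k (w : 'cV[F]_(1 + k)) (M : 'M[F]_(1 + k, k)) :
  \det (row_mx w M) = \sum_i w i 0 * (-1) ^+ i * \det (row' i M).
Proof.
rewrite (expand_det_col _ (lshift k 0)); apply: eq_bigr => i _.
rewrite /cofactor addn0 row_mxEl -mulrA; congr (_ * (_ * \det _)).
apply/matrixP => a b; rewrite !mxE; case: splitP => l /=.
  by rewrite (ord1 l) /bump.
by rewrite /bump /= => /eqP; rewrite eqSS => /eqP/val_inj->.
Qed.

Section Hyperplanes.
Variables k m : nat.
Implicit Types (B : 'M[F]_(1 + k, m)) (w : 'rV[F]_(1 + k)).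

(* Up to a scalar, the Plücker vector of the hyperplane [w = 0] of the row
   space of B, see [plucker_hyp]. *)
Definition psi B w : 'rV[F]_#|pidx k m| :=
  \row_j \det (row_mx w^T (colsub (pcols j) B)).

Lemma psi_linear B a b w w' : psi B (a *: w + b *: w') = a *: psi B w + b *: psi B w'.
Proof.
by apply/rowP => j; rewrite !mxE linearP /= linearZ /= det_row_mx_linear.
Qed.

Lemma psiZ B a w : psi B (a *: w) = a *: psi B w.
Proof. by have := psi_linear B a 0 w 0; rewrite !scale0r !addr0. Qed.

Lemma psiD B w w' : psi B (w + w') = psi B w + psi B w'.
Proof. by have := psi_linear B 1 1 w w'; rewrite !scale1r. Qed.

Lemma psi_minors B w : psi B w = \sum_i (w 0 i * (-1) ^+ i) *: minors (row' i B).
Proof.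
apply/rowP => j; rewrite mxE det_row_mx_expand summxE; apply: eq_bigr => i _.
rewrite !mxE; congr (_ * \det _).
by apply/matrixP => a b; rewrite !mxE.
Qed.

Lemma psi_Cauchy_Binet (g : 'M[F]_(m, k)) : exists phi : 'cV[F]_#|pidx k m|,
  forall B w, (psi B w *m phi) 0 0 = \det (row_mx w^T (B *m g)).
Proof.
have [phi hphi] := Cauchy_Binet g; exists phi => B w.
rewrite psi_minors mulmx_suml summxE det_row_mx_expand; apply: eq_bigr => i _.
rewrite -scalemxAl mxE hphi mxE; congr (_ * \det _).
by apply/matrixP => a b; rewrite !mxE; apply: eq_bigr => l _; rewrite mxE.
Qed.

End Hyperplanes.
End Minors.

(** * Row spaces and their hyperplanes *)

Section RowSpaces.
Variable F : fieldType.

Lemma vlineZ (V : vectType F) (c : F) (v : V) : c != 0 -> <[c *: v]>%VS = <[v]>%VS.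
Proof.
move=> c0; apply/eqP; rewrite eqEsubv -!memvE; apply/andP; split.
  by rewrite memvZ // memv_line.
by rewrite -[v in v \in _](scale1r v) -(mulVf c0) -scalerA memvZ // memv_line.
Qed.

Definition rowvs k m (A : 'M[F]_(k, m)) : {vspace 'rV[F]_m} :=
  (linfun (mulmxr A : 'rV[F]_k -> 'rV[F]_m) @: fullv)%VS.

Lemma mem_rowvs k m (A : 'M[F]_(k, m)) v :
  reflect (exists u, v = u *m A) (v \in rowvs A).
Proof.
apply: (iffP memv_imgP) => [[u _ ->]|[u ->]].
  by exists u; rewrite lfunE.
by exists u; rewrite ?memvf // lfunE.
Qed.

Lemma mem_rowvs_mul k m (A : 'M[F]_(k, m)) u : u *m A \in rowvs A.
Proof. by apply/mem_rowvs; exists u. Qed.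

Lemma rowvs_sub k m (A : 'M[F]_(k, m)) (S : {vspace 'rV[F]_m}) :
  (forall i, row i A \in S) -> (rowvs A <= S)%VS.
Proof.
move=> h; apply/subvP => v /mem_rowvs[u ->].
by rewrite mulmx_sum_row memv_suml // => i _; rewrite memvZ.
Qed.

Lemma dim_rV n : \dim (fullv : {vspace 'rV[F]_n}) = n.
Proof. by rewrite dimvf /dim /= mul1n. Qed.

Lemma dim_rowvs k m (A : 'M[F]_(k, m)) : row_free A -> \dim (rowvs A) = k.
Proof.
move=> rA; rewrite limg_dim_eq ?dim_rV //.
apply/eqP; rewrite -subv0; apply/subvP => u; rewrite memv_cap => /andP[_].
rewrite memv_ker lfunE /= => /eqP uA; rewrite memv0; apply/eqP.
by apply: (row_free_inj rA); rewrite uA mul0mx.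
Qed.

Definition basis_mx k m (S : {vspace 'rV[F]_m}) : 'M[F]_(k, m) :=
  \matrix_i ((vbasis S)`_i : 'rV[F]_m).

Lemma row_basis_mx k m (S : {vspace 'rV[F]_m}) i : row i (basis_mx k S) = (vbasis S)`_i.
Proof. by rewrite rowK. Qed.

Lemma rowvs_basis_mx k m (S : {vspace 'rV[F]_m}) : \dim S = k -> rowvs (basis_mx k S) = S.
Proof.
move=> dS; apply/eqP; rewrite eqEsubv; apply/andP; split.
  apply: rowvs_sub => i; rewrite row_basis_mx vbasis_mem // mem_nth //.
  by rewrite size_tuple dS.
apply/subvP => v /coord_vbasis->; rewrite memv_suml // => i _; rewrite memvZ //.
have ik : (i < k)%N by rewrite -dS.
have -> : (vbasis S)`_i = row (Ordinal ik) (basis_mx k S) by rewrite row_basis_mx.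
by rewrite rowE mem_rowvs_mul.
Qed.

Lemma row_free_basis_mx k m (S : {vspace 'rV[F]_m}) : \dim S = k -> row_free (basis_mx k S).
Proof.
move=> dS; have fS := basis_free (vbasisP S).
apply: inj_row_free => v; rewrite mulmx_sum_row => v0.
apply/rowP => i; rewrite mxE.
have ei (j : 'I_k) : (j < \dim S)%N by rewrite dS.
have /freeP := fS => /(_ (fun j : 'I_(\dim S) => v 0 (cast_ord dS j))).
move=> h; have := h _ (cast_ord (esym dS) i); rewrite cast_ordKV; apply.
rewrite -[RHS]v0 (reindex (cast_ord (esym dS))); last first.
  by exists (cast_ord dS) => j _; rewrite ?cast_ordK ?cast_ordKV.
by apply: eq_bigr => j _; rewrite row_basis_mx cast_ordKV.
Qed.

Lemma plucker_coordE k m (S : {vspace 'rV[F]_m}) : plucker_coord k S = minors (basis_mx k S).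
Proof.
apply/rowP => j; rewrite !mxE; congr (\det _).
by apply/matrixP => a b; rewrite !mxE.
Qed.

Lemma rowvs_eq k m (A A' : 'M[F]_(k, m)) : row_free A -> row_free A' ->
  rowvs A = rowvs A' -> exists2 g, g \in unitmx & A' = g *m A.
Proof.
move=> rA rA' e.
have [f hf] : exists f : 'I_k -> 'rV_k, forall i, row i A' = f i *m A.
  suff /boolp.choice[f hf] : forall i, exists u, row i A' = u *m A by exists f.
  move=> i; apply/mem_rowvs.
  by rewrite e rowE mem_rowvs_mul.
have eA : A' = (\matrix_i f i) *m A.
  by apply/row_matrixP => i; rewrite hf row_mul rowK.
exists (\matrix_i f i) => //.
rewrite -row_full_unit -col_leq_rank.
by rewrite -{1}(eqP rA') eA mxrankM_maxl.
Qed.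

Lemma plucker_rowvs k m (A : 'M[F]_(k, m)) : row_free A ->
  plucker k (rowvs A) = <[minors A]>%VS.
Proof.
move=> rA; have dA := dim_rowvs rA; rewrite /plucker plucker_coordE.
have [g gu ->] := rowvs_eq rA (row_free_basis_mx dA) (esym (rowvs_basis_mx dA)).
by rewrite minors_mul vlineZ // -unitfE -unitmxE.
Qed.

Lemma mulmx_rsub0 k m (z : 'rV[F]_(1 + k)) (A : 'M[F]_(1 + k, m)) :
  z 0 (lshift k 0) = 0 -> z *m A = rsubmx z *m dsubmx A.
Proof.
move=> z0; rewrite -{1}[z]hsubmxK -{1}[A]vsubmxK mul_row_col.
suff -> : lsubmx z = 0 by rewrite mul0mx add0r.
by apply/matrixP => i j; rewrite (ord1 i) (ord1 j) !mxE z0.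
Qed.

Section Hyperplanes.
Variables k m : nat.
Implicit Types (B : 'M[F]_(1 + k, m)) (w : 'rV[F]_(1 + k)).

Definition hyp B w : {vspace 'rV[F]_m} :=
  (linfun (mulmxr B : 'rV[F]_(1 + k) -> 'rV[F]_m) @:
   lker (linfun (mulmxr w^T : 'rV[F]_(1 + k) -> 'rV[F]_1)))%VS.

Lemma mem_hyp B w v : reflect (exists2 x, x *m w^T = 0 & v = x *m B) (v \in hyp B w).
Proof.
apply: (iffP memv_imgP) => [[x]|[x xw ->]].
  by rewrite memv_ker !lfunE /= => /eqP xw ->; exists x; rewrite ?lfunE.
by exists x; rewrite ?memv_ker lfunE //= xw.
Qed.

Lemma hyp_sub B w : (hyp B w <= rowvs B)%VS.
Proof. by apply/subvP => v /mem_hyp[x _ ->]; apply: mem_rowvs_mul. Qed.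

Lemma hypZ B w c : c != 0 -> hyp B (c *: w) = hyp B w.
Proof.
move=> c0; apply/vspaceP => v; apply/mem_hyp/mem_hyp => -[x xw ->]; exists x => //.
  by move: xw; rewrite linearZ /= -scalemxAr => /eqP; rewrite scaler_eq0 (negPf c0) => /eqP.
by rewrite linearZ /= -scalemxAr xw scaler0.
Qed.

(** A base change g turns w into a multiple of the first coordinate functional, so the lower rows of
    [g *m B] span its kernel; a block triangular determinant compares [psi] with their minors. *)
Lemma hyp_basis B w : row_free B -> w != 0 -> exists A, exists2 c,
  c != 0 & [/\ row_free A, hyp B w = rowvs A & psi B w = c *: minors A].
Proof.
move=> rB w0.
have [U [lam [Uu lam0 ew]]] : exists (U : 'M[F]_(1 + k)) (lam : F),
    [/\ U \in unitmx, lam != 0 & w = lam *: row (lshift k 0) U].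
  exists (row_ebase w), (col_ebase w 0 0); split; first exact: row_ebase_unit.
    have := col_ebase_unit w; rewrite unitmxE unitfE.
    by rewrite {1}[col_ebase w]mx11_scalar det_scalar1.
  have rw1 : \rank w = 1%N.
    by apply/eqP; rewrite eqn_leq rank_leq_row lt0n mxrank_eq0 w0.
  rewrite -[LHS]mulmx_ebase rw1 {1}[col_ebase w]mx11_scalar mul_scalar_mx -scalemxAl.
  congr (_ *: _); rewrite rowE; congr (_ *m _).
  apply/rowP => j; rewrite !mxE /= andbT.
  by rewrite -val_eqE eq_sym.
pose g : 'M[F]_(1 + k) := invmx U^T.
have Utu : U^T \in unitmx by rewrite unitmx_tr.
have gu : g \in unitmx by rewrite unitmx_inv.
have gw : g *m w^T = lam *: delta_mx (lshift k 0) 0.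
  rewrite ew linearZ /= -scalemxAr; congr (_ *: _).
  by rewrite rowE trmx_mul mulKmx // trmx_delta.
exists (dsubmx (g *m B)), (lam / \det g).
  by rewrite mulf_neq0 // invr_eq0 -unitfE -unitmxE.
have rgB : row_free (g *m B).
  apply/row_freeP; have /row_freeP[B' BB'] := rB.
  by exists (B' *m invmx g); rewrite mulmxA -[g *m B *m B']mulmxA BB' mulmx1 mulmxV.
split.
- apply: inj_row_free => v v0.
  have : row_mx 0 v *m (g *m B) = 0 by rewrite mulmx_rsub0 ?row_mxKr // row_mxEl mxE.
  move=> /(congr1 (mulmx^~ (pinvmx (g *m B)))); rewrite mul0mx mulmxKp // => /eqP.
  by rewrite row_mx_eq0 => /andP[_ /eqP].
- apply/vspaceP => v; apply/mem_hyp/mem_rowvs.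
    move=> [x xw ->]; exists (rsubmx (x *m invmx g)).
    rewrite -mulmx_rsub0 ?mulmxA ?mulmxKV //.
    have : x *m invmx g *m (g *m w^T) = 0 by rewrite mulmxA mulmxKV.
    rewrite gw -scalemxAr => /eqP; rewrite scaler_eq0 (negPf lam0) /= => /eqP/matrixP/(_ 0 0).
    by rewrite -colE !mxE.
  move=> [u ->]; exists (row_mx 0 u *m g); last first.
    by rewrite -mulmxA mulmx_rsub0 ?row_mxKr // row_mxEl mxE.
  by rewrite -mulmxA gw -scalemxAr -colE colKl; apply/matrixP => i j; rewrite !mxE mulr0.
- apply/rowP => j; rewrite !mxE; apply: (mulfI (_ : \det g != 0)).
    by rewrite -unitfE -unitmxE.
  rewrite [RHS]mulrA [X in _ = X * _]mulrC divfK; last by rewrite -unitfE -unitmxE.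
  rewrite -det_mulmx mul_mx_row gw.
  have -> : g *m colsub (pcols j) B = colsub (pcols j) (g *m B).
    by apply/matrixP => a b; rewrite !mxE; apply: eq_bigr => u _; rewrite mxE.
  have -> : row_mx (lam *: delta_mx (lshift k 0) 0) (colsub (pcols j) (g *m B)) =
      block_mx lam%:M (colsub (pcols j) (usubmx (g *m B))) 0 (colsub (pcols j) (dsubmx (g *m B))).
    rewrite block_mxEh; congr row_mx; apply/matrixP => a b; case: (split_ordP a) => l ->.
    - by rewrite col_mxEu !mxE (ord1 l) (ord1 b) !eqxx /= mulr1.
    - by rewrite col_mxEd !mxE /= mulr0.
    - by rewrite col_mxEu !mxE.
    - by rewrite col_mxEd !mxE.
  by rewrite det_ublock det_scalar1.
Qed.

Lemma dim_hyp B w : row_free B -> w != 0 -> \dim (hyp B w) = k.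
Proof. by move=> rB w0; have [A [c c0 [rA -> _]]] := hyp_basis rB w0; apply: dim_rowvs. Qed.

Lemma plucker_hyp B w : row_free B -> w != 0 -> plucker k (hyp B w) = <[psi B w]>%VS.
Proof.
move=> rB w0; have [A [c c0 [rA -> ->]]] := hyp_basis rB w0.
by rewrite plucker_rowvs // vlineZ.
Qed.

Lemma psi_eq0 B w : row_free B -> (psi B w == 0) = (w == 0).
Proof.
move=> rB; apply/idP/idP => [|/eqP->]; last first.
  by have := psiZ B 0 0; rewrite !scale0r => ->.
apply: contraTT => w0; have [A [c c0 [rA _ ->]]] := hyp_basis rB w0.
by rewrite scaler_eq0 negb_or c0 minors_neq0.
Qed.

Lemma psi_inj B w w' : row_free B -> psi B w = psi B w' -> w = w'.
Proof.
move=> rB e; apply/eqP; rewrite -subr_eq0 -(psi_eq0 _ rB).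
by rewrite -[- w']scaleN1r psiD psiZ e scaleN1r subrr.
Qed.

Lemma plucker_hyp_inj B w w' : row_free B -> w != 0 -> w' != 0 ->
  plucker k (hyp B w) = plucker k (hyp B w') -> exists2 c, c != 0 & w' = c *: w.
Proof.
move=> rB w0 w'0; rewrite !plucker_hyp // => e.
have : psi B w' \in <[psi B w]>%VS by rewrite e memv_line.
move=> /vlineP[c]; rewrite -psiZ => /(psi_inj rB) ec; exists c => //.
by apply: contraNneq w'0 => c0; rewrite ec c0 scale0r.
Qed.

(** The functional w is orthogonal to the coefficient vectors of a basis of s, which are k vectors
    in a space of dimension 1 + k. *)
Lemma hyp_surj B (s : {vspace 'rV[F]_m}) : row_free B -> \dim s = k -> (s <= rowvs B)%VS ->
  exists2 w, w != 0 & s = hyp B w.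
Proof.
move=> rB ds sB; pose A := basis_mx k s.
have [f hf] : exists f : 'I_k -> 'rV_(1 + k), forall i, row i A = f i *m B.
  suff /boolp.choice[f hf] : forall i, exists u, row i A = u *m B by exists f.
  move=> i; apply/mem_rowvs; apply: (subvP sB).
  by rewrite row_basis_mx vbasis_mem // mem_nth // size_tuple ds.
pose C := \matrix_i f i.
have : kermx C^T != 0.
  rewrite kermx_eq0 /row_free neq_ltn; apply/orP; left.
  by rewrite ltnS (leq_trans (rank_leq_col _)).
move=> /rowV0Pn[w /sub_kermxP wC w0]; exists w => //.
apply/eqP; rewrite eqEdim (dim_hyp rB w0) ds leqnn andbT.
rewrite -(rowvs_basis_mx ds); apply: rowvs_sub => i.
apply/mem_hyp; exists (f i); last exact: hf.
have := congr1 trmx wC; rewrite trmx_mul trmxK trmx0 => /row_matrixP/(_ i).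
by rewrite row_mul rowK row0.
Qed.

End Hyperplanes.
End RowSpaces.

(** * Coordinates adapted to pi and its pencil *)

Section Frame.
Variables (F : fieldType) (k : nat).

Lemma exists_frame (pi : {vspace 'rV[F]_k.+2}) : \dim pi = k ->
  exists (E : 'M[F]_(k, k.+2)) (u0 u1 : 'rV[F]_k.+2),
    row_free (col_mx (col_mx u0 u1) E) /\ rowvs E = pi.
Proof.
move=> dpi; pose C : 'M[F]_(1 + 1, k.+2) := basis_mx 2 (pi^C)%VS.
have dC : \dim (pi^C)%VS = 2%N by rewrite dimv_compl dpi dim_rV; lia.
exists (basis_mx k pi), (usubmx C), (dsubmx C); split; last exact: rowvs_basis_mx.
rewrite vsubmxK; apply: inj_row_free => v; rewrite -[v]hsubmxK mul_row_col => /eqP.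
rewrite addr_eq0 => /eqP e.
have : lsubmx v *m C \in (pi :&: pi^C)%VS.
  rewrite memv_cap -(rowvs_basis_mx dC) mem_rowvs_mul andbT.
  by rewrite e memvN -{2}(rowvs_basis_mx dpi) mem_rowvs_mul.
rewrite capv_compl memv0 => /eqP lC.
have -> : lsubmx v = 0.
  by apply: (row_free_inj (row_free_basis_mx dC)); rewrite mul0mx.
have -> : rsubmx v = 0.
  apply: (row_free_inj (row_free_basis_mx dpi)); rewrite mul0mx.
  by apply/eqP; rewrite -oppr_eq0 -e lC.
by rewrite row_mx0.
Qed.

Variables (E : 'M[F]_(k, k.+2)) (u0 u1 : 'rV[F]_k.+2).
Hypothesis frame : row_free (col_mx (col_mx u0 u1) E).

(* The rows of [Hmx t0 t1] span the member t = (t0 : t1) of the pencil; on it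
   [wv c y] is the functional with value c at [vec t0 t1] and y on the rows of
   E.  The functionals with y = 0 have kernel [rowvs E]. *)
Definition vec (t0 t1 : F) : 'rV[F]_k.+2 := t0 *: u0 + t1 *: u1.
Definition Hmx (t0 t1 : F) : 'M[F]_(1 + k, k.+2) := col_mx (vec t0 t1) E.
Definition wv (c : F) (y : 'rV[F]_k) : 'rV[F]_(1 + k) := row_mx c%:M y.
Definition nz2 (t0 t1 : F) := (t0 != 0) || (t1 != 0).
Definition yof (w : 'rV[F]_(1 + k)) : 'rV[F]_k := rsubmx w.
Definition cof (w : 'rV[F]_(1 + k)) : F := w 0 (lshift k 0).

Lemma wvE w : w = wv (cof w) (yof w).
Proof. by rewrite /wv -[LHS]hsubmxK [lsubmx w]mx11_scalar mxE. Qed.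

Lemma cof_wv c y : cof (wv c y) = c.
Proof. by rewrite /cof row_mxEl mxE eqxx. Qed.

Lemma yof_wv c y : yof (wv c y) = y.
Proof. exact: row_mxKr. Qed.

Lemma wvP w w' : cof w = cof w' -> yof w = yof w' -> w = w'.
Proof. by move=> e1 e2; rewrite (wvE w) (wvE w') e1 e2. Qed.

Lemma wvZ a c y : a *: wv c y = wv (a * c) (a *: y).
Proof. by rewrite /wv scale_row_mx scale_scalar_mx. Qed.

Lemma wv_mul c y B : wv c y *m col_mx B E = c *: B + y *m E.
Proof. by rewrite /wv mul_row_col mul_scalar_mx. Qed.

Lemma wv_dot c y c' y' : wv c y *m (wv c' y')^T = (c * c')%:M + y *m y'^T.
Proof. by rewrite /wv tr_row_mx mul_row_col tr_scalar_mx scalar_mxM. Qed.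

Lemma wv_eq0 c y : (wv c y == 0) = (c == 0) && (y == 0).
Proof.
rewrite row_mx_eq0; congr (_ && _); apply/eqP/eqP => [/matrixP/(_ 0 0)|->].
  by rewrite !mxE eqxx.
exact: raddf0.
Qed.

Lemma frame_inj t0 t1 p : vec t0 t1 + p *m E = 0 -> [/\ t0 = 0, t1 = 0 & p = 0].
Proof.
have : row_mx (row_mx t0%:M t1%:M) p *m col_mx (col_mx u0 u1) E = vec t0 t1 + p *m E.
  by rewrite !mul_row_col !mul_scalar_mx.
move=> <- e; have : row_mx (row_mx t0%:M t1%:M) p = 0.
  by apply: (row_free_inj frame); rewrite mul0mx.
move/eqP; rewrite !row_mx_eq0 => /andP[/andP[/eqP e0 /eqP e1] /eqP->]; split => //.
  by have /matrixP/(_ 0 0) := e0; rewrite !mxE eqxx.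
by have /matrixP/(_ 0 0) := e1; rewrite !mxE eqxx.
Qed.

Lemma frame_ex (x : 'rV[F]_k.+2) : exists t0 t1 p, x = vec t0 t1 + p *m E.
Proof.
have fu : col_mx (col_mx u0 u1) E \in unitmx by rewrite -row_free_unit.
pose z : 'rV_((1 + 1) + k) := x *m invmx (col_mx (col_mx u0 u1) E).
exists (lsubmx (lsubmx z) 0 0), (rsubmx (lsubmx z) 0 0), (rsubmx z).
rewrite -[LHS](mulmxKV fu) -/z -{1}[z]hsubmxK -{1}[lsubmx z]hsubmxK !mul_row_col.
by rewrite {1}[lsubmx (lsubmx z)]mx11_scalar {1}[rsubmx (lsubmx z)]mx11_scalar !mul_scalar_mx.
Qed.

Lemma vecD t0 t1 s0 s1 : vec (t0 + s0) (t1 + s1) = vec t0 t1 + vec s0 s1.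
Proof. by rewrite /vec !scalerDl addrACA. Qed.

Lemma vecZ a t0 t1 : vec (a * t0) (a * t1) = a *: vec t0 t1.
Proof. by rewrite /vec scalerDr !scalerA. Qed.

Lemma frame_uniq t0 t1 p s0 s1 q : vec t0 t1 + p *m E = vec s0 s1 + q *m E ->
  [/\ t0 = s0, t1 = s1 & p = q].
Proof.
move=> e; have [] := @frame_inj (t0 - s0) (t1 - s1) (p - q).
  rewrite vecD -[- s0]mulN1r -[- s1]mulN1r vecZ scaleN1r mulmxBl addrACA e -opprD.
  by rewrite subrr.
by move=> /eqP + /eqP + /eqP; rewrite !subr_eq0 => /eqP-> /eqP-> /eqP->.
Qed.

Lemma row_free_Hmx t0 t1 : nz2 t0 t1 -> row_free (Hmx t0 t1).
Proof.
move=> t; apply: inj_row_free => v; rewrite (wvE v) wv_mul -vecZ.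
move=> /frame_inj[/eqP + /eqP + ->]; rewrite !mulf_eq0.
move: t => /orP[] /negPf-> /=; rewrite orbF.
  by move=> /eqP-> _; apply/eqP; rewrite wv_eq0 !eqxx.
by move=> _ /eqP->; apply/eqP; rewrite wv_eq0 !eqxx.
Qed.

Lemma row_freeE : row_free E.
Proof.
apply: inj_row_free => v vE; have [] // := @frame_inj 0 0 v.
by rewrite vE /vec !scale0r !addr0.
Qed.

(** The value c is taken at [vec t0 t1], which scales with t, while y is taken on the fixed rows of
    E. *)
Lemma hyp_rescale a t0 t1 c y : a != 0 ->
  hyp (Hmx (a * t0) (a * t1)) (wv (a * c) y) = hyp (Hmx t0 t1) (wv c y).
Proof.
move=> a0; apply/vspaceP => v; apply/mem_hyp/mem_hyp => -[x]; rewrite (wvE x).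
  rewrite wv_dot wv_mul vecZ => e ->; exists (wv (cof x * a) (yof x)).
    by rewrite wv_dot -mulrA.
  by rewrite wv_mul scalerA.
rewrite wv_dot wv_mul => e ->; exists (wv (cof x / a) (yof x)).
  by rewrite wv_dot mulrA divfK.
by rewrite wv_mul vecZ scalerA divfK.
Qed.

Lemma hyp_pi t0 t1 c : nz2 t0 t1 -> c != 0 -> hyp (Hmx t0 t1) (wv c 0) = rowvs E.
Proof.
move=> t c0; apply/vspaceP => v; apply/mem_hyp/mem_rowvs.
  move=> [x]; rewrite (wvE x) wv_dot trmx0 mulmx0 addr0 wv_mul.
  move=> /matrixP/(_ 0 0); rewrite !mxE eqxx => /eqP.
  rewrite mulr1n mulf_eq0 (negPf c0) orbF => /eqP-> ->; exists (yof x).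
  by rewrite scale0r add0r.
move=> [p ->]; exists (wv 0 p); last by rewrite wv_mul scale0r add0r.
by rewrite wv_dot trmx0 mulmx0 mul0r addr0; exact: raddf0.
Qed.

Lemma rowvsE_sub t0 t1 : (rowvs E <= rowvs (Hmx t0 t1))%VS.
Proof.
apply/subvP => v /mem_rowvs[p ->]; apply/mem_rowvs; exists (wv 0 p).
by rewrite wv_mul scale0r add0r.
Qed.

Lemma pencil_ex H : \dim H = k.+1 -> (rowvs E <= H)%VS ->
  exists t0 t1, nz2 t0 t1 /\ H = rowvs (Hmx t0 t1).
Proof.
move=> dH EH.
have : ~~ (H <= rowvs E)%VS.
  by apply/negP => /dimvS; rewrite dH (dim_rowvs row_freeE) ltnn.
move=> /subvPn[x xH xE]; have [t0 [t1 [p ex]]] := frame_ex x.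
have tH : vec t0 t1 \in H.
  have -> : vec t0 t1 = x - p *m E by rewrite ex addrK.
  by rewrite memvB //; apply: (subvP EH); apply: mem_rowvs_mul.
have t : nz2 t0 t1.
  apply: contraNT xE; rewrite negb_or !negbK => /andP[/eqP t00 /eqP t10].
  by rewrite ex t00 t10 /vec !scale0r !add0r mem_rowvs_mul.
exists t0, t1; split => //; apply/esym/eqP; rewrite eqEdim dH (dim_rowvs (row_free_Hmx t)).
rewrite leqnn andbT; apply/subvP => v /mem_rowvs[w ->].
rewrite (wvE w) wv_mul memvD //; first by rewrite memvZ.
by apply: (subvP EH); apply: mem_rowvs_mul.
Qed.

Lemma rowvsB_inj t0 t1 s0 s1 : nz2 t0 t1 -> rowvs (Hmx t0 t1) = rowvs (Hmx s0 s1) ->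
  exists a, [/\ a != 0, t0 = a * s0 & t1 = a * s1].
Proof.
move=> t e; have : vec t0 t1 \in rowvs (Hmx s0 s1).
  rewrite -e; apply/mem_rowvs; exists (wv 1 0).
  by rewrite wv_mul scale1r mul0mx addr0.
move=> /mem_rowvs[w]; rewrite (wvE w) wv_mul -vecZ -[LHS]addr0 -(mul0mx _ E).
move=> /frame_uniq[e0 e1 _]; exists (cof w); split => //.
by apply: contraTneq t => c0; rewrite e0 e1 c0 !mul0r /nz2 eqxx.
Qed.

Lemma rowvsBZ a t0 t1 : a != 0 -> rowvs (Hmx (a * t0) (a * t1)) = rowvs (Hmx t0 t1).
Proof.
move=> a0; apply/vspaceP => v; apply/mem_rowvs/mem_rowvs => -[w ->]; rewrite (wvE w) wv_mul.
  by exists (wv (cof w * a) (yof w)); rewrite wv_mul vecZ scalerA.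
by exists (wv (cof w / a) (yof w)); rewrite wv_mul vecZ scalerA divfK.
Qed.

Section Member.
Variables (t0 t1 : F) (w : 'rV[F]_(1 + k)).
Hypotheses (t : nz2 t0 t1) (y0 : yof w != 0).

Lemma yof_neq0 : w != 0.
Proof. by apply: contraNneq y0 => ->; rewrite /yof linear0. Qed.

Lemma hyp_neq_pi : hyp (Hmx t0 t1) w != rowvs E.
Proof.
rewrite -(hyp_pi t (oner_neq0 F)); apply: contraNneq y0 => e.
have w10 : wv 1 0 != 0 by rewrite wv_eq0 oner_eq0.
have [c c0 ew] := plucker_hyp_inj (row_free_Hmx t) yof_neq0 w10 (congr1 (plucker k) e).
have : yof (c *: wv (cof w) (yof w)) = 0 by rewrite -wvE -ew yof_wv.
by rewrite wvZ yof_wv => /eqP; rewrite scaler_eq0 (negPf c0).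
Qed.

Lemma hyp_add_pi : (hyp (Hmx t0 t1) w + rowvs E)%VS = rowvs (Hmx t0 t1).
Proof.
apply/eqP; rewrite eqEdim subv_add hyp_sub rowvsE_sub (dim_rowvs (row_free_Hmx t)) /=.
rewrite ltnNge; apply/negP => h; case/eqP: hyp_neq_pi.
have dk := dim_hyp (row_free_Hmx t) yof_neq0.
apply/eqP; rewrite eq_sym eqEdim dk (dim_rowvs row_freeE) leqnn andbT.
have /eqP -> : hyp (Hmx t0 t1) w == (hyp (Hmx t0 t1) w + rowvs E)%VS.
  by rewrite eqEdim addvSl dk.
exact: addvSr.
Qed.

End Member.

Lemma hyp_neq0_yof t0 t1 w : nz2 t0 t1 -> w != 0 -> hyp (Hmx t0 t1) w != rowvs E -> yof w != 0.
Proof.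
move=> t w0; apply: contraNneq => yw; have e := wvE w.
by rewrite e yw hyp_pi //; apply: contraNneq w0 => c0; rewrite e c0 yw wv_eq0 !eqxx.
Qed.

Lemma Omega_ex (s : {vspace 'rV[F]_k.+2}) : \dim s = k -> (k.-1 <= \dim (s :&: rowvs E))%N ->
  (0 < k)%N ->
  exists t0 t1 w, [/\ nz2 t0 t1, w != 0 & s = hyp (Hmx t0 t1) w].
Proof.
move=> ds dsE k0; have [->|sE] := eqVneq s (rowvs E).
  (* Over every t the functional (1, 0) has kernel pi; the choice t = (1 : 0) is arbitrary. *)
  have t : nz2 (1 : F) 0 by rewrite /nz2 oner_eq0.
  exists 1, 0, (wv 1 0); rewrite wv_eq0 oner_eq0 hyp_pi ?oner_eq0 //.
have dE := dim_rowvs row_freeE.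
have dH : \dim (s + rowvs E)%VS = k.+1.
  have := dimv_sum_cap s (rowvs E); rewrite ds dE.
  have : (\dim (s :&: rowvs E) < k)%N.
    rewrite ltnNge; apply/negP => h; case/eqP: sE; apply/eqP.
    rewrite eqEdim ds dE leqnn andbT.
    have /eqP <- : (s :&: rowvs E)%VS == s by rewrite eqEdim capvSl ds.
    exact: capvSr.
  by move: dsE; lia.
have [t0 [t1 [t eH]]] := pencil_ex dH (addvSr _ _).
have [w w0 ew] : exists2 w, w != 0 & s = hyp (Hmx t0 t1) w.
  by apply: hyp_surj => //; [exact: row_free_Hmx|rewrite -eH addvSl].
by exists t0, t1, w.
Qed.

Lemma mem_hyp_point t0 t1 p w : nz2 t0 t1 ->
  (vec t0 t1 + p *m E \in hyp (Hmx t0 t1) w) = (wv 1 p *m w^T == 0).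
Proof.
move=> t; apply/mem_hyp/eqP => [[x xw e]|e]; last first.
  by exists (wv 1 p) => //; rewrite wv_mul scale1r.
suff -> : wv 1 p = x by [].
by apply: (row_free_inj (row_free_Hmx t)); rewrite -e wv_mul scale1r.
Qed.

(** A point off pi lies on one hyperplane of the pencil only, so s and t are proportional, and
    rescaling moves the functional from s to t. *)
Lemma hyp_point_param t0 t1 s0 s1 p w : nz2 t0 t1 -> nz2 s0 s1 ->
  vec t0 t1 + p *m E \in hyp (Hmx s0 s1) w ->
  exists2 w', hyp (Hmx s0 s1) w = hyp (Hmx t0 t1) w' & (w != 0) = (w' != 0).
Proof.
move=> t s /mem_hyp[x _]; rewrite (wvE x) wv_mul -vecZ => /frame_uniq[e0 e1 _].
have c0 : cof x != 0.
  by apply: contraTneq t => c0; rewrite e0 e1 c0 !mul0r /nz2 eqxx.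
exists (wv (cof x * cof w) (yof w)).
  by rewrite e0 e1 hyp_rescale // -wvE.
by rewrite [in LHS](wvE w) !wv_eq0 mulf_eq0 (negPf c0).
Qed.

(** The determinant is expanded along its first row, which holds c and the minors of [vec t0 t1]:
    the contribution of c does not involve t, and t enters the rest only in products with y. *)
Lemma psi_split t0 t1 c y : psi (Hmx t0 t1) (wv c y) =
  psi (Hmx 1 0) (wv c (t0 *: y)) + psi (Hmx 0 1) (wv 0 (t1 *: y)).
Proof.
apply/rowP => j; rewrite !mxE; set f := pcols j.
have eB s0 s1 c' y' : row_mx (wv c' y')^T (colsub f (Hmx s0 s1)) =
    col_mx (row_mx c'%:M (s0 *: colsub f u0 + s1 *: colsub f u1)) (row_mx y'^T (colsub f E)).
  rewrite /wv tr_row_mx tr_scalar_mx.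
  have -> : colsub f (Hmx s0 s1) = col_mx (s0 *: colsub f u0 + s1 *: colsub f u1) (colsub f E).
    apply/matrixP => a b; rewrite mxE; case: (split_ordP a) => l ->.
      by rewrite !col_mxEu /vec !mxE.
    by rewrite !col_mxEd mxE.
  by rewrite -block_mxEv -block_mxEh.
rewrite !eB !scale1r !scale0r addr0 add0r.
have lin1 (c' : F) (u : 'rV_k) y' :
    \det (col_mx (row_mx c'%:M u) (row_mx y'^T (colsub f E))) =
    c' * \det (colsub f E) + \det (col_mx (row_mx 0 u) (row_mx y'^T (colsub f E))).
  have -> : row_mx c'%:M u = c' *: row_mx 1%:M 0 + 1 *: row_mx 0 u.
    by rewrite !scale_row_mx add_row_mx scaler0 addr0 scaler0 add0r scale1r scalemx1.
  rewrite (det_col_mx_linear (k := k)) mul1r; congr (_ * _ + _).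
  by rewrite -block_mxEv det_lblock det1 mul1r.
have lin2 (a b : F) (u u' : 'rV_k) y' :
    \det (col_mx (row_mx 0 (a *: u + b *: u')) (row_mx y'^T (colsub f E))) =
    a * \det (col_mx (row_mx 0 u) (row_mx y'^T (colsub f E))) +
    b * \det (col_mx (row_mx 0 u') (row_mx y'^T (colsub f E))).
  rewrite -(det_col_mx_linear (k := k)); congr (\det (col_mx _ _)).
  by rewrite !scale_row_mx add_row_mx !scaler0 addr0.
have lin3 (a : F) (u : 'rV_k) y' :
    \det (col_mx (row_mx 0 u) (row_mx (a *: y')^T (colsub f E))) =
    a * \det (col_mx (row_mx 0 u) (row_mx y'^T (colsub f E))).
  rewrite -!block_mxEv !block_mxEh.
  rewrite -[RHS]addr0 -(mul0r (\det (row_mx 0 (col_mx u (colsub f E))))).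
  rewrite -(det_row_mx_linear (k := k)); congr (\det (row_mx _ _)).
  by rewrite scaler0 addr0 scale_col_mx scaler0 linearZ.
rewrite lin1 [in RHS]lin1 -addrA; congr (_ + _).
by rewrite lin2 (raddf0 (@scalar_mx F 1)) !lin3.
Qed.

Lemma minorsB t0 t1 : minors (Hmx t0 t1) = t0 *: minors (Hmx 1 0) + t1 *: minors (Hmx 0 1).
Proof.
apply/rowP => j; rewrite !mxE; set f := pcols j.
have eB s0 s1 : colsub f (Hmx s0 s1) =
    col_mx (s0 *: colsub f u0 + s1 *: colsub f u1) (colsub f E).
  apply/matrixP => a b; rewrite mxE; case: (split_ordP a) => l ->.
    by rewrite !col_mxEu /vec !mxE.
  by rewrite !col_mxEd mxE.
rewrite !eB (det_col_mx_linear (k := k)) !scale1r !scale0r addr0 add0r //.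
Qed.

Lemma minorsB_rank t0 t1 : minors (Hmx t0 t1) = 0 -> t0 = 0 /\ t1 = 0.
Proof.
move=> e; have [t|] := boolP (nz2 t0 t1).
  by have := minors_neq0 (row_free_Hmx t); rewrite e eqxx.
by rewrite negb_or !negbK => /andP[/eqP-> /eqP->].
Qed.

(** This is the determinant of [psi_Cauchy_Binet] for a projection onto F^k in which the i-th
    coordinate along E is replaced by a coordinate of [vec]; it reads off t y_i. Unimodular factors
    on both sides make the matrix triangular. *)
Lemma det_bordered t c (y : 'rV[F]_k) (i : 'I_k) :
  \det (block_mx c%:M (t *: delta_mx 0 i) y^T (1%:M - delta_mx i i)) = - (t * y 0 i).
Proof.
set M := _ - _.
have -> : block_mx c%:M (t *: delta_mx 0 i) y^T M =
    col_mx (c *: row_mx 1%:M 0 + t *: row_mx 0 (delta_mx 0 i)) (row_mx y^T M).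
  by rewrite block_mxEv !scale_row_mx add_row_mx !scaler0 addr0 add0r scalemx1.
rewrite (det_col_mx_linear (k := k)) -!block_mxEv det_lblock det1 mul1r.
have -> : \det M = 0.
  rewrite (expand_det_row _ i) big1 // => j _; rewrite !mxE eqxx /= [j == i]eq_sym.
  by rewrite subrr mul0r.
rewrite mulr0 add0r -mulrN; congr (_ * _).
pose L : 'M[F]_(1 + k) := block_mx 1%:M 0 (delta_mx i 0) 1%:M.
pose R : 'M[F]_(1 + k) := block_mx 1%:M 0 (- y^T) 1%:M.
have dL : \det L = 1 by rewrite /L det_lblock !det1 mulr1.
have dR : \det R = 1 by rewrite /R det_lblock !det1 mulr1.
rewrite -[LHS]mul1r -dL -[LHS]mulr1 -dR -!det_mulmx /L /R !mulmx_block.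
rewrite !mul1mx !mulmx1 !mul0mx !mulmx0 !addr0 !add0r mul_delta_mx /M addrC.
have -> : delta_mx i i + (1%:M - delta_mx i i) = 1%:M :> 'M[F]_k by rewrite addrC subrK.
rewrite mul1mx addNr det_ublock det1 mulr1 [X in \det X]mx11_scalar det_scalar1.
by rewrite mulmxN -rowE !mxE.
Qed.

(* [c], [t0 *: y] and [t1 *: y] are linear in the Plücker vector of the
   hyperplane [c, y]: they are minors of its image under suitable projections
   onto [F^k]. *)
Lemma psi_coordinates : exists (Tc : 'M[F]_(#|pidx k k.+2|, 1)) (T0 T1 : 'M[F]_(#|pidx k k.+2|, k)),
  forall t0 t1 w, [/\ psi (Hmx t0 t1) w *m Tc = (cof w)%:M,
    psi (Hmx t0 t1) w *m T0 = t0 *: yof w & psi (Hmx t0 t1) w *m T1 = t1 *: yof w].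
Proof.
have /row_freeP[G hG] := frame.
have hvec t0 t1 p : (vec t0 t1 + p *m E) *m G = row_mx (row_mx t0%:M t1%:M) p.
  rewrite -[RHS]mulmx1 -hG mulmxA !mul_row_col !mul_scalar_mx //.
have hv t0 t1 : vec t0 t1 *m G = row_mx (row_mx t0%:M t1%:M) 0.
  by rewrite -hvec mul0mx addr0.
have hE : E *m G = row_mx 0 1%:M.
  apply/row_matrixP => i; have := hvec 0 0 (delta_mx 0 i).
  rewrite /vec !scale0r !add0r -rowE -row_mul => ->.
  by rewrite row_row_mx row0 row1 (raddf0 (@scalar_mx F 1)) row_mx0.
pose Gy := rsubmx G; pose G0 := lsubmx (lsubmx G); pose G1 := rsubmx (lsubmx G).
have [Ey E0 E1] : [/\ E *m Gy = 1%:M, E *m G0 = 0 & E *m G1 = 0].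
  by rewrite /Gy /G0 /G1 !(mulmx_lsub, mulmx_rsub) hE row_mxKl row_mxKr !linear0.
have [vy v0 v1] : [/\ forall t0 t1, vec t0 t1 *m Gy = 0,
    forall t0 t1, vec t0 t1 *m G0 = t0%:M & forall t0 t1, vec t0 t1 *m G1 = t1%:M].
  by split=> t0 t1; rewrite /Gy /G0 /G1 !(mulmx_lsub, mulmx_rsub) hv ?row_mxKl ?row_mxKr ?row_mxKl.
have [phic hc] := psi_Cauchy_Binet Gy.
have coordT (Ga : 'M[F]_(k.+2, 1)) (ta : F -> F -> F) : E *m Ga = 0 ->
    (forall t0 t1, vec t0 t1 *m Ga = (ta t0 t1)%:M) ->
    exists T : 'M[F]_(#|pidx k k.+2|, k), forall t0 t1 w,
      psi (Hmx t0 t1) w *m T = ta t0 t1 *: yof w.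
  move=> EGa vGa.
  (* The projection drops the i-th coordinate along E and puts the coordinate [ta] of [vec] in its
     place. *)
  have [phi hphi] := boolp.choice (fun i : 'I_k =>
    psi_Cauchy_Binet (Gy - Gy *m delta_mx i i + Ga *m delta_mx 0 i)).
  exists (- \matrix_(a, i) phi i a 0) => t0 t1 w; apply/rowP => i.
  have -> : (psi (Hmx t0 t1) w *m - (\matrix_(a, i) phi i a 0)) 0 i =
      - (psi (Hmx t0 t1) w *m phi i) 0 0.
    rewrite mulmxN !mxE; congr (- _); apply: eq_bigr => a _; by rewrite [X in _ * X]mxE.
  rewrite hphi [RHS]mxE /yof -[RHS]opprK -(det_bordered _ (cof w)); congr (- \det _).
  rewrite block_mxEh {1}(wvE w) /wv tr_row_mx tr_scalar_mx; congr row_mx.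
  rewrite mul_col_mx !(mulmxDr, mulmxN, mulmxA) vy vGa Ey EGa !mul0mx oppr0 !add0r.
  by rewrite mul_scalar_mx mul1mx addr0.
have [T0 hT0] := coordT G0 (fun t0 _ => t0) E0 v0.
have [T1 hT1] := coordT G1 (fun _ t1 => t1) E1 v1.
exists phic, T0, T1 => t0 t1 w; split => //.
rewrite [LHS]mx11_scalar hc; congr _%:M.
rewrite {1}(wvE w) /wv tr_row_mx tr_scalar_mx mul_col_mx vy Ey.
by rewrite -block_mxEh det_lblock det1 mulr1 det_scalar1.
Qed.
End Frame.

(** * Homogeneous forms *)

Section Homogeneous.
Variable F : fieldType.

Definition hform n d (f : 'rV[F]_n -> F) :=
  exists2 p : {mpoly F[n]}, p \is d.-homog & forall v, f v = p.@[v 0].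

Lemma hform_pfun n d (f : 'rV[F]_n -> F) : hform d f -> pfun f.
Proof. by move=> [p _ fp]; exists p. Qed.

Lemma hform_ext n d (f g : 'rV[F]_n -> F) : hform d f -> f =1 g -> hform d g.
Proof. by move=> [p hform fp] fg; exists p => // v; rewrite -fg. Qed.

Lemma hform_cst n (c : F) : @hform n 0 (fun=> c).
Proof.
exists c%:MP => [|v]; last by rewrite mevalC.
by rewrite -[c%:MP]mulr1 mul_mpolyC; apply: dhomogZ; apply: dhomog1.
Qed.

Lemma hform0 n d : @hform n d (fun=> 0).
Proof. by exists 0; [apply: dhomog0|move=> v; rewrite meval0]. Qed.

Lemma hformD n d (f g : 'rV[F]_n -> F) : hform d f -> hform d g -> hform d (fun v => f v + g v).
Proof.
move=> [p hform fp] [q hq gq]; exists (p + q); first exact: dhomogD.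
by move=> v; rewrite mevalD fp gq.
Qed.

Lemma hformM n d e (f g : 'rV[F]_n -> F) : hform d f -> hform e g -> hform (d + e) (fun v => f v * g v).
Proof.
move=> [p hform fp] [q hq gq]; exists (p * q); first exact: dhomogM.
by move=> v; rewrite mevalM fp gq.
Qed.

Lemma hformZ n d c (f : 'rV[F]_n -> F) : hform d f -> hform d (fun v => c * f v).
Proof.
move=> [p hform fp]; exists (c *: p); first exact: dhomogZ.
by move=> v; rewrite mevalZ fp.
Qed.

Lemma hformN n d (f : 'rV[F]_n -> F) : hform d f -> hform d (fun v => - f v).
Proof. by move=> /(hformZ (-1)) h; apply: (hform_ext h) => v; rewrite mulN1r. Qed.

Lemma hform_sum n d I (s : seq I) (P : pred I) (f : I -> 'rV[F]_n -> F) :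
  (forall i, P i -> hform d (f i)) -> hform d (fun x => \sum_(i <- s | P i) f i x).
Proof.
move=> Sf; elim: s => [|i s IH].
  by apply: (hform_ext (hform0 n d)) => x; rewrite big_nil.
case Pi: (P i); last by apply: (hform_ext IH) => x; rewrite big_cons Pi.
by apply: (hform_ext (hformD (Sf i Pi) IH)) => x; rewrite big_cons Pi.
Qed.

Lemma hform_prod n (d : nat) I (s : seq I) (e : I -> nat) (f : I -> 'rV[F]_n -> F) :
  (forall i, hform (e i) (f i)) -> d = (\sum_(i <- s) e i)%N ->
  hform d (fun x => \prod_(i <- s) f i x).
Proof.
move=> Sf ->; elim: s => [|i s IH].
  by rewrite big_nil; apply: (hform_ext (hform_cst n 1)) => x; rewrite big_nil.
by rewrite big_cons; apply: (hform_ext (hformM (Sf i) IH)) => x; rewrite big_cons.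
Qed.

Lemma hformX n d e (f : 'rV[F]_n -> F) : hform d f -> hform (d * e) (fun v => f v ^+ e).
Proof.
move=> hf; have h := @hform_prod n (d * e) 'I_e (index_enum _) (fun=> d) (fun=> f) (fun=> hf).
apply: (hform_ext (h _)); first by rewrite sum_nat_const card_ord mulnC.
by move=> v; rewrite prodr_const card_ord.
Qed.

Lemma hform_coord n j : hform 1 (fun v : 'rV[F]_n => v 0 j).
Proof.
by exists 'X_j => [|v]; rewrite ?mevalXU // dhomogX; apply/eqP/mdeg1.
Qed.

Lemma hform_lin n m (A : 'M[F]_(n, m)) j : hform 1 (fun v : 'rV[F]_n => (v *m A) 0 j).
Proof.
apply: (@hform_ext _ _ (fun v => \sum_i A i j * v 0 i)).
  by apply: hform_sum => i _; apply: hformZ; apply: hform_coord.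
by move=> v; rewrite mxE; apply: eq_bigr => i _; rewrite mulrC.
Qed.

Lemma hform_det n m (e : 'I_m -> nat) (M : 'rV[F]_n -> 'M[F]_m) :
  (forall i j, hform (e i) (fun v => M v i j)) -> hform (\sum_i e i) (fun v => \det (M v)).
Proof.
move=> hM; apply: hform_sum => s _; apply: hformZ.
by apply: (hform_prod (e := e)) => [i|]; first exact: hM.
Qed.

Lemma hform_scale n d (f : 'rV[F]_n -> F) c v : hform d f -> f (c *: v) = c ^+ d * f v.
Proof.
move=> [p /dhomogP hform fp]; rewrite !fp !mevalE mulr_sumr big_seq [in RHS]big_seq.
apply: eq_bigr => m /hform em; rewrite mulrCA; congr (_ * _).
have {}em : mdeg m = d := em; rewrite -em mdegE expr_sum -big_split /=.
by apply: eq_bigr => i _; rewrite mxE exprMn.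
Qed.

Lemma hform_comp n m d e (f : 'rV[F]_n -> F) (g : 'rV[F]_m -> 'rV[F]_n) :
  hform d f -> (forall j, hform e (fun v => g v 0 j)) -> hform (d * e) (fun v => f (g v)).
Proof.
move=> [p /dhomogP hform fp] hg.
apply: (@hform_ext _ _ (fun v => \sum_(m <- msupp p | m \in msupp p) p@_m * \prod_i g v 0 i ^+ m i)).
  apply: hform_sum => mm /hform em; apply: hformZ.
  apply: (hform_prod (e := fun i => (e * mm i)%N)) => [i|]; first exact: hformX.
  by have {}em : mdeg mm = d := em; rewrite -big_distrr /= -mdegE em mulnC.
by move=> v; rewrite fp mevalE [RHS]big_seq.
Qed.

Lemma hform_bform n N (p : {poly F}) (a b : 'rV[F]_n -> F) : hform 1 a -> hform 1 b ->
  hform N.-1 (fun v => bform N p (a v) (b v)).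
Proof.
move=> ha hb; apply: hform_sum => i _.
have -> : N.-1 = (1 * (N - i.+1) + 1 * i)%N by have := ltn_ord i; lia.
by apply: hformM; [apply: hformZ|]; apply: hformX.
Qed.

Lemma hform_vline n d (f : 'rV[F]_n -> F) u : hform d f ->
  (forall v, v \in <[u]>%VS -> f v = 0) <-> f u = 0.
Proof.
move=> hf; split=> [h|fu v /vlineP[c ->]]; first by apply: h; apply: memv_line.
by rewrite (hform_scale _ _ hf) fu mulr0.
Qed.

Lemma zclosed_hp k m (Fam : ('rV[F]_#|pidx k m| -> F) -> Prop) :
  (forall f, Fam f -> exists d, hform d f) ->
  zclosed k [set S | grass k S /\ forall f, Fam f -> forall v, v \in plucker k S -> f v = 0].
Proof.
move=> hF; exists [set p | (exists d, p \is d.-homog) /\ exists2 f, Fam f & forall v, f v = p.@[v 0]].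
split; first by move=> p [].
apply/seteqP; split=> S [gS h]; split=> //.
  by move=> p [_ [f Ff fp]] v vS; rewrite -fp; apply: h vS.
move=> f Ff v vS; have [d [p hform fp]] := hF f Ff.
by rewrite fp; apply: h vS; split; [exists d|exists f].
Qed.

End Homogeneous.

(** * General points and generic vectors *)

Section Order.
Variable K : numClosedFieldType.

(** One homogeneous part of G is nonzero at x0. Where it is nonzero, G restricted to the multiples
    of x is a nonzero polynomial in the factor. *)
Lemma homogeneous_part n (G : 'rV[K]_n -> K) x0 : pfun G -> G x0 != 0 ->
  exists d G', [/\ hform d G', G' x0 != 0 & forall x, G' x != 0 -> exists2 c, c != 0 & G (c *: x) != 0].
Proof.
move=> [p Gp] Gx0.
pose f d (v : 'rV[K]_n) := (pihomog mdeg d p).@[v 0].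
have hf d : hform d (f d) by exists (pihomog mdeg d p) => //; apply: pihomogP.
have Gf v : G v = \sum_(d < msize p) f d v.
  by rewrite Gp {1}(pihomog_partitionE (leqnn (msize p))) raddf_sum.
have [d fd] : exists d : 'I_(msize p), f d x0 != 0.
  apply: contrapT => h; move/eqP: Gx0; apply; rewrite Gf big1 // => d _.
  by apply: contrapT => /eqP fd; apply: h; exists d.
exists d, (f d); split=> // x fx.
pose q : {poly K} := \poly_(i < msize p) f i x.
have q0 : q != 0.
  by apply: contraNneq fx => q0; have := coef_poly (msize p) (fun i => f i x) d;
    rewrite -/q q0 coef0 ltn_ord => <-.
have [c [qc c0]] := cofin_ex (cofinI (cofin_ne0 q0) (cofin_neq 0)).
exists c => //; move: qc; rewrite horner_poly Gf; congr (_ != 0).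
by apply: eq_bigr => i _; rewrite (hform_scale _ _ (hf i)) mulrC.
Qed.

Lemma card_eq1P (T : Type) (A : set T) : (A #= `I_1)%card <-> exists a, A = [set a].
Proof.
split=> [/eq_cardSP[a Aa]|[a ->]]; last exact: card_set1.
rewrite II0 card_eq0 => /eqP e; exists a; apply/seteqP; split=> x; last by move=> ->.
move=> Ax; apply: contrapT => xa; have : (A `\ a) x by [].
by rewrite e.
Qed.

Lemma row_free_rV n (x : 'rV[K]_n) : x != 0 -> row_free x.
Proof. by rewrite /row_free -mxrank_eq0 => x0; rewrite eqn_leq rank_leq_row lt0n. Qed.

Lemma rowvs_rV n (x : 'rV[K]_n) : rowvs x = <[x]>%VS.
Proof.
apply/vspaceP => v; apply/mem_rowvs/vlineP => [[u ->]|[c ->]].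
  by exists (u 0 0); rewrite {1}[u]mx11_scalar mul_scalar_mx.
by exists c%:M; rewrite mul_scalar_mx.
Qed.

Lemma plucker1 n (x : 'rV[K]_n) : x != 0 -> plucker 1 <[x]>%VS = <[minors x]>%VS.
Proof. by move=> /row_free_rV x0; rewrite -rowvs_rV plucker_rowvs. Qed.

Lemma grass1_line n (S : {vspace 'rV[K]_n}) : grass 1 S -> exists2 x, x != 0 & S = <[x]>%VS.
Proof.
move=> dS; have x0 := minors_neq0 (row_free_basis_mx dS).
exists (basis_mx 1 S); last by rewrite -rowvs_rV rowvs_basis_mx.
apply: contraNneq x0 => ->; apply/eqP/rowP => j; rewrite !mxE.
by rewrite det_mx11 !mxE.
Qed.

Lemma dim_line n (x : 'rV[K]_n) : x != 0 -> grass 1 <[x]>%VS.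
Proof. by move=> x0; rewrite /grass /= dim_vline x0. Qed.

Lemma general_point_form n (P : {vspace 'rV[K]_n} -> Prop) : general_point P ->
  exists d G, [/\ hform d G, exists x : 'rV_n, G x != 0 &
    forall x, x != 0 -> G x != 0 -> P <[x]>%VS].
Proof.
move=> [Z [[I [homI eZ]] ZT PZ]].
have [S0 [gS0 nZ]] : exists S, grass 1 S /\ ~ Z S.
  apply: contrapT => h; case: (ZT) => sub; apply => S gS.
  by apply: contrapT => nZ; apply: h; exists S.
have [p [Ip [v [vS pv]]]] : exists p, I p /\ exists v, v \in plucker 1 S0 /\ p.@[v 0] != 0.
  apply: contrapT => h; apply: nZ; rewrite eZ; split=> // p Ip v vS.
  by apply: contrapT => /eqP pv; apply: h; exists p; split=> //; exists v.
have [d hpd] := homI _ Ip.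
have hpP : hform d (fun u : 'rV_#|pidx 1 n| => p.@[u 0]) by exists p.
exists (d * 1)%N, (fun x : 'rV_n => p.@[(minors x) 0]); split.
- apply: (hform_comp (g := fun x : 'rV_n => minors x) hpP) => j.
  apply: (hform_ext (hform_coord K (pcols j 0))) => x.
  by rewrite /minors mxE det_mx11 !mxE.
- have [x x0 eS] := grass1_line gS0; exists x; apply: contraNneq pv => px.
  move: vS; rewrite eS plucker1 // => vS; apply/eqP.
  by move: v vS; apply/(hform_vline (minors x) hpP).
- move=> x x0 px; apply: PZ; split; first exact: dim_line.
  rewrite eZ => -[_ /(_ p Ip)]; rewrite plucker1 // => /(hform_vline _ hpP)/eqP.
  by rewrite (negPf px).
Qed.

Lemma generic_general_point n (P : {vspace 'rV[K]_n.+1} -> Prop) :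
  generic (fun x : 'rV_n.+1 => x != 0 -> P <[x]>%VS) -> general_point P.
Proof.
move=> [G [pG [x0 Gx0] hG]].
have [d [G' [hG' G'x0 hG'G]]] := homogeneous_part pG Gx0.
(* For points the Plücker coordinates are the usual ones reindexed by [pidx 1 n.+1]; [phi] undoes
   the reindexing. *)
have [phi hphi] := choice (fun j : 'I_n.+1 => Cauchy_Binet (delta_mx j (0 : 'I_1) : 'M[K]_(n.+1, 1))).
pose rel (u : 'rV[K]_#|pidx 1 n.+1|) : 'rV[K]_n.+1 := \row_j (u *m phi j) 0 0.
have relE (x : 'rV_n.+1) : rel (minors x) = x.
  by apply/rowP => j; rewrite mxE hphi det_mx11 -colE mxE.
pose f u := G' (rel u) : K.
have hf : hform (d * 1) f.
  apply: hform_comp hG' _ => j; apply: (hform_ext (hform_lin (phi j) 0)) => u.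
  by rewrite [RHS]mxE.
have P' x : x != 0 -> f (minors x) != 0 -> P <[x]>%VS.
  move=> xn; rewrite /f relE => /hG'G[c c0 /hG]; rewrite vlineZ //; apply.
  by rewrite scaler_eq0 negb_or c0.
exists [set S | grass 1 S /\ forall g, g = f -> forall v, v \in plucker 1 S -> g v = 0].
split.
- by apply: zclosed_hp => g ->; exists (d * 1)%N.
- split; first by move=> S [].
  (* The form [G'] may be constant and x0 zero, in which case another vector is needed to represent
     a point. *)
  have [x1 [x1n G'x1]] : exists x1, x1 != 0 /\ G' x1 != 0.
    have [x00|x0n] := eqVneq x0 0; last by exists x0.
    have e10 : const_mx 1 != 0 :> 'rV[K]_n.+1.
      by apply/eqP => /rowP/(_ 0); rewrite !mxE => /eqP; rewrite oner_eq0.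
    have h : cofin (fun s => G' (0 + s *: const_mx 1) != 0).
      apply: (@cofin_polyf _ (fun s => G' (0 + s *: const_mx 1)) 0).
        by apply: polyf_line; apply: hform_pfun hG'.
      by rewrite scale0r addr0 -x00.
    have [c []] := cofin_ex (cofinI h (cofin_neq 0)); rewrite add0r => Gc c0.
    by exists (c *: const_mx 1); rewrite scaler_eq0 negb_or c0.
  move=> /(_ <[x1]>%VS (dim_line x1n)) [_ /(_ f erefl)]; rewrite plucker1 //.
  by move=> /(hform_vline _ hf); rewrite /f relE; apply/eqP.
- move=> S [gS nZ]; have [x xn eS] := grass1_line gS; rewrite eS in nZ *.
  apply: P' => //; apply/eqP => fx; apply: nZ; split; first exact: dim_line.
  by move=> g ->; rewrite plucker1 //; apply/(hform_vline _ hf).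
Qed.

End Order.

Lemma constr_equations (K : closedFieldType) n m (I : set {mpoly K[m]})
    (f : 'rV[K]_n -> 'rV[K]_m) : (forall j, pfun (fun v => f v 0 j)) ->
  constr (fun v => forall p, I p -> p.@[(f v) 0] = 0).
Proof.
move=> pf; have [s sI hs] := finite_equations I.
have h : constr (fun v : 'rV[K]_n => forall p : seq_sub s, (ssval p).@[(f v) 0] = 0).
  apply: constr_all => p; apply: Constr0.
  by apply: (fr_mpoly (pfunP K n)).
apply: (constr_ext h) => v; split=> [hv p|hv p]; last by apply/hv/sI/ssvalP.
by apply: hs => q qs; apply: (hv (SeqSub qs)).
Qed.

Lemma plane_basis (K : numClosedFieldType) n (W : {vspace 'rV[K]_n}) : \dim W = 2 ->
  exists v1 v2, indep2 v1 v2 /\ forall v, v \in W <-> exists a b, v = a *: v1 + b *: v2.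
Proof.
move=> dW; pose A : 'M[K]_(1 + 1, n) := basis_mx 2 W.
have rA : row_free A := row_free_basis_mx dW.
have mulA a b : a *: usubmx A + b *: dsubmx A = row_mx a%:M b%:M *m A.
  by rewrite -[in RHS](vsubmxK A) mul_row_col !mul_scalar_mx.
exists (usubmx A), (dsubmx A); split.
  move=> a b; rewrite mulA => e; have : row_mx a%:M b%:M = 0 :> 'rV[K]_(1 + 1).
    by apply: (row_free_inj rA); rewrite mul0mx.
  by move=> /eqP; rewrite row_mx_eq0 => /andP[/eqP/matrixP/(_ 0 0) + /eqP/matrixP/(_ 0 0)];
    rewrite !mxE eqxx !mulr1n.
move=> v; rewrite -(rowvs_basis_mx dW); split=> [/mem_rowvs[u ->]|[a [b ->]]].
  exists (lsubmx (u : 'rV_(1 + 1)) 0 0), (rsubmx (u : 'rV_(1 + 1)) 0 0).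
  by rewrite mulA -!mx11_scalar hsubmxK.
by rewrite mulA; apply/mem_rowvs; exists (row_mx a%:M b%:M).
Qed.

Lemma indep2_neq0 (K : numClosedFieldType) n (u v : 'rV[K]_n) : indep2 u v -> u != 0.
Proof.
move=> h; apply/eqP => u0; have [|/eqP] := h 1 0; last by rewrite oner_eq0.
by rewrite u0 scaler0 scale0r addr0.
Qed.

(* Scaling t scales c but not y, so the entry c of a family of functionals has
   degree one more than the entries of y. *)
Definition is0 k (j : 'I_(1 + k)) : nat := (j == lshift k 0).

(** * Families of functionals under change of homogeneous parameter *)

Section Plane.
Variables (K : numClosedFieldType) (k : nat).

Definition plane_pt a b (p q : 'rV[{poly K}]_(1 + k)) (t0 t1 : K) (w : 'rV[K]_(1 + k)) :=
  exists c d, w = c *: bvec (@is0 k) a p t0 t1 + d *: bvec (@is0 k) b q t0 t1.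

Lemma bvec_chart a (p : 'rV[{poly K}]_(1 + k)) t0 t1 : t0 != 0 ->
  (forall j, (size (p 0%R j) <= a + is0 j)%N) ->
  bvec (@is0 k) a p t0 t1 =
  (t0 ^+ a / t0) *: wv (t0 * cof (evr p (t1 / t0))) (yof (evr p (t1 / t0))).
Proof.
move=> t00 sp; rewrite wvZ; apply: wvP.
  rewrite cof_wv /cof mxE bform_horner // /is0 eqxx addn1 /= !evrE.
  by rewrite mulrA divfK.
rewrite yof_wv; apply/rowP => i; rewrite !mxE bform_horner // /is0.
have -> : (rshift 1 i == lshift k 0) = false by apply/eqP => /(congr1 val).
rewrite addn0 /horner_eval; have := sp (rshift 1 i).
have -> : is0 (rshift 1 i) = 0%N by rewrite /is0; case: eqP => // /(congr1 val).
(* For a = 0 the y entries are zero, so that the factor t0 ^+ a / t0 in place of t0 ^+ a.-1 does no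
   harm. *)
rewrite addn0; case: a {sp} => [|a _] /=; last by rewrite exprSr mulfK.
by rewrite leqn0 size_poly_eq0 => /eqP->; rewrite horner0 !mulr0.
Qed.

Lemma bvec_rescale a (p : 'rV[{poly K}]_(1 + k)) c t0 t1 : c != 0 ->
  (forall j, (size (p 0%R j) <= a + is0 j)%N) ->
  bvec (@is0 k) a p (c * t0) (c * t1) =
  (c ^+ a / c) *: wv (c * cof (bvec (@is0 k) a p t0 t1)) (yof (bvec (@is0 k) a p t0 t1)).
Proof.
move=> c0 sp; rewrite wvZ; apply: wvP.
  by rewrite cof_wv /cof !mxE bform_scale /is0 eqxx addn1 /= mulrA divfK.
rewrite yof_wv; apply/rowP => i; rewrite !mxE bform_scale /is0.
have -> : (rshift 1 i == lshift k 0) = false by apply/eqP => /(congr1 val).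
rewrite addn0; case: a {sp} => [|a] /=; last by rewrite exprSr mulfK.
by rewrite /bform big_ord0 !mulr0.
Qed.

End Plane.

Lemma det_mulmx_thin (F : fieldType) n (C : 'M[F]_(n.+1, n)) (D : 'M[F]_(n, n.+1)) :
  \det (C *m D) = 0.
Proof.
apply/eqP; apply: contraTT isT => d0.
have : C *m D \in unitmx by rewrite unitmxE unitfE.
rewrite -row_free_unit => /eqP rk.
by have := leq_trans (mxrankM_maxl C D) (rank_leq_col C); rewrite rk ltnn.
Qed.

(** * Bezout identities with degree bounds, and syzygies *)

Section Bezout.
Variable K : numClosedFieldType.

(** A nonzero combination of least degree divides every D x, hence has no root. *)
Lemma poly_Bezout (X : finType) (D : X -> {poly K}) :
  (forall t, exists x, (D x).[t] != 0) -> exists u : X -> {poly K}, \sum_x D x * u x = 1.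
Proof.
move=> D0; pose comb (f : {poly K}) := exists u : X -> {poly K}, \sum_x D x * u x = f.
have combD f g : comb f -> comb g -> comb (f + g).
  move=> [u <-] [v <-]; exists (fun x => u x + v x).
  by rewrite -big_split; apply: eq_bigr => x _; rewrite mulrDr.
have combM h f : comb f -> comb (h * f).
  move=> [u <-]; exists (fun x => h * u x).
  by rewrite mulr_sumr; apply: eq_bigr => x _; rewrite mulrCA.
have combX x : comb (D x).
  exists (fun y => (y == x)%:R); rewrite (bigD1 x) //= eqxx mulr1 big1 ?addr0 // => y /negPf->.
  by rewrite mulr0.
have hex : exists n, `[< exists f : {poly K}, [/\ f != 0, comb f & size f = n] >].
  have [x Dx] := D0 0; exists (size (D x)); apply/asboolP; exists (D x); split=> //.
  by apply: contraNneq Dx => ->; rewrite horner0.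
case: (ex_minnP hex) => n /asboolP[f [f0 cf sf]] nmin.
have fD x : f %| D x.
  rewrite /dvdp; apply/eqP; apply: contrapT => /eqP r0.
  have : (size f <= size (D x %% f)%R)%N.
    rewrite sf; apply: nmin; apply/asboolP; exists (D x %% f); split=> //.
    have -> : D x %% f = D x + (- (D x %/ f)) * f.
      by rewrite {2}(divp_eq (D x) f) mulNr addrAC subrr add0r.
    by apply: combD => //; apply: combM.
  by rewrite leqNgt ltn_modp f0.
have : (size f <= 1)%N.
  apply: closed_polyE => t; have [x Dx] := D0 t; apply: contraNneq Dx => ft.
  by have /dvdpP[h ->] := fD x; rewrite hornerM ft mulr0.
move=> /size1_polyC ef; have c0 : f`_0 != 0.
  by apply: contraNneq f0 => e; rewrite ef e.
have [u eu] := combM (f`_0)^-1%:P f cf; exists u; rewrite eu ef coefC eqxx -polyCM mulVf //.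
Qed.

(** All weights but that of x0 are reduced modulo D x0, and the quotients go into the weight of x0;
    its degree is then forced by the identity, since D x0 has the full degree n. *)
Lemma poly_Bezout_bounded (X : finType) (D : X -> {poly K}) n x0 :
  (forall t, exists x, (D x).[t] != 0) -> (forall x, (size (D x) <= n.+1)%N) ->
  size (D x0) = n.+1 -> forall h : {poly K}, (size h <= (n + n).+1)%N ->
  exists2 u : X -> {poly K}, \sum_x D x * u x = h & forall x, (size (u x) <= n.+1)%N.
Proof.
move=> D0 sD sD0 h sh; have [v ev] := poly_Bezout D0.
have Dx0 : D x0 != 0 by rewrite -size_poly_eq0 sD0.
pose q := v x0 * h + \sum_(x | x != x0) D x * ((v x * h) %/ D x0).
pose u x := if x == x0 then q else (v x * h) %% D x0.
have su x : x != x0 -> (size (u x) <= n)%N.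
  by rewrite /u => /negPf->; rewrite -ltnS -sD0 ltn_modp.
have eh : \sum_x D x * u x = h.
  rewrite (bigD1 x0) //= {1}/u eqxx /q mulrDr mulr_sumr -addrA -big_split /=.
  rewrite -[RHS]mul1r -ev mulr_suml [RHS](bigD1 x0) //= mulrA; congr (_ + _).
  apply: eq_bigr => x xx0; rewrite /u (negPf xx0) -mulrA {3}(divp_eq (v x * h) (D x0)).
  by rewrite mulrDr; congr (_ + _); rewrite mulrCA [D x0 * _]mulrC.
exists u => // x; have [->|/su/leqW//] := eqVneq x x0.
rewrite {1}/u eqxx; have [->|q0] := eqVneq q 0; first by rewrite size_poly0.
have eq : D x0 * q = h - \sum_(x | x != x0) D x * u x.
  by rewrite -eh [X in X - _](bigD1 x0) //= {1}/u eqxx addrK.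
have ss : (size (\sum_(x | x != x0) D x * u x)%R <= (n + n).+1)%N.
  apply: leq_trans (size_sum _ _ _) _; apply/bigop.bigmax_leqP => y yx0.
  apply: leq_trans (size_polyMleq _ _) _; have := sD y; have := su y yx0.
  by move: (size (D y)) (size (u y)) => c d; lia.
have : (size (D x0 * q)%R <= (n + n).+1)%N.
  by rewrite eq (leq_trans (size_polyD _ _)) // size_polyN geq_max sh.
by rewrite size_mul // sD0; move: (size q) => c; lia.
Qed.

(** The rows P and Q are independent at every point of the projective line, infinity included, so in
    large degree the system with rows P and Q is solvable for the right sides c h and c' h. *)
Lemma linear_syzygy k a b (P Q : 'I_k -> {poly K}) (c c' : {poly K}) :
  (forall i, (size (P i) <= a.+1)%N) -> (forall i, (size (Q i) <= b.+1)%N) ->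
  (size c <= a.+2)%N -> (size c' <= b.+2)%N ->
  (forall t, exists i j, (P i).[t] * (Q j).[t] - (P j).[t] * (Q i).[t] != 0) ->
  (exists i j, (P i)`_a * (Q j)`_b - (P j)`_a * (Q i)`_b != 0) ->
  exists m, forall h : {poly K}, (size h <= m.+1)%N -> exists g : 'I_k -> {poly K},
    [/\ forall i, (size (g i) <= m.+2)%N, \sum_i P i * g i = c * h & \sum_i Q i * g i = c' * h].
Proof.
move=> sP sQ sc sc' D0 [i0 [j0 Dinf]].
pose D (x : 'I_k * 'I_k) := P x.1 * Q x.2 - P x.2 * Q x.1.
pose n := (a + b)%N.
have sPQ i j : (size (P i * Q j)%R <= n.+1)%N.
  apply: leq_trans (size_polyMleq _ _) _; have := sP i; have := sQ j.
  by move: (size (P i)) (size (Q j)) => x y; rewrite /n; lia.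
have sD x : (size (D x) <= n.+1)%N.
  by rewrite (leq_trans (size_polyD _ _)) // size_polyN geq_max !sPQ.
have cPQ i j : (P i * Q j)`_n = (P i)`_a * (Q j)`_b.
  have ta : (a < n.+1)%N by rewrite /n; lia.
  rewrite coefM (bigD1 (Ordinal ta)) //= [X in (Q j)`_X](_ : _ = b); last by rewrite /n; lia.
  rewrite big1 ?addr0 // => l; rewrite -val_eqE /= => la.
  have [lta|] := ltnP l a; last first.
    by rewrite leq_eqVlt eq_sym (negPf la) /= => al; rewrite nth_default ?mul0r // (leq_trans (sP i)).
  have nl : (b.+1 <= n - l)%N by move: lta; rewrite /n; move: (nat_of_ord l) => x; lia.
  by rewrite [X in _ * X]nth_default ?mulr0 // (leq_trans (sQ j)).
have sD0 : size (D (i0, j0)) = n.+1.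
  apply/eqP; rewrite eqn_leq sD ltnNge; apply: contraNN Dinf => s0.
  by rewrite -!cPQ -coefB -[_ - _]/(D (i0, j0)) nth_default.
(* The minors D have degree n and one of them exactly n, so weights of degree n reach every h of
   degree 2 n. *)
exists (n + n)%N => h sh.
have [|u eu su] := poly_Bezout_bounded _ sD sD0 sh.
  move=> t; have [i [j Dij]] := D0 t; exists (i, j).
  by rewrite /D hornerD hornerN !hornerM.
pose kap j := c * Q j - c' * P j.
have skap j : (size (kap j) <= n.+2)%N.
  rewrite (leq_trans (size_polyD _ _)) // size_polyN geq_max; apply/andP; split.
    apply: leq_trans (size_polyMleq _ _) _; have := sQ j.
    by move: sc; move: (size c) (size (Q j)) => x y; rewrite /n; lia.
  apply: leq_trans (size_polyMleq _ _) _; have := sP j.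
  by move: sc'; move: (size c') (size (P j)) => x y; rewrite /n; lia.
(* Cramer's rule: the entries [kap j] at i and [- kap i] at j solve the two equations with right
   sides c D(i, j) and c' D(i, j). These solutions are added with the weights u, for which the sum
   of D u is h. *)
exists (fun i => \sum_j (kap j * u (i, j) - kap j * u (j, i))).
have sw (R : 'I_k -> {poly K}) : \sum_i R i * \sum_j (kap j * u (i, j) - kap j * u (j, i)) =
    \sum_i \sum_j (R i * kap j - R j * kap i) * u (i, j).
  have -> : \sum_i \sum_j (R i * kap j - R j * kap i) * u (i, j) =
      \sum_i \sum_j R i * kap j * u (i, j) - \sum_i \sum_j R j * kap i * u (i, j).
    rewrite -sumrB; apply: eq_bigr => i _; rewrite -sumrB; apply: eq_bigr => j _.
    by rewrite mulrBl.
  rewrite [X in _ - X]exchange_big -sumrB; apply: eq_bigr => i _.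
  rewrite -sumrB mulr_sumr; apply: eq_bigr => j _.
  by rewrite mulrBr !mulrA.
have uE f : \sum_i \sum_j f (i, j) * u (i, j) = \sum_x f x * u x.
  by rewrite pair_bigA; apply: eq_bigr => -[].
split.
- move=> i; apply: leq_trans (size_sum _ _ _) _; apply/bigop.bigmax_leqP => j _.
  have sk x : (size (kap j * u x)%R <= (n + n).+2)%N.
    apply: leq_trans (size_polyMleq _ _) _; have := su x; have := skap j.
    by move: (size (kap j)) (size (u x)) => y z; rewrite /n; lia.
  by rewrite (leq_trans (size_polyD _ _)) // size_polyN geq_max !sk.
- rewrite sw -eu mulr_sumr (uE (fun x => P x.1 * kap x.2 - P x.2 * kap x.1)).
  by apply: eq_bigr => x _; rewrite /kap /D; ring.
- rewrite sw -eu mulr_sumr (uE (fun x => Q x.1 * kap x.2 - Q x.2 * kap x.1)).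
  by apply: eq_bigr => x _; rewrite /kap /D; ring.
Qed.

Lemma bform_mul M N (f g : {poly K}) t0 t1 : (size f <= M.+1)%N -> (size g <= N.+1)%N ->
  bform M.+1 f t0 t1 * bform N.+1 g t0 t1 = bform (M + N).+1 (f * g) t0 t1.
Proof.
move=> sf sg; pose F (v : 'rV[K]_(1 + 1)) := let x := v 0 (lshift 1 0) in let y := v 0 (rshift 1 0) in
  bform M.+1 f x y * bform N.+1 g x y - bform (M + N).+1 (f * g) x y.
have P := pfunP K (1 + 1).
have pv j : pfun (fun v : 'rV[K]_(1 + 1) => v 0 j) by apply: pfun_coord.
have ex x y : F (row_mx x%:M y%:M) = bform M.+1 f x y * bform N.+1 g x y - bform (M + N).+1 (f * g) x y.
  by rewrite /F row_mxEl row_mxEr !mxE !eqxx !mulr1n.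
apply/eqP; rewrite -subr_eq0 -ex; apply/eqP.
apply: (@pfun_dense _ _ F (fun v => v 0 (lshift 1 0)) (const_mx 1)) => //.
- apply: (fr_sub P); first by apply: (fr_mul P); apply: (fr_bform _ _ P).
  exact: (fr_bform _ _ P).
- by rewrite mxE oner_eq0.
move=> v v0; have sfg : (size (f * g)%R <= (M + N).+1)%N.
  apply: leq_trans (size_polyMleq _ _) _.
  by move: sf sg; move: (size f) (size g) => x y; lia.
by rewrite /F !bform_horner // hornerM exprD /=; ring.
Qed.

Lemma bformD N (f g : {poly K}) t0 t1 : bform N (f + g) t0 t1 = bform N f t0 t1 + bform N g t0 t1.
Proof.
by rewrite -big_split; apply: eq_bigr => i _; rewrite coefD !mulrDl.
Qed.

Lemma bform_sum N (J : finType) (f : J -> {poly K}) t0 t1 :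
  bform N (\sum_i f i) t0 t1 = \sum_i bform N (f i) t0 t1.
Proof.
apply: (big_morph (fun f => bform N f t0 t1)); first by move=> x y; rewrite bformD.
by rewrite /bform big1 // => i _; rewrite coef0 !mul0r.
Qed.

(** A form of degree m + 1 written in the monomials of degree m with coefficients linear in t: each
    term gives up a factor t0, except the pure power of t1. This provides the rows of a matrix
    acting on monomials. *)
Lemma bform_succ m (g : {poly K}) t0 t1 : bform m.+2 g t0 t1 =
  \sum_(l < m.+1) (t0 * g`_l + t1 * (g`_m.+1 *+ (l == ord_max))) * (t0 ^+ (m - l) * t1 ^+ l).
Proof.
rewrite /bform big_ord_recr /= subnn expr0 mulr1.
under [RHS]eq_bigr => l _ do rewrite mulrDl.
rewrite big_split /=; congr (_ + _).
  apply: eq_bigr => l _; have -> : (m.+2 - l.+1 = (m - l).+1)%N by have := ltn_ord l; lia.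
  by rewrite exprS; ring.
rewrite (bigD1 ord_max) //= eqxx subnn expr0 mul1r big1 ?addr0; last first.
  by move=> l /negPf->; rewrite mulr0n mulr0 mul0r.
by rewrite mulr1n exprS; ring.
Qed.

Lemma bform_Xn m (l : 'I_m.+1) t0 t1 : bform m.+1 'X^l t0 t1 = t0 ^+ (m - l) * t1 ^+ l :> K.
Proof.
rewrite /bform (bigD1 l) //= coefXn eqxx mul1r subSS big1 ?addr0 // => i /negPf il.
by rewrite coefXn [(i == l :> nat)]il !mul0r.
Qed.

End Bezout.

Lemma indep2_minor (K : numClosedFieldType) n (u v : 'rV[K]_n) : indep2 u v ->
  exists i j, u 0 i * v 0 j - u 0 j * v 0 i != 0.
Proof.
move=> uv; have [i ui] := rV_neq0_ex (indep2_neq0 uv).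
apply: contrapT => h; have [|_ /eqP] := uv (- (v 0 i / u 0 i)) 1; last by rewrite oner_eq0.
apply/rowP => j; rewrite !mxE mul1r; apply: (mulfI ui); rewrite mulr0.
have : u 0 i * v 0 j - u 0 j * v 0 i = 0.
  by apply: contrapT => /eqP e; apply: h; exists i, j.
by move=> <-; field.
Qed.

Lemma det_ker (F : fieldType) n (M : 'M[F]_n) (x : 'cV[F]_n) : M *m x = 0 -> x != 0 -> \det M = 0.
Proof.
move=> Mx x0; apply/eqP; apply: contraNT x0 => dM.
have uM : M \in unitmx by rewrite unitmxE unitfE.
by rewrite -(mulKmx uM x) Mx mulmx0.
Qed.

Lemma morphism_hp (F : fieldType) k m k' m' (A : set {vspace 'rV[F]_m})
    (B : set {vspace 'rV[F]_m'}) (f : {vspace 'rV[F]_m} -> {vspace 'rV[F]_m'}) :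
  (forall x, A x -> B (f x)) ->
  (forall x, A x -> exists d (g : 'rV[F]_#|pidx k m| -> 'rV[F]_#|pidx k' m'|),
    [/\ forall j, hform d (fun v => g v 0 j),
      exists2 v, plucker k x = <[v]>%VS & g v != 0 &
      forall y, A y -> exists2 v, plucker k y = <[v]>%VS &
        g v != 0 -> plucker k' (f y) = <[g v]>%VS]) ->
  morphism k k' A B f.
Proof.
move=> fA h; split=> // x /h[d [g [hg [v0 ev0 gv0] hy]]].
have [q hq] : exists q : 'I_#|pidx k' m'| -> {mpoly F[#|pidx k m|]},
    forall j, q j \is d.-homog /\ forall v, g v 0 j = (q j).@[v 0].
  suff /boolp.choice[q hq] : forall j, exists q : {mpoly F[#|pidx k m|]},
    q \is d.-homog /\ forall v, g v 0 j = q.@[v 0] by exists q.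
  by move=> j; have [q qd qE] := hg j; exists q.
have qE v : polymap q v = g v.
  by apply/rowP => j; rewrite mxE; have [_ ->] := hq j.
exists d, q; split.
- by move=> j; have [] := hq j.
- by exists v0; rewrite ?qE // ev0 memv_line.
move=> y v Ay; have [v1 ev1 hv1] := hy y Ay; rewrite ev1 qE => /vlineP[c ->] gv.
have gE : g (c *: v1) = c ^+ d *: g v1.
  by apply/rowP => j; rewrite (hform_scale _ _ (hg j)) mxE.
have gv1 : g v1 != 0 by apply: contraNneq gv => e; rewrite gE e scaler0.
by rewrite (hv1 gv1) gE vlineZ //; apply: contraNneq gv => e; rewrite gE e scale0r.
Qed.

Lemma minors1E (F : fieldType) n (x : 'rV[F]_n) j : minors x 0 j = x 0 (pcols j 0).
Proof. by rewrite mxE det_mx11 mxE. Qed.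

(** * Congruences contained in Omega_pi *)

Section Setting.
Variables (K : numClosedFieldType) (r : nat).
Local Notation k := r.+1.
Variables (E : 'M[K]_(k, k.+2)) (u0 u1 : 'rV[K]_k.+2).
Hypothesis frame : row_free (col_mx (col_mx u0 u1) E).
Variable Sigma : set {vspace 'rV[K]_k.+2}.
Variable I : set {mpoly K[#|pidx k k.+2|]}.
Hypothesis homI : forall p, I p -> exists d, p \is d.-homog.
Hypothesis SigmaI : Sigma = [set S | grass k S /\
  forall p, I p -> forall v, v \in plucker k S -> p.@[v 0] = 0].
Hypothesis SigmaO : Sigma `<=` Omega (rowvs E).

Local Notation pi := (rowvs E).
Local Notation B := (Hmx E u0 u1).
Local Notation vec := (vec u0 u1).
Local Notation N := #|pidx k k.+2|.

Lemma grass_Sigma s : Sigma s -> \dim s = k.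
Proof. by rewrite SigmaI => -[]. Qed.

(** The affine cone over the fibre of Sigma over t. For nonzero t it contains the vertex (1, 0)
    exactly when [pi] is on Sigma. *)
Definition in_cone t0 t1 w := forall p, I p -> p.@[(psi (B t0 t1) w) 0] = 0.

Lemma Sigma_cone t0 t1 w : nz2 t0 t1 -> w != 0 -> Sigma (hyp (B t0 t1) w) <-> in_cone t0 t1 w.
Proof.
move=> t w0; have rB := row_free_Hmx frame t; rewrite SigmaI; split.
  by move=> [_ h] p Ip; apply: h => //; rewrite plucker_hyp // memv_line.
move=> h; split; first exact: dim_hyp.
move=> p Ip; rewrite plucker_hyp //; have [d hpd] := homI Ip.
have hpP : hform d (fun v : 'rV_#|pidx k k.+2| => p.@[v 0]) by exists p.
by apply/(hform_vline _ hpP)/h.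
Qed.

Lemma fr_psi X (S : (X -> K) -> Prop) (t0 t1 : X -> K) (w : X -> 'rV[K]_(1 + k)) j :
  funring S -> S t0 -> S t1 -> (forall i, S (fun x => w x 0 i)) ->
  S (fun x => psi (B (t0 x) (t1 x)) (w x) 0 j).
Proof.
move=> SP S0 S1 Sw.
apply: (fr_ext SP (f := fun x => \det (row_mx (w x)^T (colsub (pcols j) (B (t0 x) (t1 x)))))).
  apply: (fr_det SP) => a b; case: (@split_ordP 1 k b) => l ->.
    by apply: (fr_ext SP (Sw a)) => x; rewrite (@row_mxEl _ _ 1) mxE (ord1 l).
  case: (@split_ordP 1 k a) => c ->.
    apply: (fr_ext SP (f := fun x => t0 x * u0 0 (pcols j l) + t1 x * u1 0 (pcols j l))).
      by apply: (fr_add SP); apply: (fr_mul SP) => //; apply: (fr_cst SP).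
    by move=> x; rewrite (@row_mxEr _ _ 1) mxE /Hmx (@col_mxEu _ 1) (ord1 c) !mxE.
  apply: (fr_ext SP (fr_cst SP (E c (pcols j l)))) => x.
  by rewrite (@row_mxEr _ _ 1) mxE /Hmx (@col_mxEd _ 1).
by move=> x; rewrite mxE.
Qed.

Lemma constr_in_cone n (t0 t1 : 'rV[K]_n -> K) (w : 'rV[K]_n -> 'rV[K]_(1 + k)) :
  pfun t0 -> pfun t1 -> (forall i, pfun (fun v => w v 0 i)) ->
  constr (fun v => in_cone (t0 v) (t1 v) (w v)).
Proof.
move=> p0 p1 pw; apply: (@constr_equations _ _ _ I (fun v => psi (B (t0 v) (t1 v)) (w v))).
by move=> j; apply: (fr_psi j (pfunP K n)).
Qed.

Lemma in_coneZ c t0 t1 w : in_cone t0 t1 w -> in_cone t0 t1 (c *: w).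
Proof.
move=> h p Ip; have [d hpd] := homI Ip.
have hpP : hform d (fun v : 'rV_#|pidx k k.+2| => p.@[v 0]) by exists p.
by rewrite psiZ (hform_scale _ _ hpP) h // mulr0.
Qed.

Lemma psi_rescale a t0 t1 c y :
  psi (B (a * t0) (a * t1)) (wv (a * c) y) = a *: psi (B t0 t1) (wv c y).
Proof.
rewrite !(psi_split _ _ _ _ _ _ y) -!scalerA scalerDr -!psiZ !wvZ mulr0 //.
Qed.

Lemma in_cone_rescale a t0 t1 c y : in_cone t0 t1 (wv c y) -> in_cone (a * t0) (a * t1) (wv (a * c) y).
Proof.
move=> h p Ip; have [d hpd] := homI Ip.
have hpP : hform d (fun v : 'rV_#|pidx k k.+2| => p.@[v 0]) by exists p.
by rewrite psi_rescale (hform_scale _ _ hpP) h // mulr0.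
Qed.

(** The limit is taken in t and w together, so it may pass from one fibre to another. *)
Lemma in_cone_dense n (t0 t1 g : 'rV[K]_n -> K) (w : 'rV[K]_n -> 'rV[K]_(1 + k)) v1 :
  pfun t0 -> pfun t1 -> (forall i, pfun (fun v => w v 0 i)) -> pfun g -> g v1 != 0 ->
  (forall v, g v != 0 -> in_cone (t0 v) (t1 v) (w v)) -> forall v, in_cone (t0 v) (t1 v) (w v).
Proof.
move=> p0 p1 pw pg gv1 h v p Ip.
apply: (@pfun_dense _ _ (fun v => p.@[(psi (B (t0 v) (t1 v)) (w v)) 0]) g v1) => //.
  by apply: (fr_mpoly (pfunP K n)) => j; apply: (fr_psi j (pfunP K n)).
by move=> v' /h; apply.
Qed.

Lemma closed_in_cone t0 t1 : closed_cone (in_cone t0 t1).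
Proof.
have P := pfunP K (1 + k); split.
- apply: (@constr_in_cone _ (fun=> t0) (fun=> t1) id); [exact: (fr_cst P)..|].
  by move=> i; apply: pfun_coord.
- by move=> c w; apply: in_coneZ.
- move=> gam pg h s p Ip.
  apply: (polyf_cofin0 (f := fun s => p.@[(psi (B t0 t1) (gam s)) 0])).
    apply: (fr_mpoly (polyfP K)) => j.
    by apply: (@fr_psi _ _ (fun=> t0) (fun=> t1) gam j (polyfP K)) => //; apply: (fr_cst (polyfP K)).
  by apply: cofinW h => s'; apply.
Qed.

Lemma Sigma_param s : Sigma s -> exists t0 t1 w, [/\ nz2 t0 t1, w != 0 & s = hyp (B t0 t1) w].
Proof. by move=> /SigmaO[ds h]; apply: Omega_ex. Qed.

Lemma Sigma_point s t0 t1 p : nz2 t0 t1 -> Sigma s -> vec t0 t1 + p *m E \in s ->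
  exists w, [/\ w != 0, s = hyp (B t0 t1) w, in_cone t0 t1 w & wv 1 p *m w^T = 0].
Proof.
move=> t Ss xs; have [s0 [s1 [w [s01 w0 es]]]] := Sigma_param Ss.
move: (xs); rewrite es => /(hyp_point_param frame t s01)[w' e' ew0].
have w'0 : w' != 0 by rewrite -ew0.
exists w'; split => //; first by apply/Sigma_cone => //; rewrite -e' -es.
by apply/eqP; rewrite -(mem_hyp_point frame _ _ t) -e' -es.
Qed.

(** A nonzero multiple of the vertex (1, 0) does not vanish on (1, p). *)
Lemma dot_yof (p : 'rV[K]_k) (w : 'rV[K]_(1 + k)) : w != 0 -> wv 1 p *m w^T = 0 -> yof w != 0.
Proof.
move=> w0; apply: contra_eqN => /eqP yw; rewrite (wvE w) yw wv_dot trmx0 mulmx0 addr0.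
rewrite mul1r; apply: contraNneq w0 => /matrixP/(_ 0 0); rewrite !mxE eqxx mulr1n => c0.
by rewrite (wvE w) c0 yw wv_eq0 !eqxx.
Qed.

Lemma phi_fibreE t0 t1 s : nz2 t0 t1 -> phi_fibre pi (rowvs (B t0 t1)) s <->
  exists2 w, yof w != 0 & s = hyp (B t0 t1) w.
Proof.
move=> t; split.
  move=> [[[ds dsE] /eqP spi] [_ /= eH]].
  have rB := row_free_Hmx frame t.
  have sH : (s <= rowvs (B t0 t1))%VS by rewrite -eH addvSl.
  have [w w0 es] := hyp_surj rB ds sH; exists w => //.
  by apply: (hyp_neq0_yof (E := E) (u0 := u0) (u1 := u1) t w0); rewrite -es.
move=> [w y0 ->].
have w0 := yof_neq0 y0; have rB := row_free_Hmx frame t.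
have dE := dim_rowvs (row_freeE frame); have ds := dim_hyp rB w0.
have dsE : \dim (hyp (B t0 t1) w :&: pi)%VS = r.
  have := dimv_sum_cap (hyp (B t0 t1) w) pi.
  rewrite (hyp_add_pi frame t y0) ds dE (dim_rowvs rB); lia.
split; last by split=> /=; [split=> //; apply: capvSr|exact: hyp_add_pi].
split; last by apply/eqP; apply: hyp_neq_pi.
by split => //=; rewrite dsE.
Qed.

Lemma pencilE H : pencil pi H <-> exists t0 t1, nz2 t0 t1 /\ H = rowvs (B t0 t1).
Proof.
split=> [[dH piH]|[t0 [t1 [t ->]]]]; first exact: pencil_ex.
split; last exact: rowvsE_sub.
exact: (dim_rowvs (row_free_Hmx frame t)).
Qed.

Definition unique_member (x : 'rV[K]_k.+2) :=
  exists s0, [/\ Sigma s0, x \in s0 & forall s, Sigma s -> x \in s -> s = s0].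

Lemma unique_memberP x : ([set s | Sigma s /\ (<[x]> <= s)%VS] #= `I_1)%card <-> unique_member x.
Proof.
rewrite card_eq1P; split=> [[s0 e]|[s0 [Ss0 xs0 u]]].
  have [Ss0 xs0] : [set s | Sigma s /\ (<[x]> <= s)%VS] s0 by rewrite e.
  exists s0; split=> // s Ss xs; have : [set s | Sigma s /\ (<[x]> <= s)%VS] s.
    by split=> //; rewrite -memvE.
  by rewrite e.
exists s0; apply/seteqP; split=> [s [Ss]|_ -> /=].
  by rewrite -memvE => xs; apply: u.
by rewrite -memvE.
Qed.

Definition unique_section t0 t1 (p : 'rV[K]_k) := exists w,
  [/\ w != 0, in_cone t0 t1 w, wv 1 p *m w^T = 0 & forall w', w' != 0 -> in_cone t0 t1 w' ->
    wv 1 p *m w'^T = 0 -> exists c, w' = c *: w].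

Lemma unique_sectionP t0 t1 p : nz2 t0 t1 ->
  unique_member (vec t0 t1 + p *m E) <-> unique_section t0 t1 p.
Proof.
move=> t; have rB := row_free_Hmx frame t; split=> [[s0 [Ss0 xs0 u]]|[w [w0 Xw pw u]]].
  have [w [w0 es Xw pw]] := Sigma_point t Ss0 xs0.
  exists w; split=> // w' w'0 Xw' pw'.
  have : hyp (B t0 t1) w' = hyp (B t0 t1) w.
    rewrite -es; apply: u; first by apply/Sigma_cone.
    by rewrite mem_hyp_point // pw'.
  move=> e; have [c _ ec] := plucker_hyp_inj rB w0 w'0 (congr1 (plucker k) (esym e)).
  by exists c.
exists (hyp (B t0 t1) w); split; first by apply/Sigma_cone.
  by rewrite mem_hyp_point // pw.
move=> s Ss xs; have [w' [w'0 es Xw' pw']] := Sigma_point t Ss xs.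
have [c ec] := u _ w'0 Xw' pw'; rewrite es ec hypZ //.
by apply: contraNneq w'0 => c0; rewrite ec c0 scale0r.
Qed.

(** * Linear fibres imply order one *)

Section Backward.
Hypothesis lines : forall H, pencil pi H -> exists2 L, is_line k L &
  phi_fibre pi H `&` Sigma = L \/ phi_fibre pi H `&` Sigma = L `\ pi.

(** For fixed t the map [psi] is linear and injective, so the plane over L pulls back to a plane of
    functionals. Those with y = 0 are left out of the equivalence because the hypothesis says
    nothing on whether [pi] belongs to Sigma. *)
Lemma fibre_plane t0 t1 : nz2 t0 t1 -> exists wa wb, indep2 wa wb /\
  forall w, yof w != 0 -> (in_cone t0 t1 w <-> exists a b, w = a *: wa + b *: wb).
Proof.
move=> t; have rB := row_free_Hmx frame t.
have pH : pencil pi (rowvs (B t0 t1)) by apply/(pencilE); exists t0, t1.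
have [L [gL [W dW eW]] hL] := lines pH.
have LP s : s <> pi -> L s <-> (phi_fibre pi (rowvs (B t0 t1)) s /\ Sigma s).
  move=> spi; split=> [Ls|[fs Ss]].
    suff : (phi_fibre pi (rowvs (B t0 t1)) `&` Sigma) s by [].
    by case: hL => ->.
  have : (phi_fibre pi (rowvs (B t0 t1)) `&` Sigma) s by [].
  by case: hL => -> // -[].
have Lw s : L s -> exists2 w, w != 0 & s = hyp (B t0 t1) w.
  move=> Ls; have [->|/eqP spi] := eqVneq s pi.
    by exists (wv 1 0); rewrite ?wv_eq0 ?oner_eq0 // hyp_pi ?oner_eq0.
  have [/(phi_fibreE)[//|w /yof_neq0 w0 es] _] := (LP s spi).1 Ls.
  by exists w.
have Wpsi v : v != 0 -> v \in W -> exists w, [/\ w != 0, L (hyp (B t0 t1) w) & v = psi (B t0 t1) w].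
  move=> v0 vW; have : points W <[v]>%VS by split; [exact: dim_line|rewrite -memvE].
  rewrite -eW => -[s Ls es]; have [w w0 es'] := Lw s Ls.
  have : v \in <[psi (B t0 t1) w]>%VS.
    by rewrite -plucker_hyp // -es' es memv_line.
  move=> /vlineP[c ev]; have c0 : c != 0 by apply: contraNneq v0 => c0; rewrite ev c0 scale0r.
  exists (c *: w); split; last by rewrite psiZ.
    by rewrite scaler_eq0 negb_or c0.
  by rewrite hypZ // -es'.
have [v1 [v2 [iv Wv]]] := plane_basis dW.
have v1W : v1 \in W by apply/Wv; exists 1, 0; rewrite scale1r scale0r addr0.
have v2W : v2 \in W by apply/Wv; exists 0, 1; rewrite scale1r scale0r add0r.
have [wa [wa0 La ea]] := Wpsi v1 (indep2_neq0 iv) v1W.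
have [wb [wb0 Lb eb]] := Wpsi v2 (indep2_neq0 (indep2C iv)) v2W.
have lin a b : a *: v1 + b *: v2 = psi (B t0 t1) (a *: wa + b *: wb).
  by rewrite psi_linear ea eb.
exists wa, wb; split.
  by move=> a b e; apply: iv; rewrite lin e; apply/eqP; rewrite psi_eq0.
move=> w y0; have w0 := yof_neq0 y0.
have spi : hyp (B t0 t1) w <> pi by apply/eqP; apply: hyp_neq_pi.
split.
  move=> /(Sigma_cone t w0) Ss.
  have Ls : L (hyp (B t0 t1) w) by apply/LP => //; split=> //; apply/phi_fibreE => //; exists w.
  have : (plucker k @` L) (plucker k (hyp (B t0 t1) w)) by exists (hyp (B t0 t1) w).
  rewrite eW plucker_hyp // => -[_]; rewrite -memvE => /Wv[a [b e]].
  by exists a, b; apply: (psi_inj rB); rewrite e lin.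
move=> [a [b ew]]; apply/(Sigma_cone t w0).
have psiW : psi (B t0 t1) w \in W by apply/Wv; exists a, b; rewrite lin ew.
have psi0 : psi (B t0 t1) w != 0 by rewrite psi_eq0.
have [w' [w'0 Lw' e]] := Wpsi _ psi0 psiW.
by rewrite -(psi_inj rB e) in Lw'; have [] := (LP _ spi).1 Lw'.
Qed.

Lemma lines_has_order : has_order Sigma 1.
Proof.
pose Q (z : 'rV[K]_((1 + 1) + k)) := unique_section
  (z 0 (lshift k (lshift 1 0))) (z 0 (lshift k (rshift 1 0))) (rsubmx z).
have cQ : constr Q.
  pose N := (1 + k)%N.
  pose t0 n (v : 'rV[K]_(1 + 1 + k + n)) := v 0 (lshift n (lshift k (lshift 1 0))).
  pose t1 n (v : 'rV[K]_(1 + 1 + k + n)) := v 0 (lshift n (lshift k (rshift 1 0))).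
  pose R (z : 'rV[K]_((1 + 1) + k)) (w : 'rV[K]_N) :=
    w != 0 /\ (in_cone (z 0 (lshift k (lshift 1 0))) (z 0 (lshift k (rshift 1 0))) w /\
    (wv 1 (rsubmx z) *m w^T) 0 0 = 0).
  have cR n (z : 'rV[K]_n -> 'rV[K]_((1 + 1) + k)) (w : 'rV[K]_n -> 'rV[K]_N) :
      (forall i, pfun (fun v => z v 0 i)) -> (forall i, pfun (fun v => w v 0 i)) ->
      constr (fun v => R (z v) (w v)).
    move=> pz pw; have P := pfunP K n.
    apply: ConstrI; first exact: constr_ne0.
    apply: ConstrI; first exact: constr_in_cone.
    apply: Constr0; apply: (fr_mulmx P) => i j; last first.
      by rewrite (ord1 j); apply: (fr_ext P (pw i)) => v; rewrite mxE.
    rewrite (ord1 i); case: (@split_ordP 1 k j) => l ->.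
      by apply: (fr_ext P (fr_cst P 1)) => v; rewrite /wv row_mxEl (ord1 l) mxE eqxx.
    by apply: (fr_ext P (pz (rshift (1 + 1) l))) => v; rewrite /wv row_mxEr mxE.
  (* Proportionality of two solutions is expressed by their 2 by 2 minors, so that uniqueness is a
     first-order condition with polynomial equations. *)
  pose T (v : 'rV[K]_(((1 + 1) + k) + N)) := R (lsubmx v) (rsubmx v) /\
    ~ exists w', (fun u : 'rV_(((1 + 1) + k) + N + N) => R (lsubmx (lsubmx u)) (rsubmx u) /\
      ~ (forall i : 'I_N * 'I_N, rsubmx u 0 i.1 * rsubmx (lsubmx u) 0 i.2 -
           rsubmx u 0 i.2 * rsubmx (lsubmx u) 0 i.1 = 0)) (row_mx v w').
  have pl n m n' (f : 'rV[K]_n' -> 'rV[K]_(n + m)) :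
      (forall i, pfun (fun v => f v 0 i)) -> forall i, pfun (fun v => lsubmx (f v) 0 i).
    by move=> pf i; apply: (fr_ext (pfunP K n') (pf (lshift m i))) => v; rewrite mxE.
  have pr n m n' (f : 'rV[K]_n' -> 'rV[K]_(n + m)) :
      (forall i, pfun (fun v => f v 0 i)) -> forall i, pfun (fun v => rsubmx (f v) 0 i).
    by move=> pf i; apply: (fr_ext (pfunP K n') (pf (rshift n i))) => v; rewrite mxE.
  have pid n : forall i, pfun (fun v : 'rV[K]_n => v 0 i) by move=> i; apply: pfun_coord.
  have cT : constr T.
    apply: ConstrI; first by apply: cR; [exact: (pl _ _ _ id)|exact: (pr _ _ _ id)].
    apply: ConstrN.
    pose U (u : 'rV[K]_(((1 + 1) + k) + N + N)) := R (lsubmx (lsubmx u)) (rsubmx u) /\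
      ~ (forall i : 'I_N * 'I_N, rsubmx u 0 i.1 * rsubmx (lsubmx u) 0 i.2 -
           rsubmx u 0 i.2 * rsubmx (lsubmx u) 0 i.1 = 0).
    apply: (constr_ext (@constr_ex K (1 + 1 + k + N) N U _)) => //; apply: ConstrI.
      by apply: cR; [exact: (pl _ _ _ _ (pl _ _ _ id _))|exact: (pr _ _ _ id)].
    apply: ConstrN; apply: constr_all => -[i j]; apply: Constr0.
    have P := pfunP K (1 + 1 + k + N + N).
    have p1 := pr _ _ _ id (pid (1 + 1 + k + N + N)%N).
    have p2 := pr _ _ _ _ (pl _ _ _ id (pid (1 + 1 + k + N + N)%N)).
    by apply: (fr_sub P); apply: (fr_mul P).
  apply: (constr_ext (constr_ex cT)) => z; split.
    move=> [w]; rewrite /T row_mxKl row_mxKr => -[[w0 [Xw pw]] u].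
    exists w; split=> //.
      by apply/matrixP => i j; rewrite (ord1 i) (ord1 j) pw mxE.
    move=> w' w'0 Xw' pw'.
    have [i wi0] := rV_neq0_ex w0.
    exists (w' 0 i / w 0 i); apply/rowP => j; rewrite mxE.
    apply: (mulIf wi0); rewrite mulrAC divfK //; apply/eqP; rewrite -subr_eq0; apply/eqP.
    apply: contrapT => h; apply: u; exists w'.
    rewrite !row_mxKl !row_mxKr; split; first by split=> //; rewrite pw' mxE.
    by move=> /(_ (j, i)).
  move=> [w [w0 Xw pw u]]; exists w; rewrite /T row_mxKl row_mxKr; split.
    by split=> //; rewrite pw mxE.
  move=> [w']; rewrite !row_mxKl !row_mxKr => -[[w'0 [Xw' pw']]]; apply => -[i j] /=.
  have [|c ->] := u w' w'0 Xw'; first by apply/matrixP => a b; rewrite (ord1 a) (ord1 b) pw' mxE.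
  by rewrite !mxE; ring.
have Pz := pfunP K (1 + 1 + k).
pose tz (z : 'rV[K]_((1 + 1) + k)) := z 0 (lshift k (lshift 1 0)).
have ptz : pfun tz by apply: pfun_coord.
case: (constr_generic cQ) => [gQ|[G [pG [z1 Gz1] hG]]]; last first.
  exfalso.
  have [z] : exists z, G z * tz z != 0.
    apply: (pfunM_neq0 (v1 := z1) (v2 := const_mx 1) pG ptz) => //.
    by rewrite /tz mxE oner_eq0.
  rewrite mulf_eq0 negb_or => /andP[Gz tz0].
  set t0 := tz z in tz0; set t1 := z 0 (lshift k (rshift 1 0)).
  have t : nz2 t0 t1 by rewrite /nz2 tz0.
  have [wa [wb [iw hw]]] := fibre_plane t.
  pose zp (p : 'rV[K]_k) : 'rV_((1 + 1) + k) := row_mx (lsubmx z) p.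
  have wa0 := indep2_neq0 iw.
  pose dt (p : 'rV[K]_k) (w : 'rV_(1 + k)) := (wv 1 p *m w^T) 0 0.
  have dtE p w : dt p w = cof w + (p *m (yof w)^T) 0 0.
    by rewrite /dt {1}(wvE w) wv_dot mul1r mxE mxE eqxx mulr1n.
  have Pk := pfunP K k.
  (* With t fixed, p is still free in a nonempty open set. At a p there whose hyperplane misses
     [wa], the plane of the fibre is cut in a single line, so the point has a unique member after
     all. *)
  have [p1 p1a] : exists p, dt p wa != 0.
    have [ca|ca] := eqVneq (cof wa) 0; last first.
      by exists 0; rewrite dtE mul0mx mxE addr0.
    have ya : yof wa != 0.
      by apply: contraNneq wa0 => ya; rewrite (wvE wa) ca ya wv_eq0 !eqxx.
    have [i yi] := rV_neq0_ex ya.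
    by exists (delta_mx 0 i); rewrite dtE ca add0r -rowE !mxE; rewrite mxE in yi.
  have [p] : exists p, G (zp p) * dt p wa != 0.
    apply: (pfunM_neq0 (v1 := rsubmx z) (v2 := p1)) => //.
    - apply: (fr_pfun (v := zp) Pk pG) => j; case: (split_ordP j) => i ->.
        by apply: (fr_ext Pk (fr_cst Pk (lsubmx z 0 i))) => p; rewrite row_mxEl.
      by apply: (fr_ext Pk (pfun_coord K i)) => p; rewrite row_mxEr.
    - apply: (fr_ext Pk (f := fun p => cof wa + (p *m (yof wa)^T) 0 0)); last by move=> p; rewrite dtE.
      apply: (fr_add Pk); first exact: (fr_cst Pk).
      by apply: (fr_mulmx Pk) => i j; [rewrite (ord1 i); apply: pfun_coord|apply: (fr_cst Pk)].
    - by rewrite /zp hsubmxK.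
  rewrite mulf_eq0 negb_or => /andP[Gp pa].
  have dtL a b : dt p (a *: wa + b *: wb) = a * dt p wa + b * dt p wb.
    by rewrite /dt linearP /= linearZ /= mulmxDr -!scalemxAr !mxE.
  apply: (hG _ Gp); rewrite /Q /zp row_mxKr !row_mxEl.
  have -> : lsubmx z 0 (lshift 1 0) = t0 by rewrite mxE.
  have -> : lsubmx z 0 (rshift 1 0) = t1 by rewrite mxE.
  pose w := dt p wb *: wa + - dt p wa *: wb.
  have w0 : w != 0.
    apply/eqP => /iw[_ /eqP]; by rewrite oppr_eq0 (negPf pa).
  have pw : wv 1 p *m w^T = 0.
    by apply/matrixP => i j; rewrite (ord1 i) (ord1 j) -/(dt p w) dtL mxE; ring.
  exists w; split => //; first by apply/(hw _ (dot_yof w0 pw)); exists (dt p wb), (- dt p wa).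
  move=> w' w'0 Xw' pw'; have [a [b ew']] := (hw _ (dot_yof w'0 pw')).1 Xw'.
  have /eqP : dt p w' = 0 by rewrite /dt pw' mxE.
  rewrite ew' dtL addr_eq0 => /eqP ab; exists (- b / dt p wa).
  rewrite /w scalerDr !scalerA; congr (_ *: _ + _ *: _); last by field.
  by apply: (mulIf pa); rewrite ab; field.
apply: generic_general_point.
pose Bas := col_mx (col_mx u0 u1) E.
have Bu : Bas \in unitmx by rewrite -row_free_unit.
have [G [pG [v Gv] hG]] : generic (fun z => Q z /\ tz z != 0).
  apply: genericI => //; exists tz; split=> //.
  by exists (const_mx 1); rewrite /tz mxE oner_eq0.
exists (fun x => G (x *m invmx Bas)); split.
- apply: (fr_pfun (pfunP K k.+2) pG) => j.
  apply: (fr_mulmx (pfunP K k.+2)) => i l; last exact: (fr_cst (pfunP K k.+2)).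
  by rewrite (ord1 i); apply: pfun_coord.
- by exists (v *m Bas); rewrite mulmxK.
- move=> x /hG[]; set z := x *m invmx Bas => Qz tz0 _.
  apply/unique_memberP.
  have -> : x = vec (z 0 (lshift k (lshift 1 0))) (z 0 (lshift k (rshift 1 0))) + rsubmx z *m E.
    rewrite -[LHS](mulmxKV Bu) -/z -[in LHS](hsubmxK (z : 'rV_((1 + 1) + k))) mul_row_col; congr (_ + _).
    rewrite -[lsubmx _]hsubmxK mul_row_col /vec [lsubmx (lsubmx _)]mx11_scalar.
    by rewrite [rsubmx (lsubmx _)]mx11_scalar !mul_scalar_mx !mxE.
  have t : nz2 (z 0 (lshift k (lshift 1 0))) (z 0 (lshift k (rshift 1 0))) by rewrite /nz2 tz0.
  exact/(unique_sectionP _ t).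
Qed.

End Backward.

(** * From order one to lines in all fibres *)

Section Forward.

(** The form defining general position is multiplied by the coordinate t0: its nonzeros then lie off
    pi, and t can be normalized to (1 : t1). *)
Lemma order_form : has_order Sigma 1 -> exists d G, [/\ hform d G,
  exists t1 p, G (vec 1 t1 + p *m E) != 0 &
  forall x, G x != 0 -> unique_member x /\
    exists t0 t1 p, t0 != 0 /\ x = vec t0 t1 + p *m E].
Proof.
move=> /general_point_form[d [G [hG [x0 Gx0] hGu]]].
pose Bas := col_mx (col_mx u0 u1) E.
have Bu : Bas \in unitmx by rewrite -row_free_unit.
pose T (x : 'rV[K]_k.+2) := (x *m invmx Bas) 0 (lshift k (lshift 1 0)).
have hT : hform 1 T by apply: hform_lin.
have TE t0 t1 p : T (vec t0 t1 + p *m E) = t0.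
  rewrite /T; suff -> : vec t0 t1 + p *m E = row_mx (row_mx t0%:M t1%:M) p *m Bas.
    by rewrite mulmxK // !row_mxEl mxE eqxx.
  by rewrite !mul_row_col !mul_scalar_mx.
have [x] : exists x, G x * T x != 0.
  apply: (pfunM_neq0 (v2 := vec 1 0 + 0 *m E) (hform_pfun hG) (hform_pfun hT) Gx0).
  by rewrite TE oner_eq0.
move=> GTx; exists (d + 1)%N, (fun x => G x * T x); have hGT := hformM hG hT; split => //.
  have [t0 [t1 [p ex]]] := frame_ex frame x.
  have t00 : t0 != 0 by apply: contraNneq GTx => t00; rewrite {2}ex TE t00 mulr0.
  exists (t1 / t0), (t0^-1 *: p).
  have -> : vec 1 (t1 / t0) + (t0^-1 *: p) *m E = t0^-1 *: x.
    by rewrite ex scalerDr -vecZ mulVf // mulrC scalemxAl.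
  by rewrite (hform_scale _ _ hGT) mulf_neq0 // expf_neq0 // invr_eq0.
move=> y; rewrite mulf_eq0 negb_or => /andP[Gy Ty].
have [t0 [t1 [p ey]]] := frame_ex frame y.
have t00 : t0 != 0 by apply: contraNneq Ty => t00; rewrite ey TE t00.
split; last by exists t0, t1, p.
apply/unique_memberP/hGu => //; apply: contraNneq Ty => ->.
by rewrite /T mul0mx mxE.
Qed.

Variables (d : nat) (G : 'rV[K]_k.+2 -> K).
Hypothesis hG : hform d G.
Hypothesis G1 : exists t1 p, G (vec 1 t1 + p *m E) != 0.
Hypothesis hGu : forall x, G x != 0 -> unique_member x /\
  exists t0 t1 p, t0 != 0 /\ x = vec t0 t1 + p *m E.

Let g p t := G (vec 1 t + p *m E).

Lemma nz1 t : nz2 (1 : K) t. Proof. by rewrite /nz2 oner_eq0. Qed.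

Lemma g_unique p t : g p t != 0 -> unique_section 1 t p.
Proof. by move=> /hGu[u _]; apply/(unique_sectionP _ (nz1 t)). Qed.

Definition dot (p : 'rV[K]_k) (w : 'rV[K]_(1 + k)) := (wv 1 p *m w^T) 0 0.

Lemma dotP p w : wv 1 p *m w^T = 0 <-> dot p w = 0.
Proof.
split=> [e|e]; first by rewrite /dot e mxE.
by apply/matrixP => i j; rewrite (ord1 i) (ord1 j) [LHS]e mxE.
Qed.

Lemma dotE p w : dot p w = cof w + (p *m (yof w)^T) 0 0.
Proof. by rewrite /dot {1}(wvE w) wv_dot mul1r mxE mxE eqxx mulr1n. Qed.

Lemma dot_linear p a b w w' : dot p (a *: w + b *: w') = a * dot p w + b * dot p w'.
Proof. by rewrite /dot linearP /= linearZ /= mulmxDr -!scalemxAr !mxE. Qed.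

Lemma g_polyf p t1 p' : polyf (fun s => g (p + s *: p') t1) /\ polyf (fun t => g p t).
Proof.
have pG := hform_pfun hG; split.
  have [q hq] := polyf_line (vec 1 t1 + p *m E) (p' *m E) pG.
  by exists q => s; rewrite -hq /g mulmxDl -scalemxAl addrA.
have [q hq] := polyf_line (vec 1 0 + p *m E) (vec 0 1) pG.
exists q => s; rewrite -hq /g; congr G.
have -> : vec 1 s = vec 1 0 + s *: vec 0 1.
  by rewrite -vecZ -vecD mulr0 mulr1 addr0 add0r.
by rewrite addrAC.
Qed.

(** For almost all t the hyperplane of p cuts the fibre in one point by order one; [rational_line]
    makes it a polynomial curve, and both equations extend to the remaining t by density. *)
Lemma section_curve p t1 : g p t1 != 0 -> exists q : 'rV[{poly K}]_(1 + k),
  forall t, [/\ in_cone 1 t (evr q t), evr q t != 0 & dot p (evr q t) = 0].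
Proof.
move=> gp; pose D t w := in_cone 1 t w /\ (w != 0 /\ dot p w = 0).
have P := pfunP K (1 + (1 + k)).
have pc i : pfun (fun v : 'rV[K]_(1 + (1 + k)) => rsubmx v 0 i).
  by apply: (fr_ext P (pfun_coord K (rshift 1 i))) => v; rewrite mxE.
have cD : constr (fun v : 'rV[K]_(1 + (1 + k)) => D (v 0 (lshift (1 + k) 0)) (rsubmx v)).
  apply: ConstrI; first by apply: constr_in_cone => //; [exact: (fr_cst P)|exact: pfun_coord].
  apply: ConstrI; first exact: constr_ne0.
  apply: Constr0; apply: (fr_mulmx P) => i j; first exact: (fr_cst P).
  by rewrite (ord1 j); apply: (fr_ext P (pc i)) => v; rewrite !mxE.
have D0 t w : D t w -> w != 0 by move=> [_ []].
have DZ t w c : c != 0 -> D t w -> D t (c *: w).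
  move=> c0 [Xw [w0 e]]; split; first exact: in_coneZ.
  split; first by rewrite scaler_eq0 negb_or c0.
  by rewrite -[c *: w]addr0 -(scale0r w) dot_linear e !mulr0 addr0.
have uD : cofin (fun t => exists2 w, D t w & forall w', D t w' -> exists c, w' = c *: w).
  apply: cofinW (cofin_polyf (g_polyf p 0 0).2 gp) => t /g_unique[w [w0 Xw /dotP pw u]].
  exists w => // w' [Xw' [w'0 /dotP pw']]; exact: u.
have [q Dq q0] := rational_line cD D0 DZ uD; exists q => t; split=> //.
  have pv : pfun (fun v : 'rV[K]_1 => v 0 0) by apply: pfun_coord.
  have [f f0 hf] := Dq.
  have [t' ft'] := poly_nonroot f0.
  have h := @in_cone_dense 1 (fun=> 1) (fun v => v 0 0) (fun v => f.[v 0 0])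
    (fun v => evr q (v 0 0)) (const_mx t').
  have := h _ pv _ _ _ _ (const_mx t); rewrite !mxE; apply.
  - exact: (fr_cst (pfunP K 1)).
  - move=> i; have [qi hqi] := polyf_evr q 0 i.
    by apply: (fr_ext (pfunP K 1) (fr_poly (pfunP K 1) qi pv)) => v; rewrite hqi.
  - exact: (fr_poly (pfunP K 1)).
  - exact: ft'.
  - by move=> v /hf[].
apply: (polyf_cofin0 (f := fun t => dot p (evr q t))); last by apply: cofinW Dq => s [_ []].
apply: (fr_mulmx (polyfP K)) => i j; first exact: (fr_cst (polyfP K)).
by rewrite (ord1 j); have [qi hqi] := polyf_evr q 0 i; exists qi => s; rewrite mxE hqi.
Qed.

(* Two generic sections of the pencil of hyperplanes cut the general fibre in
   two points, and the line through them lies in the fibre. *)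
Lemma generic_lines : exists p q : 'rV[{poly K}]_(1 + k),
  cofin (fun t => indep2 (evr p t) (evr q t)) /\
  cofin (fun t => forall c0 c1, in_cone 1 t (c0 *: evr p t + c1 *: evr q t)).
Proof.
have [t1 [p1 gp1]] := G1.
have [w1 [w10 Xw1 pw1 u1']] := g_unique gp1.
have y1 := dot_yof w10 pw1.
have [i yi] := rV_neq0_ex y1.
(* The hyperplane of p2 is obtained by moving p1 in a direction where the y part of w1 does not
   vanish. It misses the section by p1 over t1, so the two sections are independent there and hence
   for almost all t. *)
pose v : 'rV[K]_k := delta_mx 0 i.
have vy : (v *m (yof w1)^T) 0 0 != 0 by rewrite -rowE mxE mxE.
have [s [gs s0]] : exists s, g (p1 + s *: v) t1 != 0 /\ s != 0.
  have h : cofin (fun s => g (p1 + s *: v) t1 != 0).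
    apply: (@cofin_polyf _ (fun s => g (p1 + s *: v) t1) 0 (g_polyf p1 t1 v).1).
    by rewrite scale0r addr0.
  exact: cofin_ex (cofinI h (cofin_neq 0)).
set p2 := p1 + s *: v in gs.
have [q1 hq1] := section_curve gp1; have [q2 hq2] := section_curve gs.
have dq1 : dot p2 (evr q1 t1) != 0.
  have [X1 q10 d1] := hq1 t1; have [c ec] := u1' _ q10 X1 ((dotP _ _).2 d1).
  have c0 : c != 0 by apply: contraNneq q10 => c0; rewrite ec c0 scale0r.
  rewrite ec; have := dot_linear p2 c 0 w1 0; rewrite scale0r mul0r !addr0 => ->.
  rewrite mulf_neq0 // dotE mulmxDl mxE addrA -dotE (dotP _ _).1 // add0r.
  by rewrite -scalemxAl mxE mulf_neq0.
have pdq : polyf (fun t => dot p2 (evr q1 t)).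
  apply: (fr_mulmx (polyfP K)) => a b; first exact: (fr_cst (polyfP K)).
  by rewrite (ord1 b); have [qi hqi] := polyf_evr q1 0 a; exists qi => x; rewrite mxE hqi.
have cdq := cofin_polyf pdq dq1.
exists q1, q2; split.
  apply: cofinW cdq => t dt a b e.
  have [_ _ d2] := hq2 t; have [_ q20 _] := hq2 t.
  have a0 : a = 0.
    have := dot_linear p2 a b (evr q1 t) (evr q2 t); rewrite e d2 mulr0 addr0.
    have -> : dot p2 0 = 0 by rewrite /dot trmx0 mulmx0 mxE.
    by move/esym/eqP; rewrite mulf_eq0 (negPf dt) orbF => /eqP.
  split=> //; move: e; rewrite a0 scale0r add0r => /eqP.
  by rewrite scaler_eq0 (negPf q20) orbF => /eqP.
have [gp2t gp1t] := ((g_polyf p2 0 0).2, (g_polyf p1 0 0).2).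
apply: cofinW (cofinI cdq (cofinI (cofin_polyf gp1t gp1) (cofin_polyf gp2t gs))).
move=> t [dt [g1t g2t]] c0 c1.
have [X1 q10 d1] := hq1 t; have [X2 q20 d2] := hq2 t.
(* The pencil spanned by the hyperplanes of p1 and p2, at parameters 0 and 1. *)
pose a0 := (wv 1 p1)^T; pose a1 := (wv 0 (p2 - p1))^T.
have aE x : a0 + x *: a1 = (wv 1 (p1 + x *: (p2 - p1)))^T.
  rewrite /a0 /a1 -linearZ -linearD /= wvZ; congr (_^T).
  by rewrite mulr0 /wv add_row_mx (raddf0 (@scalar_mx K 1)) addr0.
have sP x w : section_pt (in_cone 1 t) a0 a1 x w <->
    [/\ in_cone 1 t w, w != 0 & wv 1 (p1 + x *: (p2 - p1)) *m w^T = 0].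
  rewrite /section_pt aE; split=> -[Xw w0 e]; split=> //.
    by have := congr1 trmx e; rewrite trmx_mul trmxK trmx0.
  by have := congr1 trmx e; rewrite trmx_mul trmxK trmx0.
have uniq x : g (p1 + x *: (p2 - p1)) t != 0 -> exists2 w, section_pt (in_cone 1 t) a0 a1 x w &
    forall w', section_pt (in_cone 1 t) a0 a1 x w' -> exists c, w' = c *: w.
  move=> /g_unique[w [w0 Xw pw u]]; exists w; first by apply/sP.
  by move=> w' /sP[Xw' w'0 pw']; apply: u.
have uq x q : g (p1 + x *: (p2 - p1)) t != 0 -> section_pt (in_cone 1 t) a0 a1 x q ->
    forall w', section_pt (in_cone 1 t) a0 a1 x w' -> exists c, w' = c *: q.
  move=> /uniq[w _ u] sq w' /u[c' ->]; have [c ec] := u _ sq.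
  have [_ q0 _] := sq; have cn : c != 0 by apply: contraNneq q0 => c_eq0; rewrite ec c_eq0 scale0r.
  by exists (c' / c); rewrite ec scalerA divfK.
have e0 : p1 + 0 *: (p2 - p1) = p1 by rewrite scale0r addr0.
have e1 : p1 + 1 *: (p2 - p1) = p2 by rewrite scale1r addrC subrK.
apply: (@cone_contains_line _ _ (in_cone 1 t) a0 a1) => //.
- exact: closed_in_cone.
- apply: cofinW (@cofin_polyf _ (fun x => g (p1 + x *: (p2 - p1)) t) 0 _ _) => [x /uniq//||].
    exact: (g_polyf p1 t (p2 - p1)).1.
  by rewrite e0.
- by apply: uq; rewrite ?e0 //; apply/sP; rewrite e0; split=> //; apply/dotP.
- by apply: uq; rewrite ?e1 //; apply/sP; rewrite e1; split=> //; apply/dotP.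
- apply: contraNneq dt => e; rewrite /dot.
  have -> : wv 1 p2 = a0^T + a1^T by rewrite -linearD /= -[a1]scale1r aE trmxK e1.
  have h0 : wv 1 p1 *m (evr q1 t)^T = 0 by apply/dotP.
  rewrite /a0 trmxK mulmxDl h0 add0r -[a1^T *m _]trmxK trmx_mul !trmxK e.
  by rewrite trmx0 mxE.
Qed.

Lemma plane_family : exists a b (p q : 'rV[{poly K}]_(1 + k)),
  [/\ forall j, (size (p 0%R j) <= a + is0 j)%N, forall j, (size (q 0%R j) <= b + is0 j)%N,
    forall t0 t1, nz2 t0 t1 -> indep2 (bvec (@is0 k) a p t0 t1) (bvec (@is0 k) b q t0 t1) &
    forall t0 t1 w, plane_pt a b p q t0 t1 w -> in_cone t0 t1 w].
Proof.
have [p0 [q0 [ipq Xpq]]] := generic_lines.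
have is01 (j : 'I_(1 + k)) : (is0 j <= 1)%N by rewrite /is0; case: (_ == _).
have [a [b [p [q [[sp sq ip span] iall]]]]] := saturate is01 ipq.
exists a, b, p, q; split=> // t0 t1 w [c0 [c1 ->]].
have [f f0 hf] := cofinI Xpq span.
have [t' ft'] := poly_nonroot f0.
have P := pfunP K (1 + 1).
pose s0 (v : 'rV[K]_(1 + 1)) := v 0 (lshift 1 0).
pose s1 (v : 'rV[K]_(1 + 1)) := v 0 (rshift 1 0).
have ps0 : pfun s0 by apply: pfun_coord.
have ps1 : pfun s1 by apply: pfun_coord.
(* Nonzero where t0 is nonzero and t1 / t0 avoids the exceptional values; the inclusion proved there
   spreads to all of the projective line by density. *)
pose gg v := s0 v * bform (size f) f (s0 v) (s1 v).
have pv x y : s0 (row_mx x%:M y%:M) = x /\ s1 (row_mx x%:M y%:M) = y.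
  by rewrite /s0 /s1 row_mxEl row_mxEr !mxE !eqxx.
have pb a' (p' : 'rV[{poly K}]_(1 + k)) i : pfun (fun v => bvec (@is0 k) a' p' (s0 v) (s1 v) 0 i).
  by apply: (fr_ext P (fr_bform (a' + is0 i) (p' 0 i) P ps0 ps1)) => v; rewrite mxE.
have h := @in_cone_dense (1 + 1) s0 s1 gg
  (fun v => c0 *: bvec (@is0 k) a p (s0 v) (s1 v) + c1 *: bvec (@is0 k) b q (s0 v) (s1 v))
  (row_mx 1%:M t'%:M) ps0 ps1 _ _ _ _ (row_mx t0%:M t1%:M).
have [e0 e1] := pv t0 t1; rewrite e0 e1 in h; apply: h.
- move=> i; apply: (fr_ext P (f := fun v => c0 * bvec (@is0 k) a p (s0 v) (s1 v) 0 i +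
    c1 * bvec (@is0 k) b q (s0 v) (s1 v) 0 i)); last by move=> v; rewrite !mxE.
  by apply: (fr_add P); apply: (fr_mul P) => //; apply: (fr_cst P).
- by apply: (fr_mul P) => //; apply: (fr_bform _ _ P).
- by rewrite /gg; have [-> ->] := pv 1 t'; rewrite mul1r bform1.
move=> v; rewrite /gg mulf_eq0 negb_or => /andP[x0].
move: (s0 v) (s1 v) x0 => x y x0; rewrite bform_horner // mulf_eq0 negb_or => /andP[_].
move=> /hf[Xt spt]; rewrite !bvec_chart // !scalerA.
move: (c0 * _) (c1 * _) => d0 d1; have [c' [d' e']] := spt d0 d1.
rewrite !wvZ /wv add_row_mx -raddfD /= -/(wv _ _) mulrCA [d1 * (x * _)]mulrCA -mulrDr.
have -> : y = x * (y / x) by rewrite mulrC divfK.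
rewrite -{1}[x]mulr1 [x * (y / x) / x]mulrAC divff // mul1r.
apply: in_cone_rescale => //.
suff -> : wv (d0 * cof (evr p (y / x)) + d1 * cof (evr q (y / x)))
    (d0 *: yof (evr p (y / x)) + d1 *: yof (evr q (y / x))) = d0 *: evr p (y / x) + d1 *: evr q (y / x).
  by rewrite e'; apply: Xt.
apply: wvP; first by rewrite cof_wv /cof !mxE.
by rewrite yof_wv /yof linearP /= linearZ.
Qed.

End Forward.

(** * The family of lines over the pencil *)

Section LineFamily.
Hypothesis irrSigma : zirreducible k Sigma.
Variables (a b : nat) (p q : 'rV[{poly K}]_(1 + k)).
Hypothesis sp : forall j, (size (p 0%R j) <= a + is0 j)%N.
Hypothesis sq : forall j, (size (q 0%R j) <= b + is0 j)%N.
Local Notation bP := (bvec (@is0 k) a p).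
Local Notation bQ := (bvec (@is0 k) b q).
Local Notation plane := (plane_pt a b p q).
Hypothesis indPQ : forall t0 t1, nz2 t0 t1 -> indep2 (bP t0 t1) (bQ t0 t1).
Hypothesis plane_cone : forall t0 t1 w, plane t0 t1 w -> in_cone t0 t1 w.
Variables (Tc : 'M[K]_(N, 1)) (T0 T1 : 'M[K]_(N, k)).
Hypothesis coords : forall t0 t1 w, [/\ psi (B t0 t1) w *m Tc = (cof w)%:M,
    psi (B t0 t1) w *m T0 = t0 *: yof w & psi (B t0 t1) w *m T1 = t1 *: yof w].

Lemma psi_entry (B' : 'M[K]_(1 + k, k.+2)) (w : 'rV[K]_(1 + k)) j :
  psi B' w 0 j = \sum_i w 0 i * psi B' (delta_mx 0 i) 0 j.
Proof.
rewrite mxE det_row_mx_expand; apply: eq_bigr => i _.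
rewrite [in RHS]mxE det_row_mx_expand (bigD1 i) //= big1 ?addr0; last first.
  by move=> l li; rewrite !mxE eqxx (negPf li) !mul0r.
by rewrite !mxE !eqxx mul1r mulrA.
Qed.

(** The entry c has degree c + 1 - 1 in t and the entries of y one less, but y enters [psi]
    multiplied by t; so all terms have the same degree. In degree 0 the entries of y are zero. *)
Lemma hform_psi_bvec n c (f : 'rV[{poly K}]_(1 + k)) (S0 S1 : 'rV[K]_n -> K) j :
  hform 1 S0 -> hform 1 S1 ->
  hform c (fun v => psi (B (S0 v) (S1 v)) (bvec (@is0 k) c f (S0 v) (S1 v)) 0 j).
Proof.
move=> h0 h1.
have hy S i : hform 1 S -> hform c (fun v => S v * yof (bvec (@is0 k) c f (S0 v) (S1 v)) 0 i).
  move=> hS; case: c => [|c].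
    apply: (hform_ext (hform0 _ _ _)) => v; rewrite !mxE /is0.
    have -> : (rshift 1 i == lshift k 0) = false by apply/eqP => /(congr1 val).
    by rewrite /bform big_ord0 mulr0.
  have hb := hform_bform c.+1 (f 0 (rshift 1 i)) h0 h1.
  apply: (hform_ext (hformM hS hb)) => v; rewrite !mxE /is0.
  have -> : (rshift 1 i == lshift k 0) = false by apply/eqP => /(congr1 val).
  by rewrite addn0.
have hw (B' : 'M[K]_(1 + k, k.+2)) (w : 'rV[K]_n -> 'rV[K]_(1 + k)) :
    (forall i, hform c (fun v => w v 0 i)) -> hform c (fun v => psi B' (w v) 0 j).
  move=> hh; apply: (hform_ext (f := fun v => \sum_i psi B' (delta_mx 0 i) 0 j * w v 0 i)).
    by apply: hform_sum => i _; apply: hformZ.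
  by move=> v; rewrite [RHS]psi_entry; apply: eq_bigr => i _; rewrite mulrC.
pose wf v := bvec (@is0 k) c f (S0 v) (S1 v).
apply: (hform_ext (f := fun v => psi (B 1 0) (wv (cof (wf v)) (S0 v *: yof (wf v))) 0 j +
    psi (B 0 1) (wv 0 (S1 v *: yof (wf v))) 0 j)); last first.
  by move=> v; rewrite -/(wf v) [in RHS](wvE (wf v)) [in RHS]psi_split [RHS]mxE.
have hc : hform c (fun v => cof (wf v)).
  have := hform_bform (c + 1) (f 0 (lshift k 0)) h0 h1; rewrite addn1 => hb.
  by apply: (hform_ext hb) => v; rewrite /cof mxE /is0 eqxx addn1.
apply: hformD; apply: hw => i; case: (@split_ordP 1 k i) => l ->.
- by apply: (hform_ext hc) => v; rewrite /wv row_mxEl (ord1 l) mxE eqxx.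
- by apply: (hform_ext (hy _ l h0)) => v; rewrite /wv row_mxEr [RHS]mxE.
- by apply: (hform_ext (hform0 _ _ _)) => v; rewrite /wv row_mxEl !mxE mul0rn.
- by apply: (hform_ext (hy _ l h1)) => v; rewrite /wv row_mxEr [RHS]mxE.
Qed.

Lemma psi_bvec_rescale c (f : 'rV[{poly K}]_(1 + k)) s t0 t1 : s != 0 ->
  (forall j, (size (f 0%R j) <= c + is0 j)%N) ->
  psi (B (s * t0) (s * t1)) (bvec (@is0 k) c f (s * t0) (s * t1)) =
  s ^+ c *: psi (B t0 t1) (bvec (@is0 k) c f t0 t1).
Proof.
move=> s0 sf; rewrite bvec_rescale // psiZ psi_rescale scalerA divfK //.
by rewrite -wvE.
Qed.

Definition zcoord (e : bool) (v : 'rV[K]_N) : 'rV[K]_k := if e then v *m T1 else v *m T0.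

Lemma zcoord_psi e t0 t1 w : zcoord e (psi (B t0 t1) w) = (if e then t1 else t0) *: yof w.
Proof. by have [_ h0 h1] := coords t0 t1 w; case: e. Qed.

Lemma hform_zcoord e i : hform 1 (fun v => zcoord e v 0 i).
Proof. by case: e; apply: hform_lin. Qed.

(** When v comes from (t, w), the pair (s0, s1) is y_i t, so for y_i nonzero the first two rows span
    the line of the family over t. Rank two then says that v is on that line, by equations in v
    alone. *)
Definition triple (i : 'I_k) (v : 'rV[K]_N) : 'M[K]_(1 + 1 + 1, N) :=
  let s0 := zcoord false v 0 i in let s1 := zcoord true v 0 i in
  col_mx (col_mx (psi (B s0 s1) (bP s0 s1)) (psi (B s0 s1) (bQ s0 s1))) v.

Lemma zcoord_entry e t0 t1 w i :
  zcoord e (psi (B t0 t1) w) 0 i = yof w 0 i * (if e then t1 else t0).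
Proof. by rewrite zcoord_psi mxE mulrC. Qed.

Lemma triple_psi i t0 t1 w : yof w 0 i != 0 -> triple i (psi (B t0 t1) w) =
  col_mx (col_mx (yof w 0 i ^+ a *: psi (B t0 t1) (bP t0 t1))
    (yof w 0 i ^+ b *: psi (B t0 t1) (bQ t0 t1))) (psi (B t0 t1) w).
Proof. by move=> yi; rewrite /triple !zcoord_entry !psi_bvec_rescale. Qed.

(** * Members other than [pi] lie on the family *)

Section Sweep.
Variables (d : nat) (G : 'rV[K]_k.+2 -> K).
Hypothesis hG : hform d G.
Hypothesis G1 : exists t1 p, G (vec 1 t1 + p *m E) != 0.
Hypothesis hGu : forall x, G x != 0 -> unique_member x /\
  exists t0 t1 p, t0 != 0 /\ x = vec t0 t1 + p *m E.

(* The closed set of members whose Plücker vector lies in the plane of the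
   family over its point of the pencil. *)
Definition on_plane (f : 'rV[K]_N -> K) := exists i e j,
  f = fun v => zcoord e v 0 i * minors (triple i v) 0 j.

(* These forms evaluate G at the points of the member with Plücker vector v. *)
Definition off_plane (f : 'rV[K]_N -> K) := exists e (mu : 'M[K]_k) nu,
  f = fun v => G (vec (- (zcoord false v *m nu^T) 0 0) (- (zcoord true v *m nu^T) 0 0) +
    (zcoord e v *m (mu - mu^T) + (v *m Tc) 0 0 *: nu) *m E).

Lemma hform_on_plane f : on_plane f -> exists d, hform d f.
Proof.
move=> [i [e [j ->]]].
pose ee (l : 'I_(1 + 1 + 1)) := match fintype.split l with
  | inl l' => match fintype.split l' with inl _ => a | inr _ => b end
  | inr _ => 1%N end.
exists (1 + \sum_l ee l)%N; apply: hformM; first exact: hform_zcoord.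
apply: (hform_ext (f := fun v => \det (colsub (pcols j) (triple i v)))); last by move=> v; rewrite mxE.
apply: hform_det => l c.
have [h0 h1] := (hform_zcoord false i, hform_zcoord true i).
rewrite /ee; case: splitP => l' el; [case: splitP => l'' el'|].
- apply: (hform_ext (hform_psi_bvec a p (pcols j c) h0 h1)) => v.
  have -> : l = lshift 1 (lshift 1 l'') by apply: val_inj; rewrite /= el el'.
  by rewrite [RHS]mxE col_mxEu col_mxEu (ord1 l'').
- apply: (hform_ext (hform_psi_bvec b q (pcols j c) h0 h1)) => v.
  have -> : l = lshift 1 (rshift 1 l'') by apply: val_inj; rewrite /= el el'.
  by rewrite [RHS]mxE col_mxEu col_mxEd (ord1 l'').
- apply: (hform_ext (hform_coord _ (pcols j c))) => v.
  have -> : l = rshift (1 + 1) l' by apply: val_inj; rewrite /= el.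
  by rewrite [RHS]mxE col_mxEd (ord1 l').
Qed.

Lemma hform_off_plane f : off_plane f -> exists d, hform d f.
Proof.
move=> [e [mu [nu ->]]]; exists (d * 1)%N.
apply: hform_comp hG _ => j.
have hzz e' : hform 1 (fun v => (zcoord e' v *m nu^T) 0 0).
  by case: e'; apply: (hform_ext (hform_lin (_ *m nu^T) 0)) => v; rewrite mulmxA.
have hc : hform 1 (fun v => (v *m Tc) 0 0) by apply: hform_lin.
have hE : hform 1 (fun v => ((zcoord e v *m (mu - mu^T) + (v *m Tc) 0 0 *: nu) *m E) 0 j).
  pose TT := (if e then T1 else T0) *m (mu - mu^T) *m E + Tc *m (nu *m E).
  apply: (hform_ext (hform_lin TT j)) => v; congr (_ _ _ j).
  rewrite /TT mulmxDr !mulmxA mulmxDl; congr (_ + _); first by case: (e).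
  by rewrite -mul_scalar_mx -mx11_scalar.
apply: (hform_ext (f := fun v => - (u0 0 j) * (zcoord false v *m nu^T) 0 0 +
  - (u1 0 j) * (zcoord true v *m nu^T) 0 0 +
  ((zcoord e v *m (mu - mu^T) + (v *m Tc) 0 0 *: nu) *m E) 0 j)).
  by apply: hformD => //; apply: hformD; apply: hformZ.
move=> v; rewrite [RHS]mxE /vec; congr (_ + _); rewrite 3!mxE; congr (_ + _).
  by rewrite [RHS]mxE mulNr mulrC -mulNr.
by rewrite [RHS]mxE mulNr mulrC -mulNr.
Qed.

Definition on_plane_set := [set S | grass k S /\
  forall f, on_plane f -> forall v, v \in plucker k S -> f v = 0].
Definition off_plane_set := [set S | grass k S /\
  forall f, off_plane f -> forall v, v \in plucker k S -> f v = 0].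

Lemma on_plane_set_hyp t0 t1 w : nz2 t0 t1 -> w != 0 -> (yof w = 0 \/ plane t0 t1 w) ->
  on_plane_set (hyp (B t0 t1) w).
Proof.
move=> t w0 hw; have rB := row_free_Hmx frame t; split; first exact: dim_hyp.
move=> f fo; have [d' hf] := hform_on_plane fo.
rewrite plucker_hyp //; apply/(hform_vline _ hf); case: fo => i [e [j ->]].
rewrite zcoord_entry.
(* Where y_i = 0 the matrix [triple] no longer knows t; the factor [zcoord e v 0 i] disposes of this
   case. *)
have [yi|yi] := eqVneq (yof w 0 i) 0; first by rewrite yi !mul0r.
case: hw => [yw|[c [c' ew]]]; first by rewrite yw mxE eqxx in yi.
apply/eqP; rewrite mulf_eq0; apply/orP; right; apply/eqP.
rewrite mxE; set s := yof w 0 i in yi.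
have -> : triple i (psi (B t0 t1) w) = col_mx (col_mx (row_mx (s ^+ a)%:M 0) (row_mx 0 (s ^+ b)%:M))
    (row_mx c%:M c'%:M : 'rV_(1 + 1)) *m col_mx (psi (B t0 t1) (bP t0 t1)) (psi (B t0 t1) (bQ t0 t1)).
  rewrite (triple_psi _ _ yi) !mul_col_mx !mul_row_col !mul_scalar_mx !mul0mx addr0 add0r.
  by rewrite -psi_linear -ew.
have colM (C : 'M[K]_(1 + 1 + 1, 1 + 1)) (D : 'M[K]_(1 + 1, N)) f' :
    colsub f' (C *m D) = C *m colsub f' D :> 'M_(1 + 1 + 1, 1 + 1 + 1).
  by apply/matrixP => x y; rewrite !mxE; apply: eq_bigr => z _; rewrite mxE.
by rewrite colM; apply: (@det_mulmx_thin _ 2).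
Qed.

(** A point with coefficients (x, p) on [Hmx t0 t1] lies on the member when x c + p.y = 0. Solutions
    polynomial in the Plücker vector are x = - y.nu with p = c nu, and x = 0 with p the image of y
    under a skew matrix. *)
Lemma off_plane_point e mu nu t0 t1 w : vec (- (zcoord false (psi (B t0 t1) w) *m nu^T) 0 0)
      (- (zcoord true (psi (B t0 t1) w) *m nu^T) 0 0) +
    (zcoord e (psi (B t0 t1) w) *m (mu - mu^T) + (psi (B t0 t1) w *m Tc) 0 0 *: nu) *m E
  \in hyp (B t0 t1) w.
Proof.
have [hc _ _] := coords t0 t1 w; rewrite hc !zcoord_psi.
set s := if e then t1 else t0; set y := yof w.
have -> : ((cof w)%:M : 'M[K]_1) 0 0 = cof w by rewrite mxE eqxx mulr1n.
have -> : vec (- ((t0 *: y) *m nu^T) 0 0) (- ((t1 *: y) *m nu^T) 0 0) =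
    (- (y *m nu^T) 0 0) *: vec t0 t1.
  have zE c : - ((c *: y) *m nu^T) 0 0 = - (y *m nu^T) 0 0 * c.
    by rewrite -scalemxAl mxE mulNr mulrC.
  by rewrite -vecZ !zE.
apply/mem_hyp; exists (wv (- (y *m nu^T) 0 0) ((s *: y) *m (mu - mu^T) + cof w *: nu)); last by rewrite wv_mul.
rewrite [in LHS](wvE w) wv_dot -/y mulmxDl.
have -> : (s *: y) *m (mu - mu^T) *m y^T = 0.
  rewrite -!scalemxAl mulmxBr mulmxBl.
  suff -> : y *m mu^T *m y^T = y *m mu *m y^T by rewrite subrr scaler0.
  have tr11 (M : 'M[K]_1) : M^T = M by rewrite [M]mx11_scalar tr_scalar_mx.
  by rewrite -[RHS]tr11 !trmx_mul trmxK mulmxA.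
rewrite add0r -scalemxAl; apply/matrixP => i j; rewrite (ord1 i) (ord1 j) !mxE eqxx mulr1n.
have -> : (\sum_j0 nu 0 j0 * y^T j0 0) = (\sum_j0 y 0 j0 * nu^T j0 0).
  by apply: eq_bigr => l _; rewrite !mxE mulrC.
by rewrite cof_wv; ring.
Qed.

Lemma off_plane_surj t0 t1 w p' : nz2 t0 t1 -> yof w != 0 -> wv 1 p' *m w^T = 0 ->
  exists e mu nu, vec t0 t1 + p' *m E = vec (- (zcoord false (psi (B t0 t1) w) *m nu^T) 0 0)
      (- (zcoord true (psi (B t0 t1) w) *m nu^T) 0 0) +
    (zcoord e (psi (B t0 t1) w) *m (mu - mu^T) + (psi (B t0 t1) w *m Tc) 0 0 *: nu) *m E.
Proof.
move=> t y0 pw; set y := yof w in y0.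
have [i yi] := rV_neq0_ex y0.
(* Since y.n' = 1, the vector [kap] = p' + c n' is orthogonal to y, and the skew matrix built from
   n' and [kap] sends y to [kap]; taking nu = - n' makes the coefficient of [vec] equal to 1. *)
pose n' : 'rV[K]_k := (y 0 i)^-1 *: delta_mx 0 i.
have yn : y *m n'^T = 1%:M.
  rewrite linearZ /= -scalemxAr trmx_delta -colE; apply/matrixP => x z.
  by rewrite (ord1 x) (ord1 z) [LHS]mxE [X in _ * X]mxE [RHS]mxE eqxx mulVf.
pose e := t0 == 0; pose s := if e then t1 else t0.
have s0 : s != 0 by move: t; rewrite /s /e /nz2; case: eqP => [_ //|/eqP].
pose kap := p' + cof w *: n'.
have ky : kap *m y^T = 0.
  have := pw; rewrite [in X in X -> _](wvE w) wv_dot mul1r -/y => h.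
  rewrite mulmxDl -scalemxAl -[n' *m y^T]trmxK trmx_mul trmxK yn trmx1 scalemx1 addrC.
  exact: h.
exists e, (s^-1 *: (n'^T *m kap)), (- n').
have [hc _ _] := coords t0 t1 w; rewrite hc !zcoord_psi -/y -/s.
have -> : ((cof w)%:M : 'M[K]_1) 0 0 = cof w by rewrite mxE eqxx mulr1n.
have E1 c : - ((c *: y) *m (- n')^T) 0 0 = c.
  by rewrite linearN /= mulmxN -scalemxAl yn !mxE eqxx mulr1 opprK.
rewrite !E1; congr (_ + _ *m _).
have yk : y *m kap^T = 0 by rewrite -[LHS]trmxK trmx_mul trmxK ky trmx0.
have -> : (s *: y) *m (s^-1 *: (n'^T *m kap) - (s^-1 *: (n'^T *m kap))^T) = kap.
  have -> : (s^-1 *: (n'^T *m kap))^T = s^-1 *: (kap^T *m n').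
    by rewrite linearZ /= trmx_mul trmxK.
  rewrite -scalerBr -scalemxAr -scalemxAl scalerA mulVf // scale1r mulmxBr.
  by rewrite !mulmxA yn mul1mx yk mul0mx subr0.
by rewrite /kap scalerN addrK.
Qed.

(** Irreducibility is applied to [on_plane_set] and [off_plane_set]. A member through a point x with
    G x nonzero is the only one through x, while the plane of the family over the same t also
    contains a functional vanishing at x; so the member is on the family. Not all members avoid the
    nonzeros of G, since each nonzero lies on a member. *)
Lemma Sigma_on_plane t0 t1 w : nz2 t0 t1 -> yof w != 0 -> in_cone t0 t1 w -> plane t0 t1 w.
Proof.
have c1 : zclosed k on_plane_set by apply: zclosed_hp; apply: hform_on_plane.
have c2 : zclosed k off_plane_set by apply: zclosed_hp; apply: hform_off_plane.
have cover : Sigma `<=` on_plane_set `|` off_plane_set.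
  move=> s Ss; have [noff|noff] := pselect (off_plane_set s); [by right|left].
  have [t0' [t1' [w' [t' w'0 es]]]] := Sigma_param Ss.
  have rB := row_free_Hmx frame t'.
  have [f [fo fv]] : exists f, off_plane f /\ f (psi (B t0' t1') w') != 0.
    apply: contrapT => h; apply: noff; split; first exact: (grass_Sigma Ss).
    move=> f fo; have [d' hf] := hform_off_plane fo; rewrite es plucker_hyp //.
    by apply/(hform_vline _ hf); apply: contrapT => /eqP fv; apply: h; exists f.
  case: fo fv => e [mu [nu ->]]; set x := vec _ _ + _ => Gx.
  have [[s0 [_ _ us]] [x0 [x1 [p' [x00 ex]]]]] := hGu Gx.
  have xs : x \in s by rewrite es; apply: off_plane_point.
  have tx : nz2 x0 x1 by rewrite /nz2 x00.
  have ip := indPQ tx.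
  pose dp (w : 'rV[K]_(1 + k)) := (wv 1 p' *m w^T) 0 0 : K.
  have dpl (c c' : K) (w1 w2 : 'rV[K]_(1 + k)) : dp (c *: w1 + c' *: w2) = c * dp w1 + c' * dp w2.
    by rewrite /dp linearP /= linearZ /= mulmxDr -!scalemxAr !mxE.
  (* Vanishing at x is one linear condition on a plane of functionals, so it has a nonzero
     solution. *)
  have [c [c' [cc dc]]] : exists c c', ~ (c = 0 /\ c' = 0) /\
      c * dp (bP x0 x1) + c' * dp (bQ x0 x1) = 0.
    have [dP|dP] := eqVneq (dp (bP x0 x1)) 0.
      exists 1, 0; rewrite dP mulr0 mul0r addr0; split=> // -[/eqP].
      by rewrite oner_eq0.
    exists (dp (bQ x0 x1)), (- dp (bP x0 x1)); split; last by ring.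
    by move=> [_ /eqP]; rewrite oppr_eq0 (negPf dP).
  pose w1 := c *: bP x0 x1 + c' *: bQ x0 x1.
  have w10 : w1 != 0 by apply/eqP => /ip.
  have pw1 : plane x0 x1 w1 by exists c, c'.
  have Sw1 : Sigma (hyp (B x0 x1) w1) by apply/(Sigma_cone) => //; apply: plane_cone.
  have xw1 : x \in hyp (B x0 x1) w1.
    rewrite ex mem_hyp_point //; apply/eqP/matrixP => i j.
    by rewrite (ord1 i) (ord1 j) -/(dp w1) dpl dc mxE.
  by rewrite (us _ Ss xs) -(us _ Sw1 xw1); apply: on_plane_set_hyp => //; right.
have noff : ~ (Sigma `<=` off_plane_set).
  move=> sub; have [t1' [p' Gx]] := G1.
  have [[s0 [Ss0 xs0 _]] _] := hGu Gx.
  have t' : nz2 (1 : K) t1' by rewrite /nz2 oner_eq0.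
  have [w' [w'0 es Xw' pw']] := Sigma_point t' Ss0 xs0.
  have [e [mu [nu ex]]] := off_plane_surj t' (dot_yof w'0 pw') pw'.
  have [_ h] := sub _ Ss0; move/eqP: Gx; apply; rewrite ex.
  apply: (h _ (ex_intro _ e (ex_intro _ mu (ex_intro _ nu erefl))) (psi (B 1 t1') w')).
  by rewrite es plucker_hyp ?memv_line //; apply: row_free_Hmx.
have sub : Sigma `<=` on_plane_set by case: (irrSigma.2 on_plane_set off_plane_set c1 c2 cover).
move=> t y0 Xw; have w0 := yof_neq0 y0; have rB := row_free_Hmx frame t.
have [_ h] := sub _ ((Sigma_cone t w0).2 Xw).
have [i yi] := rV_neq0_ex y0.
set s := yof w 0 i in yi.
set v := psi (B t0 t1) w in h.
have m0 : minors (triple i v) = 0.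
  apply/rowP => j; rewrite [RHS]mxE; pose e := t0 == 0.
  have := h (fun v => zcoord e v 0 i * minors (triple i v) 0 j) _ v.
  rewrite plucker_hyp // memv_line => /(_ _ isT) hh.
  have {hh} : zcoord e v 0 i * minors (triple i v) 0 j = 0 by apply: hh; exists i, e, j.
  move=> /eqP; rewrite mulf_eq0 zcoord_entry -/s mulf_eq0 (negPf yi) /=.
  by move: t; rewrite /e /nz2; case: eqP => /= [_ /negPf->|/eqP/negPf-> _] /eqP.
(* Vanishing minors give a relation among the three rows; the first two are independent, so v has a
   nonzero coefficient in it. *)
have : ~~ row_free (triple i v) by apply/negP => /minors_neq0; rewrite m0 eqxx.
rewrite -kermx_eq0 => /rowV0Pn[u /sub_kermxP uM un].
have := uM; rewrite (triple_psi _ _ yi) -/s.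
rewrite -[u](hsubmxK (u : 'rV_(1 + 1 + 1))) -[lsubmx _]hsubmxK !mul_row_col.
rewrite [lsubmx (lsubmx _)]mx11_scalar [rsubmx (lsubmx _)]mx11_scalar [rsubmx (u : 'rV_(1 + 1 + 1))]mx11_scalar.
rewrite !mul_scalar_mx !scalerA; set x := lsubmx _ 0 0; set x' := (rsubmx (lsubmx _)) 0 0; set z := _ 0 0.
rewrite -psi_linear -psiZ -psiD => /eqP; rewrite psi_eq0 // => /eqP e.
have z0 : z != 0.
  apply: contraNneq un => z0; move: e; rewrite z0 scale0r addr0 => /(indPQ t)[/eqP + /eqP].
  rewrite !mulf_eq0 !expf_eq0 (negPf yi) !andbF !orbF => /eqP ex /eqP ex'.
  rewrite -[u](hsubmxK (u : 'rV_(1 + 1 + 1))) -[lsubmx _]hsubmxK.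
  rewrite [lsubmx (lsubmx _)]mx11_scalar [rsubmx (lsubmx _)]mx11_scalar [rsubmx (u : 'rV_(1 + 1 + 1))]mx11_scalar.
  by rewrite -/x -/x' -/z ex ex' z0 (raddf0 (@scalar_mx K 1)) !row_mx0.
exists (- (x * s ^+ a) / z), (- (x' * s ^+ b) / z).
apply: (scalerI z0); rewrite scalerDr !scalerA ![z * _]mulrC !divfK // !scaleNr.
by apply/eqP; rewrite -opprD -addr_eq0 addrC; apply/eqP.
Qed.

End Sweep.

Hypothesis cone_plane : forall t0 t1 w, nz2 t0 t1 -> yof w != 0 -> in_cone t0 t1 w -> plane t0 t1 w.

Lemma is0_rshift (i : 'I_k) : is0 (rshift 1 i) = 0%N.
Proof. by rewrite /is0; case: eqP => // /(congr1 val). Qed.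

Lemma yof_bvec c (f : 'rV[{poly K}]_(1 + k)) t0 t1 i :
  yof (bvec (@is0 k) c f t0 t1) 0 i = bform c (f 0 (rshift 1 i)) t0 t1.
Proof. by rewrite !mxE is0_rshift addn0. Qed.

Lemma cof_bvec c (f : 'rV[{poly K}]_(1 + k)) t0 t1 :
  cof (bvec (@is0 k) c f t0 t1) = bform c.+1 (f 0 (lshift k 0)) t0 t1.
Proof. by rewrite /cof mxE /is0 eqxx addn1. Qed.

(* If [pi] is on no line of the family, multiplication by the coordinate c maps
   the space of binary forms of a large degree m into its products with the
   coordinates z, so that a characteristic polynomial is a form in c and z that
   vanishes on all the lines but not at [pi], contradicting irreducibility. *)
Lemma vertex_on_plane : Sigma pi -> exists t0 t1, nz2 t0 t1 /\ plane t0 t1 (wv 1 0).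
Proof.
move=> Spi; apply: contrapT => h.
(* A nonzero combination with y = 0 would be a multiple of the vertex, so the y parts stay
   independent over every t. *)
have indy t0 t1 : nz2 t0 t1 -> indep2 (yof (bP t0 t1)) (yof (bQ t0 t1)).
  move=> t c c' e; apply: (indPQ t); apply/eqP; apply: contrapT => /eqP w0; apply: h.
  exists t0, t1; split=> //; set w := c *: _ + _ in w0.
  have yw : yof w = 0 by rewrite -[RHS]e /w /yof linearP /= linearZ.
  have cw : cof w != 0 by apply: contraNneq w0 => cw; rewrite (wvE w) cw yw wv_eq0 !eqxx.
  exists (c / cof w), (c' / cof w).
  have <- : (cof w)^-1 *: w = wv 1 0.
    apply: wvP; first by rewrite cof_wv {1}/cof mxE mulVf.
    by rewrite yof_wv [LHS]linearZ /= [rsubmx w]yw scaler0.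
  by rewrite ![_ / cof w]mulrC -!scalerA -scalerDr.
have nz10 : nz2 (1 : K) 0 by rewrite /nz2 oner_eq0.
have nz01 : nz2 (0 : K) 1 by rewrite /nz2 oner_eq0 orbT.
have a0 : (0 < a)%N.
  rewrite lt0n; apply/eqP => a0; have := indep2_neq0 (indy _ _ nz10).
  by move/eqP; apply; apply/rowP => i; rewrite yof_bvec a0 /bform big_ord0 mxE.
have b0 : (0 < b)%N.
  rewrite lt0n; apply/eqP => b0; have := indep2_neq0 (indep2C (indy _ _ nz10)).
  by move/eqP; apply; apply/rowP => i; rewrite yof_bvec b0 /bform big_ord0 mxE.
pose P i := p 0 (rshift 1 i); pose Q i := q 0 (rshift 1 i).
pose cp := p 0 (lshift k 0); pose cq := q 0 (lshift k 0).
have sP i : (size (P i) <= a.-1.+1)%N by have := sp (rshift 1 i); rewrite is0_rshift addn0 prednK.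
have sQ i : (size (Q i) <= b.-1.+1)%N by have := sq (rshift 1 i); rewrite is0_rshift addn0 prednK.
have scp : (size cp <= a.-1.+2)%N by have := sp (lshift k 0); rewrite /is0 eqxx addn1 prednK.
have scq : (size cq <= b.-1.+2)%N by have := sq (lshift k 0); rewrite /is0 eqxx addn1 prednK.
have Dfin t : exists i j, (P i).[t] * (Q j).[t] - (P j).[t] * (Q i).[t] != 0.
  have t' : nz2 (1 : K) t by rewrite /nz2 oner_eq0.
  have [i [j]] := indep2_minor (indy _ _ t'); rewrite !yof_bvec => e; exists i, j.
  by move: e; rewrite !bform1 //; [have := sQ i|have := sP j|have := sQ j|have := sP i];
    rewrite prednK.
have Dinf : exists i j, (P i)`_a.-1 * (Q j)`_b.-1 - (P j)`_a.-1 * (Q i)`_b.-1 != 0.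
  have [i [j]] := indep2_minor (indy _ _ nz01); rewrite !yof_bvec => e; exists i, j.
  by move: e; rewrite !bform01 //; [have := sQ i|have := sP j|have := sQ j|have := sP i];
    rewrite prednK.
have [m hm] := linear_syzygy sP sQ scp scq Dfin Dinf.
have [g hg] : exists g : 'I_m.+1 -> 'I_k -> {poly K}, forall l,
    [/\ forall i, (size (g l i) <= m.+2)%N, \sum_i P i * g l i = cp * 'X^l &
      \sum_i Q i * g l i = cq * 'X^l].
  suff /boolp.choice[g hg] : forall l : 'I_m.+1, exists g : 'I_k -> {poly K},
    [/\ forall i, (size (g i) <= m.+2)%N, \sum_i P i * g i = cp * 'X^l &
      \sum_i Q i * g i = cq * 'X^l] by exists g.
  by move=> l; apply: hm; rewrite size_polyXn.
pose mon t0 t1 : 'cV[K]_m.+1 := \col_l (t0 ^+ (m - l) * t1 ^+ l).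
have formE c (f : 'rV[{poly K}]_(1 + k)) l t0 t1 : (0 < c)%N ->
    (forall i, (size (f 0%R (rshift 1 i)) <= c.-1.+1)%N) ->
    (size (f 0%R (lshift k 0%R)) <= c.-1.+2)%N ->
    \sum_i f 0 (rshift 1 i) * g l i = f 0 (lshift k 0) * 'X^l ->
    cof (bvec (@is0 k) c f t0 t1) * mon t0 t1 l 0 =
    \sum_i yof (bvec (@is0 k) c f t0 t1) 0 i * bform m.+2 (g l i) t0 t1.
  move=> c0 sf sf0 e; have [sg _ _] := hg l.
  rewrite mxE cof_bvec -bform_Xn -{1}(prednK c0) bform_mul ?size_polyXn //.
  rewrite -e addSnnS bform_sum; apply: eq_bigr => i _.
  by rewrite yof_bvec -{2}(prednK c0) bform_mul.
(* On the family, c times a monomial of degree m in t is a sum of products of the y_i with forms of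
   degree m + 1. *)
have planeE t0 t1 w l : plane t0 t1 w -> cof w * mon t0 t1 l 0 =
    \sum_i yof w 0 i * bform m.+2 (g l i) t0 t1.
  move=> [c [c' ->]]; have [_ eP eQ] := hg l.
  have -> : cof (c *: bP t0 t1 + c' *: bQ t0 t1) = c * cof (bP t0 t1) + c' * cof (bQ t0 t1).
    by rewrite /cof !mxE.
  rewrite mulrDl -!mulrA (formE a p l) // (formE b q l) // !mulr_sumr -big_split /=.
  apply: eq_bigr => i _.
  have -> : yof (c *: bP t0 t1 + c' *: bQ t0 t1) 0 i =
    c * yof (bP t0 t1) 0 i + c' * yof (bQ t0 t1) 0 i by rewrite !mxE.
  by ring.
(* By [bform_succ] the sums in [planeE] are the product of this matrix with the vector of monomials,
   and its entries are linear in t0 y and t1 y. Thus c is an eigenvalue on the family, whereas at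
   the vertex the matrix is 0 and c is not. *)
pose Lam (v : 'rV[K]_N) : 'M[K]_m.+1 := \matrix_(l, l') \sum_i
  ((g l i)`_l' * zcoord false v 0 i + ((g l i)`_m.+1 *+ (l' == ord_max)) * zcoord true v 0 i).
pose F v := \det (((v *m Tc) 0 0)%:M - Lam v).
have hF : hform (\sum_(l < m.+1) 1) F.
  apply: (@hform_det _ _ _ (fun=> 1%N)) => l l'.
  apply: (hform_ext (f := fun v => (l == l')%:R * (v *m Tc) 0 0 - \sum_i
    ((g l i)`_l' * zcoord false v 0 i + ((g l i)`_m.+1 *+ (l' == ord_max)) * zcoord true v 0 i))).
    apply: hformD; first by apply: hformZ; apply: hform_lin.
    by apply: hformN; apply: hform_sum => i _; apply: hformD; apply: hformZ; apply: hform_zcoord.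
  move=> v; rewrite [RHS]mxE; congr (_ + _); first by rewrite [RHS]mxE mulr_natl.
  by rewrite [RHS]mxE [X in _ = - X]mxE.
have Fplane t0 t1 w : nz2 t0 t1 -> plane t0 t1 w -> F (psi (B t0 t1) w) = 0.
  move=> t pw; apply: (det_ker (x := mon t0 t1)); last first.
    apply/eqP => /colP e; move: t; rewrite /nz2.
    have := e ord0; have := e ord_max; rewrite !mxE subnn subn0 !expr0 mul1r mulr1.
    by move=> /eqP + /eqP; rewrite !expf_eq0 => /andP[_ /eqP->] /andP[_ /eqP->]; rewrite !eqxx.
  apply/colP => l; rewrite mulmxBl mul_scalar_mx; have [hc _ _] := coords t0 t1 w.
  rewrite hc [RHS]mxE [LHS]mxE [X in X + _]mxE [X in _ + X]mxE.
  rewrite [X in X * _]mxE eqxx mulr1n (planeE _ _ _ l pw); apply/eqP; rewrite subr_eq0; apply/eqP.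
  under eq_bigr => i _ do rewrite bform_succ mulr_sumr.
  rewrite exchange_big [RHS]mxE; apply: eq_bigr => l' _ /=.
  rewrite [X in _ = X * _]mxE mulr_suml; apply: eq_bigr => i _.
  by rewrite !zcoord_entry /= [mon _ _ _ _]mxE; ring.
have Fpi : F (psi (B 1 0) (wv 1 0)) != 0.
  rewrite /F; have [hc _ _] := coords 1 0 (wv 1 0).
  have -> : Lam (psi (B 1 0) (wv 1 0)) = 0.
    apply/matrixP => l l'; rewrite !mxE big1 // => i _.
    by rewrite !zcoord_entry yof_wv mxE !mul0r !mulr0 addr0.
  by rewrite hc cof_wv subr0 mxE eqxx mulr1n det1 oner_eq0.
pose zeros_F : set {vspace 'rV[K]_k.+2} := [set S | grass k S /\
  forall f, f = F -> forall v, v \in plucker k S -> f v = 0].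
(* The second closed set takes care of members with y = 0; Sigma is not contained in it, because it
   contains the lines of the family. *)
pose zeros_z : set {vspace 'rV[K]_k.+2} := [set S | grass k S /\
  forall f, (exists e i, f = fun v => zcoord e v 0 i) -> forall v, v \in plucker k S -> f v = 0].
have c3 : zclosed k zeros_F.
  by apply: (zclosed_hp (Fam := fun f => f = F)) => f ->; eexists; apply: hF.
have c4 : zclosed k zeros_z.
  apply: (zclosed_hp (Fam := fun f => exists e i, f = fun v => zcoord e v 0 i)) => f [e [i ->]].
  by exists 1%N; apply: hform_zcoord.
have cover : Sigma `<=` zeros_F `|` zeros_z.
  move=> s Ss; have [t0 [t1 [w [t w0 es]]]] := Sigma_param Ss.
  have rB := row_free_Hmx frame t; have ds := grass_Sigma Ss.
  have [yw|yw] := eqVneq (yof w) 0.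
    right; split=> // f [e [i ->]]; rewrite es plucker_hyp //.
    apply/(hform_vline (psi (B t0 t1) w) (hform_zcoord e i)).
    by rewrite zcoord_entry yw mxE mul0r.
  left; split=> // f ->; rewrite es plucker_hyp //; apply/(hform_vline _ hF).
  apply: Fplane => //; apply: cone_plane => //.
  by apply/(Sigma_cone) => //; rewrite -es.
have piE : pi = hyp (B 1 0) (wv 1 0) by rewrite hyp_pi ?oner_eq0.
have w10 : wv 1 0 != 0 :> 'rV[K]_(1 + k) by rewrite wv_eq0 oner_eq0.
case: (irrSigma.2 zeros_F zeros_z c3 c4 cover) => sub.
  have [_ /(_ F erefl)] := sub _ Spi.
  rewrite piE plucker_hyp //; last exact: row_free_Hmx.
  by move=> /(hform_vline _ hF)/eqP; rewrite (negPf Fpi).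
have y0 := indep2_neq0 (indy _ _ nz10); have [i yi] := rV_neq0_ex y0.
have w0 := yof_neq0 y0.
have SP : Sigma (hyp (B 1 0) (bP 1 0)).
  apply/(Sigma_cone) => //; apply: plane_cone; exists 1, 0.
  by rewrite scale1r scale0r addr0.
have [_ h4] := sub _ SP.
have := h4 _ (ex_intro _ false (ex_intro _ i erefl)) (psi (B 1 0) (bP 1 0)).
rewrite plucker_hyp ?memv_line; [|exact: row_free_Hmx|done].
move=> /(_ isT) /eqP; rewrite zcoord_entry mulr1.
by rewrite (negPf yi).
Qed.

(** * The lines in the Plücker space and the ruling *)

Hypothesis vertex : Sigma pi -> exists t0 t1, nz2 t0 t1 /\ plane t0 t1 (wv 1 0).

Definition line_mx t0 t1 : 'M[K]_(1 + 1, N) :=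
  col_mx (psi (B t0 t1) (bP t0 t1)) (psi (B t0 t1) (bQ t0 t1)).

Lemma line_mx_mul t0 t1 c c' :
  row_mx c%:M c'%:M *m line_mx t0 t1 = psi (B t0 t1) (c *: bP t0 t1 + c' *: bQ t0 t1).
Proof. by rewrite mul_row_col !mul_scalar_mx psi_linear. Qed.

Lemma row11E (u : 'rV[K]_(1 + 1)) : u = row_mx (lsubmx u 0 0)%:M (rsubmx u 0 0)%:M.
Proof. by rewrite -!mx11_scalar hsubmxK. Qed.

Lemma row11_eq0 (c c' : K) : (row_mx c%:M c'%:M == 0 :> 'rV[K]_(1 + 1)) = (c == 0) && (c' == 0).
Proof. by rewrite (@wv_eq0 _ 1 c c'%:M); congr (_ && _); apply/eqP/eqP => [/matrixP/(_ 0 0)|->];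
  rewrite ?mxE ?eqxx ?mulr1n // raddf0. Qed.

Lemma row_free_line_mx t0 t1 : nz2 t0 t1 -> row_free (line_mx t0 t1).
Proof.
move=> t; apply: inj_row_free => u; rewrite [u]row11E line_mx_mul => /eqP.
rewrite psi_eq0 ?row_free_Hmx // => /eqP/(indPQ t)[-> ->].
by apply/eqP; rewrite row11_eq0 !eqxx.
Qed.

Lemma mem_line_mx t0 t1 v : v \in rowvs (line_mx t0 t1) <->
  exists2 w, plane t0 t1 w & v = psi (B t0 t1) w.
Proof.
split=> [/mem_rowvs[u ->]|[w [c [c' ->]] ->]].
  rewrite [u]row11E line_mx_mul; eexists; last by [].
  by eexists; eexists.
by apply/mem_rowvs; exists (row_mx c%:M c'%:M); rewrite line_mx_mul.
Qed.

(** The two rows scale by c ^+ a and c ^+ b, so the row space depends only on the point (t0 : t1);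
    this makes the family of lines well defined on the pencil. *)
Lemma rowvs_line_mxZ c t0 t1 : c != 0 ->
  rowvs (line_mx (c * t0) (c * t1)) = rowvs (line_mx t0 t1).
Proof.
move=> c0; rewrite /line_mx !psi_bvec_rescale //.
have e (x y : K) (u v : 'rV[K]_N) : row_mx x%:M y%:M *m col_mx u v = x *: u + y *: v.
  by rewrite mul_row_col !mul_scalar_mx.
apply/vspaceP => v; apply/mem_rowvs/mem_rowvs => -[u ->]; rewrite [u]row11E e.
  by rewrite !scalerA -e; eexists.
exists (row_mx (lsubmx u 0 0 / c ^+ a)%:M (rsubmx u 0 0 / c ^+ b)%:M).
by rewrite e !scalerA !divfK // expf_neq0.
Qed.

Definition member_line t0 t1 : set {vspace 'rV[K]_k.+2} :=
  [set s | exists w, [/\ w != 0, plane t0 t1 w & s = hyp (B t0 t1) w]].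

Lemma plucker_member_line t0 t1 : nz2 t0 t1 ->
  plucker k @` member_line t0 t1 = points (rowvs (line_mx t0 t1)).
Proof.
move=> t; have rB := row_free_Hmx frame t; apply/seteqP; split=> x.
  move=> [s [w [w0 pw ->]] <-]; rewrite plucker_hyp //; split.
    by apply: dim_line; rewrite psi_eq0.
  by rewrite -memvE; apply/mem_line_mx; exists w.
move=> [/grass1_line[v v0 ->]]; rewrite -memvE => /mem_line_mx[w pw ev].
have w0 : w != 0 by rewrite -(psi_eq0 _ rB) -ev.
by exists (hyp (B t0 t1) w); [exists w|rewrite plucker_hyp // -ev].
Qed.

Lemma is_line_member_line t0 t1 : nz2 t0 t1 -> is_line k (member_line t0 t1).
Proof.
move=> t; split.
  by move=> s [w [w0 _ ->]]; apply: dim_hyp => //; apply: row_free_Hmx.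
exists (rowvs (line_mx t0 t1)); last exact: plucker_member_line.
exact: (dim_rowvs (row_free_line_mx t)).
Qed.

Lemma fibre_member_line t0 t1 : nz2 t0 t1 ->
  phi_fibre pi (rowvs (B t0 t1)) `&` Sigma = member_line t0 t1 `\ pi.
Proof.
move=> t; have rB := row_free_Hmx frame t; apply/seteqP; split=> s.
  move=> [/(phi_fibreE _ t)[w yw es] Ss]; split; last first.
    by apply/eqP; rewrite es; apply: hyp_neq_pi.
  have w0 := yof_neq0 yw; exists w; split=> //; apply: cone_plane => //.
  by apply/(Sigma_cone) => //; rewrite -es.
move=> [[w [w0 pw es]] /eqP spi].
have yw : yof w != 0.
  by apply: (hyp_neq0_yof (E := E) (u0 := u0) (u1 := u1) t w0); rewrite -es.
split; first by apply/(phi_fibreE _ t); exists w.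
by rewrite es; apply/(Sigma_cone) => //; apply: plane_cone.
Qed.

Lemma Sigma_lines H : pencil pi H -> exists2 L, is_line k L &
  phi_fibre pi H `&` Sigma = L \/ phi_fibre pi H `&` Sigma = L `\ pi.
Proof.
move=> /(pencilE)[t0 [t1 [t ->]]]; exists (member_line t0 t1).
  exact: is_line_member_line.
by right; apply: fibre_member_line.
Qed.

Lemma member_off_pi s : (Sigma `\ pi) s <-> exists t0 t1 w,
  [/\ nz2 t0 t1, yof w != 0, plane t0 t1 w & s = hyp (B t0 t1) w].
Proof.
split=> [[Ss /eqP spi]|[t0 [t1 [w [t yw pw ->]]]]].
  have [t0 [t1 [w [t w0 es]]]] := Sigma_param Ss.
  have yw : yof w != 0.
    by apply: (hyp_neq0_yof (E := E) (u0 := u0) (u1 := u1) t w0); rewrite -es.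
  exists t0, t1, w; split=> //; apply: cone_plane => //.
  by apply/(Sigma_cone) => //; rewrite -es.
split; last by apply/eqP; apply: hyp_neq_pi.
by apply/(Sigma_cone) => //; [exact: yof_neq0|exact: plane_cone].
Qed.

(** The pencil is a line in its own Plücker space: the minors of [Hmx t0 t1] are linear and
    injective in t, so a left inverse of this matrix recovers t. *)
Definition pencil_minors : 'M[K]_(1 + 1, #|pidx k.+1 k.+2|) := col_mx (minors (B 1 0)) (minors (B 0 1)).

Lemma pencil_minorsE (t0 t1 : K) : row_mx t0%:M t1%:M *m pencil_minors = minors (B t0 t1).
Proof. by rewrite mul_row_col !mul_scalar_mx -minorsB. Qed.

Lemma row_free_pencil_minors : row_free pencil_minors.
Proof.
apply: inj_row_free => u; rewrite [u]row11E pencil_minorsE => /(minorsB_rank frame)[-> ->].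
by apply/eqP; rewrite row11_eq0 !eqxx.
Qed.

Lemma pencil_plucker t0 t1 : nz2 t0 t1 -> plucker k.+1 (rowvs (B t0 t1)) = <[minors (B t0 t1)]>%VS.
Proof. by move=> t; rewrite (@plucker_rowvs _ k.+1) //; apply: row_free_Hmx. Qed.

Lemma pencil_rowvs t0 t1 : nz2 t0 t1 -> pencil pi (rowvs (B t0 t1)).
Proof. by move=> t; apply/(pencilE); exists t0, t1. Qed.

Lemma alpha_hyp t0 t1 w : nz2 t0 t1 -> yof w != 0 ->
  alpha pi (hyp (B t0 t1) w) = rowvs (B t0 t1).
Proof. exact: hyp_add_pi. Qed.

Lemma pencil_isomorphic : isomorphic k.+1 1 (pencil pi) (@grass K 1 2).
Proof.
have [f hf] : exists f : {vspace 'rV[K]_k.+2} -> {vspace 'rV[K]_2}, forall H, pencil pi H ->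
    exists t0 t1, [/\ nz2 t0 t1, H = rowvs (B t0 t1) & f H = <[row_mx t0%:M t1%:M : 'rV_(1 + 1)]>%VS].
  suff /boolp.choice[f hf] : forall H, exists x : {vspace 'rV[K]_2}, pencil pi H ->
    exists t0 t1, [/\ nz2 t0 t1, H = rowvs (B t0 t1) & x = <[row_mx t0%:M t1%:M : 'rV_(1 + 1)]>%VS].
    by exists f.
  move=> H; have [/(pencilE)[t0 [t1 [t eH]]]|] := pselect (pencil pi H); last by exists 0%VS.
  by eexists => _; exists t0, t1.
have [g hg] : exists g : {vspace 'rV[K]_2} -> {vspace 'rV[K]_k.+2}, forall x, grass 1 x ->
    exists t0 t1, [/\ nz2 t0 t1, g x = rowvs (B t0 t1) & x = <[row_mx t0%:M t1%:M : 'rV_(1 + 1)]>%VS].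
  suff /boolp.choice[g hg] : forall x : {vspace 'rV[K]_2}, exists H, grass 1 x ->
    exists t0 t1, [/\ nz2 t0 t1, H = rowvs (B t0 t1) & x = <[row_mx t0%:M t1%:M : 'rV_(1 + 1)]>%VS].
    by exists g.
  move=> x; have [/grass1_line[v v0 ex]|] := pselect (grass 1 x); last by exists 0%VS.
  eexists => _; exists (lsubmx (v : 'rV_(1 + 1)) 0 0), (rsubmx (v : 'rV_(1 + 1)) 0 0).
  split; [|reflexivity|by rewrite -row11E].
  by have := v0; rewrite {1}(row11E v) row11_eq0 negb_and.
have nzrow (t0 t1 : K) : nz2 t0 t1 -> row_mx t0%:M t1%:M != 0 :> 'rV[K]_(1 + 1).
  by rewrite row11_eq0 negb_and.
have inj (t0 t1 s0 s1 : K) : nz2 t0 t1 ->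
    <[row_mx t0%:M t1%:M : 'rV_(1 + 1)]>%VS = <[row_mx s0%:M s1%:M : 'rV_(1 + 1)]>%VS ->
    exists c, [/\ c != 0, t0 = c * s0 & t1 = c * s1].
  move=> t e; have : row_mx t0%:M t1%:M \in <[row_mx s0%:M s1%:M : 'rV[K]_(1 + 1)]>%VS.
    by rewrite -e memv_line.
  move=> /vlineP[c]; rewrite scale_row_mx !scale_scalar_mx => /eq_row_mx[].
  move=> /matrixP/(_ 0 0) + /matrixP/(_ 0 0); rewrite !mxE !eqxx !mulr1n => e0 e1.
  exists c; split=> //; apply: contraTneq t => c0.
  by rewrite e0 e1 c0 !mul0r /nz2 eqxx.
exists f, g; split.
- apply: morphism_hp => [H /hf[t0 [t1 [t _ ->]]]|H0 pH0]; first by apply: dim_line; apply: nzrow.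
  have /row_freeP[L hL] := row_free_pencil_minors.
  exists 1%N, (fun v => minors (v *m L : 'rV[K]_2)); split.
  + by move=> j; apply: (hform_ext (hform_lin L (pcols j 0))) => v; rewrite minors1E.
  + have [t0 [t1 [t -> _]]] := hf _ pH0; exists (minors (B t0 t1)); first exact: pencil_plucker.
    rewrite -pencil_minorsE -mulmxA hL mulmx1; apply: minors_neq0; apply: row_free_rV.
    exact: nzrow.
  + move=> H /hf[t0 [t1 [t eH ->]]]; exists (minors (B t0 t1)); first by rewrite eH pencil_plucker.
    by rewrite -pencil_minorsE -mulmxA hL mulmx1 plucker1 // nzrow.
- apply: morphism_hp => [x /hg[t0 [t1 [t -> _]]]|x0 gx0]; first exact: pencil_rowvs.
  have /boolp.choice[L hL] : forall j : 'I_2, exists phi : 'cV[K]_#|pidx 1 2|,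
    forall A : 'rV[K]_2, (minors A *m phi) 0 0 = A 0 j.
    move=> j; have [phi hphi] := Cauchy_Binet (delta_mx j (0 : 'I_1) : 'M[K]_(2, 1)).
    by exists phi => A; rewrite hphi det_mx11 -colE mxE.
  pose LL : 'M[K]_(#|pidx 1 2|, 1 + 1) := \matrix_(i, j) L j i 0.
  have hLL (A : 'rV[K]_2) : minors A *m LL = A.
    by apply/rowP => j; rewrite -[RHS]hL [LHS]mxE [RHS]mxE; apply: eq_bigr => i _; rewrite [X in _ * X]mxE.
  exists 1%N, (fun v => v *m LL *m pencil_minors); split.
  + by move=> j; apply: (hform_ext (hform_lin (LL *m pencil_minors) j)) => v; rewrite mulmxA.
  + have [t0 [t1 [t _ ->]]] := hg _ gx0; exists (minors (row_mx t0%:M t1%:M : 'rV[K]_(1 + 1))).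
      by rewrite plucker1 // nzrow.
    by rewrite hLL pencil_minorsE (@minors_neq0 _ k.+1) // row_free_Hmx.
  + move=> x /hg[t0 [t1 [t -> ->]]]; exists (minors (row_mx t0%:M t1%:M : 'rV[K]_(1 + 1))).
      by rewrite plucker1 // nzrow.
    by rewrite hLL pencil_minorsE pencil_plucker.
- move=> H /hf[t0 [t1 [t eH ->]]].
  have [s0 [s1 [s -> e]]] := hg _ (dim_line (nzrow _ _ t)).
  by have [c [c0 e0 e1]] := inj _ _ _ _ t e; rewrite eH e0 e1 rowvsBZ.
- move=> x /hg[t0 [t1 [t -> ex]]].
  have [s0 [s1 [s e ->]]] := hf _ (pencil_rowvs t).
  have [c [c0 e0 e1]] := rowvsB_inj frame t e.
  by rewrite ex e0 e1 -!scale_scalar_mx -scale_row_mx vlineZ.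
Qed.

(** Near a member with y_i nonzero, the Plücker entries t0 y_i and t1 y_i give the hyperplane H_t by
    linear forms. *)
Lemma alpha_morphism : morphism k k.+1 (Sigma `\ pi) (pencil pi) (alpha pi).
Proof.
apply: morphism_hp => [s /member_off_pi[t0 [t1 [w [t yw _ ->]]]]|s0 /member_off_pi].
  by rewrite alpha_hyp //; apply: pencil_rowvs.
move=> [s0' [s1' [w0 [s yw0 _ es0]]]]; have [i yi] := rV_neq0_ex yw0.
pose g v := row_mx (zcoord false v 0 i)%:M (zcoord true v 0 i)%:M *m pencil_minors.
have gE t0 t1 w : g (psi (B t0 t1) w) = yof w 0 i *: minors (B t0 t1).
  rewrite /g !zcoord_entry -pencil_minorsE scalemxAl; congr (_ *m _).
  by rewrite scale_row_mx !scale_scalar_mx.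
exists 1%N, g; split.
- move=> j; apply: (hform_ext (f := fun v => zcoord false v 0 i * minors (B 1 0) 0 j +
    zcoord true v 0 i * minors (B 0 1) 0 j)); last first.
    by move=> v; rewrite /g mul_row_col !mul_scalar_mx [RHS]mxE; congr (_ + _); rewrite [RHS]mxE.
  apply: hformD; (apply: hform_ext; last by move=> v; rewrite mulrC); apply: hformZ; exact: hform_zcoord.
- exists (psi (B s0' s1') w0).
    by rewrite es0 plucker_hyp ?row_free_Hmx // yof_neq0.
  by rewrite gE scaler_eq0 negb_or yi (@minors_neq0 _ k.+1) // row_free_Hmx.
- move=> y /member_off_pi[t0 [t1 [w [t yw _ ->]]]]; exists (psi (B t0 t1) w).
    by rewrite plucker_hyp ?row_free_Hmx // yof_neq0.
  rewrite gE scaler_eq0 negb_or => /andP[wi _].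
  by rewrite alpha_hyp // pencil_plucker // vlineZ.
Qed.

(** The functionals with y = 0 are the multiples of the vertex, so they cannot fill a plane. *)
Lemma plane_off_pi t0 t1 : nz2 t0 t1 -> exists2 w, plane t0 t1 w & yof w != 0.
Proof.
move=> t; have ip := indPQ t.
have PP : plane t0 t1 (bP t0 t1) by exists 1, 0; rewrite scale1r scale0r addr0.
have PQ : plane t0 t1 (bQ t0 t1) by exists 0, 1; rewrite scale1r scale0r add0r.
have [yP|] := eqVneq (yof (bP t0 t1)) 0; last by exists (bP t0 t1).
have [yQ|] := eqVneq (yof (bQ t0 t1)) 0; last by exists (bQ t0 t1).
have P0 := indep2_neq0 ip; exfalso.
have [|_ /eqP] := ip (cof (bQ t0 t1)) (- cof (bP t0 t1)).
  apply: wvP; first by rewrite /cof !mxE; ring.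
  rewrite [LHS]linearP /= linearZ /= [rsubmx (bP _ _)]yP [rsubmx (bQ _ _)]yQ.
  by rewrite !scaler0 addr0 /yof linear0.
rewrite oppr_eq0 => /eqP cP; move/eqP: P0; apply.
by rewrite (wvE (bP t0 t1)) cP yP; apply/eqP; rewrite wv_eq0 !eqxx.
Qed.

(** The minors of [line_mx] are forms of degree a + b in t, and t is linear in the Plücker vector of
    H. *)
Lemma line_family : exists lam : {vspace 'rV[K]_k.+2} -> {vspace 'rV[K]_N},
  morphism k.+1 2 (pencil pi) (@grass K 2 N) lam /\
  forall t0 t1, nz2 t0 t1 -> lam (rowvs (B t0 t1)) = rowvs (line_mx t0 t1).
Proof.
have [lam hlam] : exists lam : {vspace 'rV[K]_k.+2} -> {vspace 'rV[K]_N}, forall H, pencil pi H ->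
    exists t0 t1, [/\ nz2 t0 t1, H = rowvs (B t0 t1) & lam H = rowvs (line_mx t0 t1)].
  suff /boolp.choice[f hf] : forall H, exists x : {vspace 'rV[K]_N}, pencil pi H ->
    exists t0 t1, [/\ nz2 t0 t1, H = rowvs (B t0 t1) & x = rowvs (line_mx t0 t1)] by exists f.
  move=> H; have [/(pencilE)[t0 [t1 [t eH]]]|] := pselect (pencil pi H); last by exists 0%VS.
  by eexists => _; exists t0, t1.
have lamE t0 t1 : nz2 t0 t1 -> lam (rowvs (B t0 t1)) = rowvs (line_mx t0 t1).
  move=> t; have [s0 [s1 [s e ->]]] := hlam _ (pencil_rowvs t).
  by have [c [c0 -> ->]] := rowvsB_inj frame t e; rewrite rowvs_line_mxZ.
exists lam; split=> //.
apply: morphism_hp => [H /hlam[t0 [t1 [t _ ->]]]|H0 pH0].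
  exact: (dim_rowvs (row_free_line_mx t)).
have /row_freeP[L hL] := row_free_pencil_minors.
pose s0 (v : 'rV[K]_#|pidx k.+1 k.+2|) := (v *m L) 0 (lshift 1 0).
pose s1 (v : 'rV[K]_#|pidx k.+1 k.+2|) := (v *m L) 0 (rshift 1 0).
have sE t0 t1 : s0 (minors (B t0 t1)) = t0 /\ s1 (minors (B t0 t1)) = t1.
  by rewrite /s0 /s1 -pencil_minorsE -mulmxA hL mulmx1 row_mxEl row_mxEr !mxE !eqxx !mulr1n.
have hs0 : hform 1 s0 by apply: hform_lin.
have hs1 : hform 1 s1 by apply: hform_lin.
pose ee (l : 'I_(1 + 1)) := match fintype.split l with inl _ => a | inr _ => b end.
exists (\sum_l ee l)%N, (fun v => minors (line_mx (s0 v) (s1 v))); split.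
- move=> j; apply: (hform_ext (f := fun v => \det (colsub (pcols j) (line_mx (s0 v) (s1 v))))); last by move=> v; rewrite mxE.
  apply: hform_det => l c; rewrite /ee; case: splitP => l' el.
    apply: (hform_ext (hform_psi_bvec a p (pcols j c) hs0 hs1)) => v.
    have -> : l = lshift 1 l' by apply: val_inj; rewrite /= el.
    by rewrite [RHS]mxE col_mxEu (ord1 l').
  apply: (hform_ext (hform_psi_bvec b q (pcols j c) hs0 hs1)) => v.
  have -> : l = rshift 1 l' by apply: val_inj; rewrite /= el.
  by rewrite [RHS]mxE col_mxEd (ord1 l').
- have [t0 [t1 [t -> _]]] := hlam _ pH0; exists (minors (B t0 t1)); first exact: pencil_plucker.
  by have [-> ->] := sE t0 t1; apply: (@minors_neq0 _ 2); apply: row_free_line_mx.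
- move=> H /hlam[t0 [t1 [t -> _]]]; exists (minors (B t0 t1)); first exact: pencil_plucker.
  move=> _; have [-> ->] := sE t0 t1; rewrite lamE //.
  by apply: (@plucker_rowvs _ 2); apply: row_free_line_mx.
Qed.

Lemma Sigma_ruling : rational_ruling k k.+1 Sigma pi (pencil pi) (alpha pi).
Proof.
split; [exact: pencil_isomorphic|exact: alpha_morphism| |].
  apply/seteqP; split=> H.
    move=> [s /member_off_pi[t0 [t1 [w [t yw _ ->]]]] <-].
    by rewrite alpha_hyp //; apply: pencil_rowvs.
  move=> /(pencilE)[t0 [t1 [t ->]]]; have [w pw yw] := plane_off_pi t.
  exists (hyp (B t0 t1) w); last exact: alpha_hyp.
  by apply/member_off_pi; exists t0, t1, w.
have [lam [mlam lamE]] := line_family; exists lam; split=> //.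
  apply/seteqP; split=> x.
    move=> [s Ss <-].
    have [t0 [t1 [w [t w0 es pw]]]] : exists t0 t1 w,
        [/\ nz2 t0 t1, w != 0, s = hyp (B t0 t1) w & plane t0 t1 w].
      (* Sigma contains [pi] or not; if it does, [vertex] supplies a line of the family through
         it. *)
      have [spi|/eqP spi] := eqVneq s pi.
        have [t0 [t1 [t pw]]] : exists t0 t1, nz2 t0 t1 /\ plane t0 t1 (wv 1 0).
          by apply: vertex; rewrite -spi.
        by exists t0, t1, (wv 1 0); split=> //; rewrite ?wv_eq0 ?oner_eq0 // hyp_pi ?oner_eq0.
      have [t0 [t1 [w [t yw pw es]]]] : exists t0 t1 w,
        [/\ nz2 t0 t1, yof w != 0, plane t0 t1 w & s = hyp (B t0 t1) w] by apply/member_off_pi.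
      by exists t0, t1, w; split=> //; apply: yof_neq0.
    exists (rowvs (B t0 t1)); first exact: pencil_rowvs.
    rewrite lamE // -plucker_member_line //; exists s => //; by exists w.
  move=> [H /(pencilE)[t0 [t1 [t ->]]]]; rewrite lamE // -plucker_member_line //.
  move=> [s [w [w0 pw es]] <-]; exists s => //; rewrite es.
  by apply/(Sigma_cone) => //; apply: plane_cone.
move=> H /(pencilE)[t0 [t1 [t ->]]]; have rB := row_free_Hmx frame t.
rewrite lamE // -plucker_member_line //; apply/seteqP; split=> x.
  move=> [s [Ss /= es] <-].
  have [w [w0 pw es']] : member_line t0 t1 s.
    suff : (member_line t0 t1 `\ pi) s by case.
    rewrite -fibre_member_line //; split; last by case: Ss.
    have [s0 [s1 [w [ss yw pw es']]]] := (member_off_pi s).1 Ss.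
    apply/(phi_fibreE _ t).
    have : rowvs (B s0 s1) = rowvs (B t0 t1) by rewrite -es es' alpha_hyp.
    move=> /esym/(rowvsB_inj frame t)[c [c0 e0 e1]].
    exists (wv (c * cof w) (yof w)); first by rewrite yof_wv.
    by rewrite e0 e1 hyp_rescale // -wvE.
  split; first by exists s => //; exists w.
  (* Writing pi as the member (1, 0) over the same t makes the injectivity of [plucker] on that
     fibre applicable. *)
  move=> /= e; case: Ss => _ /=; apply.
  rewrite es'; have piE : pi = hyp (B t0 t1) (wv 1 0) by rewrite hyp_pi ?oner_eq0.
  have w10 : wv 1 0 != 0 :> 'rV[K]_(1 + k) by rewrite wv_eq0 oner_eq0.
  move: e; rewrite es' {1}piE => e; have [c c0 ew] := plucker_hyp_inj rB w0 w10 e.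
  by rewrite piE ew hypZ.
move=> [[s [w [w0 pw es]] <-] /= spi]; exists s => //.
have yw : yof w != 0.
  apply: (hyp_neq0_yof (E := E) (u0 := u0) (u1 := u1) t w0); rewrite -es.
  by apply/eqP => e; apply: spi; rewrite e.
split; first by apply/member_off_pi; exists t0, t1, w.
by rewrite /= es alpha_hyp.
Qed.

End LineFamily.
End Setting.

Theorem proposition2p9 (R : realType) (r : nat) (hr : (1 <= r)%N)
    (Sigma : set {vspace 'rV[R[i]]_r.+3}) (pi : {vspace 'rV[R[i]]_r.+3})
    (hSigma : congruence Sigma) (hpi : grass r.+1 pi)
    (hSigmapi : Sigma `<=` Omega pi) :
  (has_order Sigma 1 <->
     forall H, pencil pi H ->
       exists2 L, is_line r.+1 L &
         phi_fibre pi H `&` Sigma = L \/ phi_fibre pi H `&` Sigma = L `\ pi) /\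
  (has_order Sigma 1 ->
     rational_ruling r.+1 r.+2 Sigma pi (pencil pi) (alpha pi)).
Proof.
have [E [u0 [u1 [frame epi]]]] := exists_frame hpi.
case: hSigma => -[I [homI SigmaI]] irr _.
rewrite -epi in hSigmapi *.
have forward : has_order Sigma 1 -> (forall H, pencil (rowvs E) H ->
       exists2 L, is_line r.+1 L &
         phi_fibre (rowvs E) H `&` Sigma = L \/ phi_fibre (rowvs E) H `&` Sigma = L `\ rowvs E) /\
     rational_ruling r.+1 r.+2 Sigma (rowvs E) (pencil (rowvs E)) (alpha (rowvs E)).
  move=> /(order_form frame)[d [G [hG G1 hGu]]].
  have [a [b [p [q [sp sq ind pXX]]]]] := plane_family frame homI SigmaI hSigmapi hG G1 hGu.
  have [Tc [T0 [T1 coords]]] := psi_coordinates frame.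
  have Xp := Sigma_on_plane frame homI SigmaI hSigmapi irr sp sq ind pXX coords hG G1 hGu.
  have vert := vertex_on_plane frame homI SigmaI hSigmapi irr sp sq ind pXX coords Xp.
  split; first exact: (Sigma_lines frame homI SigmaI ind pXX Xp).
  exact: (Sigma_ruling frame homI SigmaI hSigmapi sp sq ind pXX coords Xp vert).
split; last by move=> /forward[].
split; first by move=> /forward[].
exact: (lines_has_order frame homI SigmaI hSigmapi).
Qed.
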